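(* Suppose Assumptions A and B (stated in the context) hold. Let $\theta_1\in(0,1)$, $\theta_2\in(0,\theta_1/3)$ and $\theta_3\in(\theta_2,(\theta_1-\theta_2)/2]$ be constants. For any $T\in\mathbb{N}_+$, let $\boldsymbol{x}_T=(x_1,\dots,x_T)$ be the sequence generated by Algorithm 1 (described in the context) with, for all $i\in[n]$ and $t\in\mathbb{N}_+$, $$\alpha_{i,t}=\frac{r_i^2}{4mp_i^2F_{g_i}^2t^{\theta_1}},\quad \beta_{i,t}=\frac{2}{t^{\theta_2}},\quad \gamma_{i,t}=\frac{1}{t^{1-\theta_2}},\quad \xi_{i,t}=\frac{1}{(t+1)^{\theta_3}},\quad \delta_{i,t}=\frac{r_i}{(t+1)^{\theta_3}}.$$ Then, for any comparator sequence $\boldsymbol{y}_T\in\mathcal{X}_T$, $$\mathbf{E}[\mathrm{Reg}(\boldsymbol{x}_T,\boldsymbol{y}_T)]\le C_1T^{\max\{\theta_1,\,1-\theta_1+2\theta_3,\,1-\theta_3+\theta_2\}}+\max_{i\in[n]}\Big\{\frac{8mp_i^2F_{g_i}^2R_i}{r_i^2}\Big\}T^{\theta_1}V(\boldsymbol{y}_T),$$ $$\mathbf{E}\Big[\Big\|\Big[\sum_{t=1}^Tg_t(x_t)\Big]_+\Big\|\Big]\le\sqrt{C_2}\,T^{1-\theta_2/2},$$ where $$V(\boldsymbol{y}_T)=\sum_{t=1}^{T-1}\sum_{i=1}^n\|y_{i,t+1}-y_{i,t}\|,$$ $$C_1=\sum_{i=1}^n\Big(\frac{mF_gG_{g_i}(2r_i+R_i)}{1-\theta_3+\theta_2}+\frac{G_{f_i}(2r_i+R_i)}{1-\theta_3}+\frac{8mp_i^2F_{g_i}^2R_i^2}{r_i^2}+\frac{F_{f_i}^2}{4mF_{g_i}^2(1-\theta_1+2\theta_3)}+\frac{16mp_i^2F_{g_i}^2R_i^2}{r_i^2}\Big)+\frac{C_0}{\theta_2},$$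 $$C_2=C_{2,1}\Big(2\sum_{i=1}^nF_{f_i}+C_1\Big),\qquad C_{2,1}=2n\Big(1+\max_{i\in[n]}\Big\{\frac{F_{f_i}^2}{F_{g_i}^2(1-\theta_1+2\theta_3)}\Big\}+\frac{1}{1-\theta_2}\Big),$$ $$F_g=\max_{i\in[n]}F_{g_i},\quad C_0=\frac{6mn^2F_g^2\tau}{1-\lambda}+2mnF_g^2,\quad \tau=\Big(1-\frac{w}{2n^2}\Big)^{-2},\quad \lambda=\Big(1-\frac{w}{2n^2}\Big)^{1/\iota}.$$
   Context: Notation. $[n]=\{1,\dots,n\}$; $\mathbb{N}_+$ is the set of positive integers; $\|\cdot\|$ is the Euclidean norm; $\mathbb{B}^p,\mathbb{S}^p$ are the unit ball and unit sphere of $\mathbb{R}^p$; $\mathcal{P}_{\mathbb{K}}$ is Euclidean projection on $\mathbb{K}$; $[\cdot]_+=\mathcal{P}_{\mathbb{R}^m_+}$; vector inequalities are componentwise; $(1-\xi)\mathbb{K}=\{(1-\xi)x:x\in\mathbb{K}\}$. Problem. There are $n$ learners and an adversary. Learner $i$ has a decision set $\mathbb{X}_i\subseteq\mathbb{R}^{p_i}$; $\mathbb{X}=\mathbb{X}_1\times\cdots\times\mathbb{X}_n$. At the beginning of each round $t$ the adversary chooses $f_{i,t}:\mathbb{X}_i\to\mathbb{R}$ and $g_{i,t}:\mathbb{X}_i\to\mathbb{R}^m$, $i\in[n]$, possibly depending on the past decisions $x_1,\dots,x_{t-1}$ but not on the current decision; then learners choose $x_{i,t}\in\mathbb{X}_i$.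 Write $x_t=(x_{1,t},\dots,x_{n,t})$, $f_t(x_t)=\sum_{i=1}^nf_{i,t}(x_{i,t})$, $g_t(x_t)=\sum_{i=1}^ng_{i,t}(x_{i,t})$. For sequences $\boldsymbol{x}_T=(x_1,\dots,x_T)$, $\boldsymbol{y}_T=(y_1,\dots,y_T)$ with $y_t=(y_{1,t},\dots,y_{n,t})$, $\mathrm{Reg}(\boldsymbol{x}_T,\boldsymbol{y}_T)=\sum_{t=1}^Tf_t(x_t)-\sum_{t=1}^Tf_t(y_t)$. Let $\mathcal{X}_T=\{(x_1,\dots,x_T):x_t\in\mathbb{X},\ g_t(x_t)\le\mathbf{0}_m,\ t\in[T]\}$ and $\check{\mathcal{X}}_T=\{(x,\dots,x):x\in\mathbb{X},\ g_t(x)\le\mathbf{0}_m,\ t\in[T]\}\subseteq\mathcal{X}_T$; both are assumed nonempty for every $T\in\mathbb{N}_+$. Graph. $\mathcal{G}_t=(\mathcal{V},\mathcal{E}_t)$ is a time-varying directed graph on $\mathcal{V}=[n]$; the mixing matrix $W_t\in\mathbb{R}^{n\times n}$ satisfies $[W_t]_{ij}>0$ if $(j,i)\in\mathcal{E}_t$ or $i=j$, and $[W_t]_{ij}=0$ otherwise. Assumption A. For every $t\in\mathbb{N}_+$: (a) there is a constant $w\in(0,1)$ (independent of $t$) with $[W_t]_{ij}\ge w$ whenever $[W_t]_{ij}>0$; (b) $W_t$ is doubly stochastic; (c) there is an integer $\iota>0$ (independent of $t$) such that $(\mathcal{V},\cup_{l=0}^{\iota-1}\mathcal{E}_{t+l})$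 is strongly connected. Assumption B. For each $i\in[n]$: (a) $\mathbb{X}_i$ is convex and closed and $r_i\mathbb{B}^{p_i}\subseteq\mathbb{X}_i\subseteq R_i\mathbb{B}^{p_i}$ for some $r_i,R_i>0$; (b) $f_{i,t}$ and all components $[g_{i,t}]_j$, $j\in[m]$, are convex with $|f_{i,t}(x)|\le F_{f_i}$ and $|[g_{i,t}(x)]_j|\le F_{g_i}$ for all $t$, $j$, $x\in\mathbb{X}_i$, where $F_{f_i},F_{g_i}>0$ are constants; (c) $f_{i,t},g_{i,t}$ are differentiable with $\|\nabla f_{i,t}(x)\|\le G_{f_i}$ and $\|\nabla[g_{i,t}(x)]_j\|\le G_{g_i}$ for all $t$, $j$, $x\in\mathbb{X}_i$, where $G_{f_i},G_{g_i}>0$ are constants. Algorithm 1 (one-point bandit feedback), with sequences $\alpha_{i,t},\beta_{i,t},\gamma_{i,t},\xi_{i,t},\delta_{i,t}$. The vectors $u_{i,t}$, $i\in[n]$, $t\ge1$, are drawn independently and uniformly from $\mathbb{S}^{p_i}$. Initialize $z_{i,1}\in(1-\xi_{i,1})\mathbb{X}_i$, $x_{i,1}=z_{i,1}+\delta_{i,1}u_{i,1}$, $q_{i,1}=\mathbf{0}_m$. For $t\ge2$ and each $i\in[n]$: $\tilde q_{i,t}=\sum_{j=1}^n[W_{t-1}]_{ij}q_{j,t-1}$; $z_{i,t}=\mathcal{P}_{(1-\xi_{i,t})\mathbb{X}_i}(z_{i,t-1}-\alpha_{i,t}a_{i,t})$; $x_{i,t}=z_{i,t}+\delta_{i,t}u_{i,t}$;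 $q_{i,t}=[(1-\beta_{i,t}\gamma_{i,t})\tilde q_{i,t}+\gamma_{i,t}g_{i,t-1}(x_{i,t-1})]_+$; where $a_{i,t}=\hat\nabla_1f_{i,t-1}(z_{i,t-1})+(\hat\nabla_1g_{i,t-1}(z_{i,t-1}))^\top\tilde q_{i,t}$, $\hat\nabla_1f_{i,t}(z_{i,t})=\frac{p_i}{\delta_{i,t}}f_{i,t}(z_{i,t}+\delta_{i,t}u_{i,t})u_{i,t}$ and $\hat\nabla_1g_{i,t}(z_{i,t})=\frac{p_i}{\delta_{i,t}}g_{i,t}(z_{i,t}+\delta_{i,t}u_{i,t})u_{i,t}^\top\in\mathbb{R}^{m\times p_i}$. Expectations $\mathbf{E}$ are over the random vectors $u_{i,t}$. *)

(* Defs.v *)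
From HB Require Import structures.
From mathcomp Require Import all_boot all_order all_algebra.
From mathcomp Require Import all_classical all_reals all_analysis.

Set Implicit Arguments.
Unset Strict Implicit.
Unset Printing Implicit Defensive.

Import Order.TTheory GRing.Theory Num.Theory.
Import numFieldNormedType.Exports.

Local Open Scope classical_set_scope.
Local Open Scope ring_scope.

(* Vectors of R^p are row vectors.  The library norm on matrices is the sup
   norm, hence the explicit Euclidean norm; both induce the same topology, so
   [open] and [closed] have their usual meaning. *)
Definition inner (R : realType) (p : nat) (v w : 'rV[R]_p) : R :=
  \sum_(k < p) v ord0 k * w ord0 k.

Definition enorm (R : realType) (p : nat) (v : 'rV[R]_p) : R :=
  Num.sqrt (\sum_(k < p) v ord0 k ^+ 2).

Definition scaled_set (R : realType) (p : nat) (c : R) (K : set 'rV[R]_p) :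
    set 'rV[R]_p := (fun v => c *: v) @` K.

Definition unit_ball (R : realType) (p : nat) : set 'rV[R]_p :=
  [set v : 'rV[R]_p | enorm v <= 1].

Definition unit_sphere (R : realType) (p : nat) : set 'rV[R]_p :=
  [set v : 'rV[R]_p | enorm v = 1].

(* For K nonempty, closed and convex the minimizer selected by [xget] exists
   and is unique. *)
Definition proj (R : realType) (p : nat) (K : set 'rV[R]_p) (v : 'rV[R]_p) :
    'rV[R]_p :=
  xget 0 [set w | K w /\ forall w', K w' -> enorm (v - w) <= enorm (v - w')].

Definition pospart (R : realType) (m : nat) : 'rV[R]_m -> 'rV[R]_m :=
  proj [set w : 'rV[R]_m | forall j, 0 <= w ord0 j].

(* [d] is the gradient at [v] of a function whose domain is [X]: only the
   values of [f] on [X] matter.  It is unique when [X] is convex with nonempty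
   interior, including at boundary points. *)
Definition is_gradient (R : realType) (p : nat) (X : set 'rV[R]_p)
    (f : 'rV[R]_p -> R) (v d : 'rV[R]_p) : Prop :=
  forall eps : R, 0 < eps -> exists2 eta : R, 0 < eta &
    forall w, X w -> enorm (w - v) < eta ->
      `|f w - f v - inner d (w - v)| <= eps * enorm (w - v).

Definition profile (R : realType) (n : nat) (p : 'I_n -> nat) : Type :=
  forall i : 'I_n, 'rV[R]_(p i).

(* A sequence of joint decisions; rounds are numbered from 1, the entry of
   index 0 is never used. *)
Definition path_of (R : realType) (n : nat) (p : 'I_n -> nat) : Type :=
  nat -> profile R p.

(* The adversary is adaptive: its choice at round t is a function of the
   sequence of decisions.  That it only sees the decisions of the rounds
   1, ..., t-1 is part of [adapted] below. *)
Definition strategy (R : realType) (n : nat) (p : 'I_n -> nat) (V : Type) :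
    Type :=
  forall i : 'I_n, nat -> path_of R p -> 'rV[R]_(p i) -> V.

Definition past_in (R : realType) (n : nat) (p : 'I_n -> nat)
    (X : forall i : 'I_n, set 'rV[R]_(p i)) (t : nat) (h : path_of R p) : Prop :=
  forall (s : nat) (i : 'I_n), (1 <= s < t)%N -> X i (h s i).

(* The sigma-algebra, on pairs of a path h and a point v of R^(p i), generated
   by the coordinates of h 1, ..., h (t-1) and of v. *)
Definition past_sigma (R : realType) (n : nat) (p : 'I_n -> nat) (t : nat)
    (i : 'I_n) : set (set (path_of R p * 'rV[R]_(p i))) :=
  let D : Type := (path_of R p * 'rV[R]_(p i))%type in
  <<s [set B : set D |
         (exists (s : nat) (j : 'I_n) (k : 'I_(p j)) (C : set R),
            [/\ (1 <= s < t)%N, measurable C &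
                B = [set hv : D | C (hv.1 s j ord0 k)]])
      \/ (exists (k : 'I_(p i)) (C : set R),
            measurable C /\ B = [set hv : D | C (hv.2 ord0 k)])]>>.

(* The value chosen for round t is a jointly Borel function of the decisions of
   the rounds 1, ..., t-1 and of the point of evaluation.  In particular it
   does not depend on the entries of h of index >= t. *)
Definition adapted (R : realType) (n : nat) (p : 'I_n -> nat)
    (X : forall i : 'I_n, set 'rV[R]_(p i)) (f : strategy R p R) : Prop :=
  forall (i : 'I_n) (t : nat) (C : set R), (1 <= t)%N -> measurable C ->
    @past_sigma R n p t i [set hv : path_of R p * 'rV[R]_(p i) |
      [/\ past_in X t hv.1, X i hv.2 & C (f i t hv.1 hv.2)]].

Definition component (R : realType) (n m : nat) (p : 'I_n -> nat)
    (g : strategy R p 'rV[R]_m) (j : 'I_m) : strategy R p R :=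
  fun i t h v => g i t h v ord0 j.
Arguments component {R n m p} g j i t h v.

(* [E t j i] means that (j, i) is an edge of the graph at time t. *)
Definition mixing_matrix (R : realType) (n : nat) (E : nat -> rel 'I_n)
    (W : nat -> 'M[R]_n) : Prop :=
  forall (t : nat) (i j : 'I_n), (1 <= t)%N ->
    (E t j i || (i == j) -> 0 < W t i j) /\
    (~~ (E t j i || (i == j)) -> W t i j = 0).

Definition doubly_stochastic (R : realType) (n : nat) (A : 'M[R]_n) : Prop :=
  [/\ forall i j, 0 <= A i j,
      forall i, \sum_(j < n) A i j = 1 &
      forall j, \sum_(i < n) A i j = 1].

Definition strongly_connected (n : nat) (e : rel 'I_n) : Prop :=
  forall a b : 'I_n, connect e a b.

Definition assumption_A (R : realType) (n : nat) (E : nat -> rel 'I_n)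
    (W : nat -> 'M[R]_n) (w : R) (iota : nat) : Prop :=
  [/\ 0 < w < 1, (0 < iota)%N &
    forall t : nat, (1 <= t)%N ->
      [/\ forall i j, 0 < W t i j -> w <= W t i j,
          doubly_stochastic (W t) &
          strongly_connected
            [rel a b | [exists l : 'I_iota, E (t + l)%N a b]]]].

Definition regular_on (R : realType) (p : nat) (X : set 'rV[R]_p)
    (F G : R) (f : 'rV[R]_p -> R) : Prop :=
  [/\ convex_function (E := 'rV[R]_p) X f,
      forall v, X v -> `|f v| <= F &
      forall v, X v -> exists2 d, is_gradient X f v d & enorm d <= G].

Definition assumption_B (R : realType) (n m : nat) (p : 'I_n -> nat)
    (X : forall i : 'I_n, set 'rV[R]_(p i)) (r Rad Ff Fg Gf Gg : 'I_n -> R)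
    (f : strategy R p R) (g : strategy R p 'rV[R]_m) : Prop :=
  forall i : 'I_n,
    [/\ convex_set (M := 'rV[R]_(p i)) (X i) /\ closed (X i),
        0 < r i /\ 0 < Rad i,
        scaled_set (r i) (@unit_ball R (p i)) `<=` X i /\
          X i `<=` scaled_set (Rad i) (@unit_ball R (p i)),
        [/\ 0 < Ff i, 0 < Fg i, 0 < Gf i & 0 < Gg i] &
        forall (t : nat) (h : path_of R p), (1 <= t)%N -> past_in X t h ->
          regular_on (X i) (Ff i) (Gf i) (f i t h) /\
          forall j : 'I_m,
            regular_on (X i) (Fg i) (Gg i) (component g j i t h)].

Definition borel (R : realType) (p : nat) : set (set 'rV[R]_p) :=
  <<s [set A : set 'rV[R]_p | open A]>>.

Definition random_vector (d : measure_display) (Omega : measurableType d)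
    (R : realType) (p : nat) (u : Omega -> 'rV[R]_p) : Prop :=
  forall A, borel A -> measurable (u @^-1` A).

(* The uniform distribution on the unit sphere is its unique Borel probability
   measure that is invariant under all orthogonal transformations. *)
Definition uniform_on_sphere (d : measure_display) (Omega : measurableType d)
    (R : realType) (P : probability Omega R) (p : nat)
    (u : Omega -> 'rV[R]_p) : Prop :=
  [/\ random_vector u,
      forall omega, unit_sphere (u omega) &
      forall (Q : 'M[R]_p) (A : set 'rV[R]_p), Q *m Q^T = 1%:M -> borel A ->
        P [set omega | A (u omega *m Q)] = P [set omega | A (u omega)]].

(* Mutual independence of the vectors u_{i,t}, i in [n], t >= 1, indexed by the
   pairs k = (i, t). *)
Definition independent_vectors (d : measure_display) (Omega : measurableType d)
    (R : realType) (P : probability Omega R) (n : nat) (p : 'I_n -> nat)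
    (u : Omega -> path_of R p) : Prop :=
  forall (S : seq ('I_n * nat)) (A : forall k : 'I_n * nat, set 'rV[R]_(p k.1)),
    uniq S -> (forall k, k \in S -> (1 <= k.2)%N) -> (forall k, borel (A k)) ->
    P [set omega | forall k, k \in S -> A k (u omega k.2 k.1)]
      = (\prod_(k <- S) P [set omega | A k (u omega k.2 k.1)])%E.

Definition grad_est_f (R : realType) (p : nat) (f : 'rV[R]_p -> R) (delta : R)
    (z u : 'rV[R]_p) : 'rV[R]_p :=
  (p%:R / delta * f (z + delta *: u)) *: u.

Definition grad_est_g (R : realType) (m p : nat) (g : 'rV[R]_p -> 'rV[R]_m)
    (delta : R) (z u : 'rV[R]_p) : 'M[R]_(m, p) :=
  (p%:R / delta) *: ((g (z + delta *: u))^T *m u).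

(* One run of the algorithm.  As vectors are rows, the transposed estimated
   Jacobian applied to q is written q *m grad_est_g. *)
Definition algorithm1 (R : realType) (n m : nat) (p : 'I_n -> nat)
    (X : forall i : 'I_n, set 'rV[R]_(p i)) (W : nat -> 'M[R]_n)
    (alpha beta gamma xi delta : 'I_n -> nat -> R)
    (f : strategy R p R) (g : strategy R p 'rV[R]_m)
    (u z x : path_of R p) (q : nat -> 'I_n -> 'rV[R]_m) : Prop :=
  [/\ forall i, scaled_set (1 - xi i 1%N) (X i) (z 1%N i),
      forall i, q 1%N i = 0,
      forall i t, (1 <= t)%N -> x t i = z t i + delta i t *: u t i &
      forall i t, (2 <= t)%N ->
        let qtilde := \sum_(j < n) W t.-1 i j *: q t.-1 j in
        let a :=
          grad_est_f (f i t.-1 x) (delta i t.-1) (z t.-1 i) (u t.-1 i)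
          + qtilde *m
            grad_est_g (g i t.-1 x) (delta i t.-1) (z t.-1 i) (u t.-1 i) in
        z t i = proj (scaled_set (1 - xi i t) (X i))
                     (z t.-1 i - alpha i t *: a) /\
        q t i = pospart ((1 - beta i t * gamma i t) *: qtilde
                         + gamma i t *: g i t.-1 x (x t.-1 i))].

(* [x] is the path of decisions to which the adversary reacts. *)
Definition feasible (R : realType) (n m : nat) (p : 'I_n -> nat)
    (X : forall i : 'I_n, set 'rV[R]_(p i)) (g : strategy R p 'rV[R]_m)
    (x : path_of R p) (T : nat) (y : path_of R p) : Prop :=
  forall t, (1 <= t <= T)%N ->
    (forall i, X i (y t i)) /\
    (forall j : 'I_m, (\sum_(i < n) g i t x (y t i)) ord0 j <= 0).

(* Comparators are deterministic sequences, whereas the constraints of an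
   adaptive adversary are random: feasibility is almost sure. *)
Definition comparators (d : measure_display) (Omega : measurableType d)
    (R : realType) (P : probability Omega R) (n m : nat) (p : 'I_n -> nat)
    (X : forall i : 'I_n, set 'rV[R]_(p i)) (g : strategy R p 'rV[R]_m)
    (x : Omega -> path_of R p) (T : nat) : set (path_of R p) :=
  [set y | {ae P, forall omega, feasible X g (x omega) T y}].

Definition static_comparators (d : measure_display) (Omega : measurableType d)
    (R : realType) (P : probability Omega R) (n m : nat) (p : 'I_n -> nat)
    (X : forall i : 'I_n, set 'rV[R]_(p i)) (g : strategy R p 'rV[R]_m)
    (x : Omega -> path_of R p) (T : nat) : set (path_of R p) :=
  [set y | comparators P X g x T y /\
           exists v : profile R p, forall t, (1 <= t <= T)%N -> y t = v].

Definition regret (R : realType) (n : nat) (p : 'I_n -> nat) (f : strategy R p R)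
    (x y : path_of R p) (T : nat) : R :=
  \sum_(1 <= t < T.+1) \sum_(i < n) f i t x (x t i)
  - \sum_(1 <= t < T.+1) \sum_(i < n) f i t x (y t i).

Definition violation (R : realType) (n m : nat) (p : 'I_n -> nat)
    (g : strategy R p 'rV[R]_m) (x : path_of R p) (T : nat) : R :=
  enorm (pospart (\sum_(1 <= t < T.+1) \sum_(i < n) g i t x (x t i))).

Definition path_length (R : realType) (n : nat) (p : 'I_n -> nat)
    (y : path_of R p) (T : nat) : R :=
  \sum_(1 <= t < T) \sum_(i < n) enorm (y t.+1 i - y t i).

(* Only used for n >= 1 and nonnegative F, where the default value 0 is
   harmless. *)
Definition max_over (R : realType) (n : nat) (F : 'I_n -> R) : R :=
  \big[Num.max/0]_(i < n) F i.

(* Main.v *)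
Require Import Defs.
From HB Require Import structures.
From mathcomp Require Import all_boot all_order all_algebra.
From mathcomp Require Import all_classical all_reals all_analysis.
From mathcomp Require Import measurable_realfun.
From mathcomp Require Import ring lra zify.

Set Implicit Arguments.
Unset Strict Implicit.
Unset Printing Implicit Defensive.

Import Order.TTheory GRing.Theory Num.Theory.
Import numFieldNormedType.Exports.

Local Open Scope classical_set_scope.
Local Open Scope ring_scope.

(** The theorem follows from an inequality that holds along every run of the
    algorithm, in which the only random term left has an expectation of known
    sign.

    Along one run, the two gradient estimates of a learner add up to the
    one-point estimate for the Lagrangian, the loss plus the constraint
    functions weighted by the mixed multipliers.  The squared distances of the
    points [z] to the comparator, shrunk into the sets on which [z] is
    projected, telescope ([primal_sum]), and so do the squared distances of the
    multipliers to an arbitrary nonnegative vector [c] ([dual_sum]).  In the sum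
    of both ([run_bound]) the terms in the multipliers cancel:
    regret, plus the inner product of [c] with the total constraint value, minus
    a multiple of [T ^ (1 - theta2)] times the square of the norm of [c], is at
    most the announced right hand side minus the sum of the estimation gaps.
    Three terms need an argument of their own.

    - A comparator is feasible only for the sum of the constraints over the
      learners, whereas the multipliers of the learners differ.  The difference
      is the disagreement in a perturbed consensus iteration, which is
      proportional to the total perturbation ([total_disagreement]) because the
      distance to consensus contracts over each window of [iota] rounds.  For
      this, every gap between consecutive values is charged to the first agent
      that averages over values on both sides of it ([variance_loss_ge]).

    - The square of the norm of the gradient estimate grows like
      [t ^ (2 * theta3)] times the square of the norm of the multipliers.  The
      step size and the condition [theta3 <= (theta1 - theta2) / 2] let the
      regularization of the multipliers absorb it ([direction_cost]).

    - The estimation gap is the amount by which the gradient estimate, paired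
      with [z - y], exceeds the Lagrangian at [z] minus the Lagrangian at [y]
      minus the smoothing error.  Its expectation is nonnegative
      ([expected_gap_ge0]).  Classically the estimate is the gradient of an
      averaged function, by the divergence theorem.  Here the perturbation [u]
      is instead paired with its mirror image in the hyperplane orthogonal to
      [z - y]: convexity along the chord joining them gives a pointwise
      inequality ([one_point_pairing]), whose average follows from the
      invariance of the uniform distribution alone ([one_point_expectation]).
      The Lagrangian being random, this is applied conditionally on the past:
      the run up to round [t] is measurable with respect to the earlier
      perturbations ([trajectory_measurable]), of which the current one is
      independent, so the past may be frozen ([freeze_ge0]).

    Taking [c = 0] bounds the expected regret.  For the violation, a static
    comparator has path length zero, and taking [c] proportional to the positive
    part of the total constraint value bounds the second moment of the violation
    ([expected_sqr_violation]), hence its mean. *)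

(** * Euclidean geometry of row vectors *)

Lemma inner_mul (R : realType) (p : nat) (v w : 'rV[R]_p) :
  inner v w = (v *m w^T) ord0 ord0.
Proof. by rewrite /inner mxE; apply: eq_bigr => k _; rewrite mxE. Qed.

Lemma innerC (R : realType) (p : nat) (v w : 'rV[R]_p) : inner v w = inner w v.
Proof. by apply: eq_bigr => k _; rewrite mulrC. Qed.

Lemma innerDl (R : realType) (p : nat) (v w x : 'rV[R]_p) :
  inner (v + w) x = inner v x + inner w x.
Proof. by rewrite !inner_mul mulmxDl mxE. Qed.

Lemma innerDr (R : realType) (p : nat) (v w x : 'rV[R]_p) :
  inner x (v + w) = inner x v + inner x w.
Proof. by rewrite !(innerC x) innerDl. Qed.

Lemma innerZl (R : realType) (p : nat) (a : R) (v x : 'rV[R]_p) :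
  inner (a *: v) x = a * inner v x.
Proof. by rewrite !inner_mul -scalemxAl mxE. Qed.

Lemma innerZr (R : realType) (p : nat) (a : R) (v x : 'rV[R]_p) :
  inner x (a *: v) = a * inner x v.
Proof. by rewrite !(innerC x) innerZl. Qed.

Lemma innerNl (R : realType) (p : nat) (v x : 'rV[R]_p) :
  inner (- v) x = - inner v x.
Proof. by rewrite -scaleN1r innerZl mulN1r. Qed.

Lemma innerNr (R : realType) (p : nat) (v x : 'rV[R]_p) :
  inner x (- v) = - inner x v.
Proof. by rewrite !(innerC x) innerNl. Qed.

Lemma innerBl (R : realType) (p : nat) (v w x : 'rV[R]_p) :
  inner (v - w) x = inner v x - inner w x.
Proof. by rewrite innerDl innerNl. Qed.

Lemma innerBr (R : realType) (p : nat) (v w x : 'rV[R]_p) :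
  inner x (v - w) = inner x v - inner x w.
Proof. by rewrite innerDr innerNr. Qed.

Lemma inner0l (R : realType) (p : nat) (x : 'rV[R]_p) : inner 0 x = 0.
Proof. by rewrite -(scale0r 0) innerZl mul0r. Qed.

Lemma inner0r (R : realType) (p : nat) (x : 'rV[R]_p) : inner x 0 = 0.
Proof. by rewrite innerC inner0l. Qed.

Definition innerE := (innerDl, innerDr, innerNl, innerNr, innerZl, innerZr).

Lemma inner_suml (R : realType) (p : nat) (I : Type) (s : seq I) (P : pred I)
    (F : I -> 'rV[R]_p) (x : 'rV[R]_p) :
  inner (\sum_(i <- s | P i) F i) x = \sum_(i <- s | P i) inner (F i) x.
Proof.
by apply: (big_morph (fun v => inner v x)) => [v w|]; rewrite ?innerDl ?inner0l.
Qed.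

Lemma inner_sumr (R : realType) (p : nat) (I : Type) (s : seq I) (P : pred I)
    (F : I -> 'rV[R]_p) (x : 'rV[R]_p) :
  inner x (\sum_(i <- s | P i) F i) = \sum_(i <- s | P i) inner x (F i).
Proof. by rewrite innerC inner_suml; apply: eq_bigr => i _; rewrite innerC. Qed.

Lemma inner_ge0 (R : realType) (p : nat) (v : 'rV[R]_p) : 0 <= inner v v.
Proof. by apply: sumr_ge0 => k _; rewrite -expr2 sqr_ge0. Qed.

Lemma enormE (R : realType) (p : nat) (v : 'rV[R]_p) :
  enorm v = Num.sqrt (inner v v).
Proof. by rewrite /enorm; congr Num.sqrt; apply: eq_bigr => k _; rewrite expr2. Qed.

Lemma enorm_sqr (R : realType) (p : nat) (v : 'rV[R]_p) :
  enorm v ^+ 2 = inner v v.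
Proof. by rewrite enormE sqr_sqrtr ?inner_ge0. Qed.

Lemma enorm_ge0 (R : realType) (p : nat) (v : 'rV[R]_p) : 0 <= enorm v.
Proof. exact: sqrtr_ge0. Qed.

Lemma enorm0 (R : realType) (p : nat) : enorm (0 : 'rV[R]_p) = 0.
Proof. by rewrite enormE inner0l sqrtr0. Qed.

Lemma enorm_eq0 (R : realType) (p : nat) (v : 'rV[R]_p) :
  (enorm v == 0) = (v == 0).
Proof.
apply/eqP/eqP => [v0|->]; last exact: enorm0.
have : inner v v = 0 by rewrite -enorm_sqr v0 expr0n.
move=> /eqP; rewrite /inner psumr_eq0 => [|k _]; last by rewrite -expr2 sqr_ge0.
move=> /allP vk; apply/rowP => k; rewrite mxE.
by have := vk k (mem_index_enum k); rewrite /= mulf_eq0 orbb => /eqP.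
Qed.

Lemma enormZ (R : realType) (p : nat) (a : R) (v : 'rV[R]_p) :
  enorm (a *: v) = `|a| * enorm v.
Proof.
by rewrite !enormE innerZl innerZr mulrA -expr2 sqrtrM ?sqr_ge0// sqrtr_sqr.
Qed.

Lemma enormN (R : realType) (p : nat) (v : 'rV[R]_p) : enorm (- v) = enorm v.
Proof. by rewrite -scaleN1r enormZ normrN1 mul1r. Qed.

Lemma enormC (R : realType) (p : nat) (v w : 'rV[R]_p) :
  enorm (v - w) = enorm (w - v).
Proof. by rewrite -enormN opprB. Qed.

Lemma enormD_sqr (R : realType) (p : nat) (v w : 'rV[R]_p) :
  enorm (v + w) ^+ 2 = enorm v ^+ 2 + 2 * inner v w + enorm w ^+ 2.
Proof. by rewrite !enorm_sqr !innerE (innerC w v); ring. Qed.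

Lemma enormB_sqr (R : realType) (p : nat) (v w : 'rV[R]_p) :
  enorm (v - w) ^+ 2 = enorm v ^+ 2 - 2 * inner v w + enorm w ^+ 2.
Proof. by rewrite !enorm_sqr !innerE (innerC w v); ring. Qed.

Lemma cauchy_schwarz (R : realType) (p : nat) (v w : 'rV[R]_p) :
  inner v w <= enorm v * enorm w.
Proof.
set a := enorm v; set b := enorm w.
have [ab0|ab0] := eqVneq (a * b) 0.
  move: ab0 => /eqP; rewrite mulf_eq0 !enorm_eq0 => /orP[]/eqP z0.
    by rewrite z0 inner0l mulr_ge0 ?enorm_ge0.
  by rewrite z0 inner0r mulr_ge0 ?enorm_ge0.
have ab_gt0 : 0 < a * b by rewrite lt_def ab0 mulr_ge0 ?enorm_ge0.
have := sqr_ge0 (enorm (b *: v - a *: w)).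
rewrite enormB_sqr !enormZ !ger0_norm ?enorm_ge0// -/a -/b innerZl innerZr => h.
rewrite -(ler_pM2l ab_gt0); nra.
Qed.

Lemma cauchy_schwarz_abs (R : realType) (p : nat) (v w : 'rV[R]_p) :
  `|inner v w| <= enorm v * enorm w.
Proof.
rewrite ler_norml cauchy_schwarz andbT lerNl -innerNl.
by rewrite (le_trans (cauchy_schwarz _ _))// enormN.
Qed.

Lemma enormD (R : realType) (p : nat) (v w : 'rV[R]_p) :
  enorm (v + w) <= enorm v + enorm w.
Proof.
rewrite -(@ler_pXn2r _ 2)// ?nnegrE ?addr_ge0 ?enorm_ge0// enormD_sqr.
by have := cauchy_schwarz v w; nra.
Qed.

Lemma enormB (R : realType) (p : nat) (v w : 'rV[R]_p) :
  enorm (v - w) <= enorm v + enorm w.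
Proof. by rewrite -(enormN w) enormD. Qed.

Lemma enorm_sum (R : realType) (p : nat) (I : Type) (s : seq I) (P : pred I)
    (F : I -> 'rV[R]_p) :
  enorm (\sum_(i <- s | P i) F i) <= \sum_(i <- s | P i) enorm (F i).
Proof.
elim/big_rec2 : _ => [|i v w _ h]; first by rewrite enorm0.
by rewrite (le_trans (enormD _ _))// lerD2l.
Qed.

Lemma enorm_le_sqr (R : realType) (p q : nat) (v : 'rV[R]_p) (w : 'rV[R]_q) :
  (enorm v <= enorm w) = (enorm v ^+ 2 <= enorm w ^+ 2).
Proof. by rewrite ler_pXn2r// nnegrE enorm_ge0. Qed.

Lemma coord_le_enorm (R : realType) (p : nat) (v : 'rV[R]_p) k :
  `|v ord0 k| <= enorm v.
Proof.
rewrite -(@ler_pXn2r _ 2)// ?nnegrE ?enorm_ge0// enorm_sqr real_normK ?num_real//.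
rewrite /inner (bigD1 k)//= -expr2 lerDl sumr_ge0// => j _.
by rewrite -expr2 sqr_ge0.
Qed.

Lemma enorm_le_coord (R : realType) (p : nat) (v : 'rV[R]_p) (M : R) :
  (forall k, `|v ord0 k| <= M) -> enorm v ^+ 2 <= p%:R * M ^+ 2.
Proof.
move=> h; rewrite enorm_sqr /inner.
have -> : p%:R * M ^+ 2 = \sum_(k < p) M ^+ 2.
  by rewrite sumr_const card_ord mulr_natl.
apply: ler_sum => k _; rewrite -expr2 -real_normK ?num_real//.
by rewrite lerXn2r// ?nnegrE// (le_trans _ (h k)).
Qed.

Lemma continuous_enorm (R : realType) (p : nat) (w : 'rV[R]_p) :
  continuous (fun v : 'rV[R]_p => enorm (v - w)).
Proof.
move=> v; rewrite /enorm.
apply: (@continuous_comp _ _ _ _ (@Num.sqrt R)); last exact: sqrt_continuous.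
have -> : (fun v0 : 'rV[R]_p => \sum_(k < p) ((v0 - w) ord0 k) ^+ 2) =
  \sum_(k < p) (fun v0 : 'rV[R]_p => ((v0 - w) ord0 k) ^+ 2).
  by apply/funext => v0; rewrite fct_sumE.
elim/big_ind : _ => [|F G cF cG|k _]; first exact: cst_continuous.
  exact: continuousD.
have -> : (fun v0 : 'rV[R]_p => (v0 - w) ord0 k ^+ 2) =
  (fun v0 : 'rV[R]_p => (v0 ord0 k - w ord0 k) * (v0 ord0 k - w ord0 k)).
  by apply/funext => v0; rewrite !mxE expr2.
apply: continuousM; (apply: continuousB; [exact: coord_continuous|exact: cst_continuous]).
Qed.

(** * Nearest points of convex sets *)

Lemma convex_setP (R : realType) (p : nat) (K : set 'rV[R]_p) (x y : 'rV[R]_p)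
    (t : R) :
  convex_set (M := 'rV[R]_p) K -> K x -> K y -> 0 <= t <= 1 ->
  K (t *: x + (1 - t) *: y).
Proof.
move=> cK Kx Ky t01; have := cK x y (Itv01 (proj1 (andP t01)) (proj2 (andP t01))).
by rewrite !inE => /(_ Kx Ky).
Qed.

Definition nearest (R : realType) (p : nat) (K : set 'rV[R]_p)
    (v w : 'rV[R]_p) : Prop :=
  K w /\ forall w', K w' -> enorm (v - w) <= enorm (v - w').

(** The obtuse angle criterion: moving from the nearest point towards another
    point of a convex set cannot decrease the distance to first order. *)
Lemma nearest_obtuse (R : realType) (p : nat) (K : set 'rV[R]_p)
    (v w x : 'rV[R]_p) :
  convex_set (M := 'rV[R]_p) K -> nearest K v w -> K x ->
  inner (v - w) (x - w) <= 0.
Proof.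
move=> cK [Kw min] Kx; rewrite leNgt; apply/negP => c_gt0.
set c := inner _ _ in c_gt0; set b := enorm (x - w) ^+ 2.
have b_ge0 : 0 <= b by rewrite exprn_ge0 ?enorm_ge0.
have cb : 0 < c + b by lra.
pose t := c / (c + b).
have t0 : 0 < t by rewrite divr_gt0.
have t1 : t <= 1 by rewrite ler_pdivrMr// mul1r; lra.
have := min _ (convex_setP cK Kx Kw (t := t) _).
rewrite (ltW t0) t1 => /(_ isT).
have -> : v - (t *: x + (1 - t) *: w) = (v - w) - t *: (x - w).
  by apply/rowP => k; rewrite !mxE; ring.
rewrite enorm_le_sqr [leRHS]enormB_sqr enormZ exprMn real_normK ?num_real//.
rewrite innerZr -/c -/b => h.
have : t * b < c.
  rewrite /t mulrAC ltr_pdivrMr//; nra.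
nra.
Qed.

Lemma nearest_contract (R : realType) (p : nat) (K : set 'rV[R]_p)
    (v w x : 'rV[R]_p) :
  convex_set (M := 'rV[R]_p) K -> nearest K v w -> K x ->
  enorm (w - x) <= enorm (v - x).
Proof.
move=> cK vw Kx; have := nearest_obtuse cK vw Kx.
rewrite enorm_le_sqr; have -> : v - x = (v - w) - (x - w).
  by apply/rowP => k; rewrite !mxE; ring.
rewrite (enormB_sqr (v - w)) (enormC w x).
have := sqr_ge0 (enorm (v - w)); lra.
Qed.

(** Add the two obtuse angle inequalities. *)
Lemma nearest_nonexpansive (R : realType) (p : nat) (K : set 'rV[R]_p)
    (v w v' w' : 'rV[R]_p) :
  convex_set (M := 'rV[R]_p) K -> nearest K v w -> nearest K v' w' ->
  enorm (w - w') <= enorm (v - v').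
Proof.
move=> cK vw vw'.
have h1 := nearest_obtuse cK vw vw'.1; have h2 := nearest_obtuse cK vw' vw.1.
have [->|ww'] := eqVneq w w'; first by rewrite subrr enorm0 enorm_ge0.
have ww'0 : 0 < enorm (w - w') by rewrite lt_def enorm_ge0 enorm_eq0 subr_eq0 ww'.
rewrite -(ler_pM2r ww'0) -expr2.
apply: le_trans (cauchy_schwarz _ _).
have -> : v - v' = (v - w) - (v' - w') + (w - w').
  by apply/rowP => k; rewrite !mxE; ring.
rewrite innerDl innerBl -enorm_sqr.
by move: h1; rewrite -(opprB w w') innerNr; lra.
Qed.

Lemma nearest_unique (R : realType) (p : nat) (K : set 'rV[R]_p)
    (v w w' : 'rV[R]_p) :
  convex_set (M := 'rV[R]_p) K -> nearest K v w -> nearest K v w' -> w = w'.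
Proof.
move=> cK vw vw'; have := nearest_nonexpansive cK vw vw'.
rewrite subrr enorm0 => h; apply/eqP; rewrite -subr_eq0 -enorm_eq0.
by rewrite eq_le h enorm_ge0.
Qed.

Lemma proj_nearest (R : realType) (p : nat) (K : set 'rV[R]_p) (v : 'rV[R]_p) :
  compact K -> K !=set0 -> nearest K v (Defs.proj K v).
Proof.
move=> cK K0.
have [|w Kw min] := @EVT_min_rV R p (fun w => enorm (w - v)) K K0 cK.
  exact/continuous_subspaceT/continuous_enorm.
rewrite /Defs.proj; case: xgetP => [//|/(_ w)]; case; split; first exact/set_mem.
by move=> w' Kw'; rewrite !(enormC v); apply: min; exact/mem_set.
Qed.

Lemma proj_eq (R : realType) (p : nat) (K : set 'rV[R]_p) (v w : 'rV[R]_p) :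
  convex_set (M := 'rV[R]_p) K -> nearest K v w -> Defs.proj K v = w.
Proof.
move=> cK vw; apply: (nearest_unique cK _ vw).
by rewrite /Defs.proj; case: xgetP => [//|/(_ w)]; case.
Qed.

Lemma max0_nearest (R : realType) (a b : R) : 0 <= b ->
  (a - Num.max 0 a) * (a - Num.max 0 a) <= (a - b) * (a - b).
Proof.
move=> b0; rewrite /Order.max; case: (ltP 0 a) => a0; last by nra.
by rewrite subrr mul0r -expr2 sqr_ge0.
Qed.

Lemma max0_contract (R : realType) (a b : R) : 0 <= b ->
  (Num.max 0 a - b) * (Num.max 0 a - b) <= (a - b) * (a - b).
Proof. by move=> b0; rewrite /Order.max; case: (ltP 0 a) => a0; nra. Qed.

Lemma pospartE (R : realType) (m : nat) (v : 'rV[R]_m) :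
  pospart v = \row_k Num.max 0 (v ord0 k).
Proof.
apply: proj_eq.
  move=> x y t; rewrite !inE /= => x0 y0 k.
  have -> : conv t x y = t%:num *: x + (1 - t%:num) *: y by [].
  have t0 : 0 <= t%:num by []. have t1 : t%:num <= 1 by [].
  by rewrite !mxE addr_ge0// mulr_ge0// subr_ge0.
split=> [k|w' w'0]; first by rewrite mxE le_max lexx.
rewrite enorm_le_sqr !enorm_sqr; apply: ler_sum => k _; rewrite !mxE.
exact: max0_nearest (w'0 k).
Qed.

Lemma pospart_ge0 (R : realType) (m : nat) (v : 'rV[R]_m) k :
  0 <= pospart v ord0 k.
Proof. by rewrite pospartE mxE le_max lexx. Qed.

(** [pospart] is the projection on the orthant, so it moves no point away from
    a nonnegative vector. *)
Lemma pospart_contract (R : realType) (m : nat) (v q : 'rV[R]_m) :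
  (forall k, 0 <= q ord0 k) -> enorm (pospart v - q) <= enorm (v - q).
Proof.
move=> q0; rewrite enorm_le_sqr !enorm_sqr; apply: ler_sum => k _.
rewrite pospartE !mxE.
have := q0 k; set a : R := v ord0 k; set b : R := q ord0 k => b0.
by rewrite /Order.max; case: (ltP 0 a) => a0; nra.
Qed.

Lemma inner_pospart (R : realType) (m : nat) (v : 'rV[R]_m) :
  inner (pospart v) v = enorm (pospart v) ^+ 2.
Proof.
rewrite enorm_sqr; apply: eq_bigr => k _; rewrite pospartE mxE.
by case: (leP 0 (v ord0 k)) => //; rewrite !mul0r.
Qed.

(** * Functions with bounded subgradients *)

(** What convexity, differentiability and the gradient bound provide together.
    Unlike differentiability relative to a set, this property is stable under
    sums without any discussion of the uniqueness of gradients. *)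
Definition subdifferentiable (R : realType) (p : nat) (X : set 'rV[R]_p) (G : R)
    (f : 'rV[R]_p -> R) : Prop :=
  forall v, X v -> exists2 d, enorm d <= G &
    forall w, X w -> f v + inner d (w - v) <= f w.

(** A gradient of a convex function is a subgradient: divide the convexity
    inequality between [v] and [w] by the step length and let it shrink. *)
Lemma regular_on_subdifferentiable (R : realType) (p : nat) (X : set 'rV[R]_p)
    (F G : R) (f : 'rV[R]_p -> R) :
  convex_set (M := 'rV[R]_p) X -> regular_on X F G f -> subdifferentiable X G f.
Proof.
move=> cX [cf _ gf] v Xv; have [d df dG] := gf v Xv; exists d => // w Xw.
have [->|wv] := eqVneq w v; first by rewrite subrr inner0r addr0.
set N := enorm (w - v).
have N0 : 0 < N by rewrite lt_def enorm_ge0 enorm_eq0 subr_eq0 wv.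
rewrite -lerBrDl; apply/ler_addgt0Pr => e e0.
have [|eta eta0 h] := df (e / N); first exact: divr_gt0.
pose t := Num.min 1 (eta / (2 * N)).
have t0 : 0 < t by rewrite lt_min ltr01 divr_gt0// mulr_gt0.
have t1 : t <= 1 by rewrite ge_min lexx.
have tN : t * N < eta.
  have : t <= eta / (2 * N) by rewrite ge_min lexx orbT.
  rewrite ler_pdivlMr ?mulr_gt0//; nra.
have := h (t *: w + (1 - t) *: v) (convex_setP cX Xw Xv _).
rewrite (ltW t0) t1 => /(_ isT).
have -> : t *: w + (1 - t) *: v - v = t *: (w - v).
  by apply/rowP => k; rewrite !mxE; ring.
rewrite enormZ (gtr0_norm t0) -/N => /(_ tN).
rewrite ler_norml innerZr => /andP[h1 _].
have h2 : f (t *: w + (1 - t) *: v) <= t * f w + (1 - t) * f v.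
  by have := cf (Itv01 (ltW t0) t1) w v; rewrite !inE; apply.
have eN : e / N * (t * N) = t * e by field; rewrite gt_eqF.
by rewrite eN in h1; rewrite -(ler_pM2l t0); lra.
Qed.

Lemma subdifferentiable_lipschitz (R : realType) (p : nat) (X : set 'rV[R]_p)
    (G : R) (f : 'rV[R]_p -> R) (v w : 'rV[R]_p) :
  subdifferentiable X G f -> X v -> X w -> f v - f w <= G * enorm (v - w).
Proof.
move=> sf Xv Xw; have [d dG /(_ w Xw)] := sf v Xv.
rewrite -(opprB v w) innerNr => h.
have := cauchy_schwarz d (v - w).
have : enorm d * enorm (v - w) <= G * enorm (v - w).
  by rewrite ler_wpM2r ?enorm_ge0.
lra.
Qed.

Lemma subdifferentiable_convex (R : realType) (p : nat) (X : set 'rV[R]_p)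
    (G : R) (f : 'rV[R]_p -> R) (v w : 'rV[R]_p) (t : R) :
  convex_set (M := 'rV[R]_p) X -> subdifferentiable X G f -> X v -> X w ->
  0 <= t <= 1 -> f (t *: v + (1 - t) *: w) <= t * f v + (1 - t) * f w.
Proof.
move=> cX sf Xv Xw t01; have [d _ h] := sf _ (convex_setP cX Xv Xw t01).
have := h _ Xv; have := h _ Xw.
have -> : v - (t *: v + (1 - t) *: w) = (1 - t) *: (v - w).
  by apply/rowP => k; rewrite !mxE; ring.
have -> : w - (t *: v + (1 - t) *: w) = (- t) *: (v - w).
  by apply/rowP => k; rewrite !mxE; ring.
rewrite !innerZr; case/andP: t01; nra.
Qed.

Lemma subdifferentiableD (R : realType) (p : nat) (X : set 'rV[R]_p)
    (G H : R) (f g : 'rV[R]_p -> R) :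
  subdifferentiable X G f -> subdifferentiable X H g ->
  subdifferentiable X (G + H) (fun v => f v + g v).
Proof.
move=> sf sg v Xv; have [d dG fd] := sf v Xv; have [e eH ge] := sg v Xv.
exists (d + e) => [|w Xw]; first by rewrite (le_trans (enormD _ _))// lerD.
by rewrite innerDl; have := fd w Xw; have := ge w Xw; lra.
Qed.

Lemma subdifferentiable_sum (R : realType) (p m : nat) (X : set 'rV[R]_p)
    (G c : 'I_m -> R) (f : 'I_m -> 'rV[R]_p -> R) :
  (forall j, 0 <= c j) -> (forall j, subdifferentiable X (G j) (f j)) ->
  subdifferentiable X (\sum_(j < m) c j * G j)
    (fun v => \sum_(j < m) c j * f j v).
Proof.
move=> c0 sf v Xv.
have /choice[d hd] : forall j, exists d, enorm d <= G j /\
    forall w, X w -> f j v + inner d (w - v) <= f j w.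
  by move=> j; have [d] := sf j v Xv; exists d.
exists (\sum_(j < m) c j *: d j).
  apply: le_trans (enorm_sum _ _ _) _; apply: ler_sum => j _.
  by rewrite enormZ ger0_norm// ler_wpM2l//; exact: (hd j).1.
move=> w Xw; rewrite inner_suml -big_split/=; apply: ler_sum => j _.
by rewrite innerZl -mulrDr ler_wpM2l//; exact: (hd j).2.
Qed.

(** * The one-point gradient estimate *)

(** A pointwise substitute for the divergence theorem.  Put [h := L *: e] and
    [y := z - h].  The estimator pairs the two reflected points
    [z + delta *: (o + s *: e)] and [z + delta *: (o - s *: e)] of a line
    parallel to [h].  If [L] is at least the half length [delta * s] of the
    chord between them, its slope dominates the slope over the longer segment
    from [z + delta *: o - h] to [z + delta *: o], and [z + delta *: o - h] is
    within [delta] of [y].  Otherwise [z + delta *: o] itself is within [delta]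
    of [y], so the left hand side is nonpositive and shrinking the chord only
    helps. *)
Lemma reflected_difference_ge (R : realType) (p : nat) (X : set 'rV[R]_p)
    (G : R) (f : 'rV[R]_p -> R) (z e o : 'rV[R]_p) (delta L s : R) :
  convex_set (M := 'rV[R]_p) X -> subdifferentiable X G f ->
  0 <= G -> 0 < delta -> 0 < L ->
  (forall v, enorm v <= 1 -> X (z + delta *: v)) ->
  (forall v, enorm v <= 1 -> X (z - L *: e + delta *: v)) ->
  enorm e = 1 -> inner o e = 0 -> enorm o ^+ 2 + s ^+ 2 = 1 ->
  2 * delta * s ^+ 2 * (f (z + delta *: o) - f (z - L *: e) - G * delta) <=
  s * L * (f (z + delta *: (o + s *: e)) - f (z + delta *: (o - s *: e))).
Proof.
move=> cX sf G0 d0 L0 Xz Xy e1 oe os.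
wlog s0 : s os / 0 < s => [hw|].
  have [s0|s0|s0] := ltgtP s 0; last 2 first.
  - exact: hw.
  - by rewrite s0; nra.
  have := hw (- s); rewrite sqrrN oppr_gt0 => /(_ os s0).
  rewrite !scaleNr opprK; lra.
have ee : inner e e = 1 by rewrite -enorm_sqr e1 expr1n.
have o1 : enorm o <= 1.
  by rewrite -(@ler_pXn2r _ 2) ?nnegrE ?enorm_ge0// expr1n; nra.
have se b : `|b| = 1 -> enorm (o + (b * s) *: e) <= 1.
  move=> b1; rewrite -(@ler_pXn2r _ 2) ?nnegrE ?enorm_ge0// expr1n enormD_sqr.
  by rewrite innerZr oe mulr0 enormZ e1 mulr1 normrM b1 mul1r real_normK ?num_real//; lra.
have sep : enorm (o + s *: e) <= 1 by have := se 1 (normr1 _); rewrite mul1r.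
have sem : enorm (o - s *: e) <= 1.
  by have := se (-1) (normrN1 _); rewrite mulN1r scaleNr.
have Xa := Xz _ o1; have Xp := Xz _ sep; have Xm := Xz _ sem.
have Xy0 : X (z - L *: e).
  by have := Xy 0; rewrite enorm0 scaler0 addr0; apply; exact: ler01.
set a : 'rV[R]_p := z + delta *: o in Xa *.
have mid : f a <= (f (z + delta *: (o + s *: e)) + f (z + delta *: (o - s *: e))) / 2.
  have -> : a = 2^-1 *: (z + delta *: (o + s *: e))
      + (1 - 2^-1) *: (z + delta *: (o - s *: e)).
    by apply/rowP => k; rewrite !mxE; field.
  apply: le_trans (subdifferentiable_convex cX sf Xp Xm _) _; first lra.
  lra.
set fp := f (z + delta *: (o + s *: e)) in mid *.
set fm := f (z + delta *: (o - s *: e)) in mid *.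
have s2 : s ^+ 2 = s * s by rewrite expr2.
have [Lc|cL] := leP (delta * s) L.
  (* the left end of the chord lies on the longer segment *)
  have XaL := Xy _ o1.
  have : fm <= (1 - delta * s / L) * f a + (delta * s / L) * f (a - L *: e).
    rewrite /fm; have -> : z + delta *: (o - s *: e) =
        (delta * s / L) *: (z - L *: e + delta *: o) + (1 - delta * s / L) *: a.
      by apply/rowP => k; rewrite !mxE; field; rewrite gt_eqF.
    have -> : a - L *: e = z - L *: e + delta *: o by rewrite /a addrAC.
    rewrite [leRHS]addrC; apply: (subdifferentiable_convex cX sf XaL Xa).
    by rewrite ler_pdivrMr// mul1r Lc andbT ltW// divr_gt0// mulr_gt0.
  have aL : f (a - L *: e) - f (z - L *: e) <= G * delta.
    have -> : a - L *: e = z - L *: e + delta *: o by rewrite /a addrAC.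
    apply: le_trans (subdifferentiable_lipschitz sf XaL Xy0) _.
    rewrite addrAC subrr add0r enormZ gtr0_norm// ler_wpM2l//.
    by rewrite ler_piMr// ltW.
  set q := delta * s / L => h.
  have qL : q * L = delta * s by rewrite /q divfK// gt_eqF.
  have q0 : 0 < q by rewrite divr_gt0// mulr_gt0.
  have h1 : q * (f a - f (a - L *: e)) <= f a - fm by lra.
  have h2 : q * (f a - f (z - L *: e) - G * delta) <= f a - fm.
    by apply: le_trans h1; rewrite ler_pM2l//; lra.
  have h3 : 2 * (q * (f a - f (z - L *: e) - G * delta)) <= fp - fm by lra.
  have := ler_wpM2l (ltW (mulr_gt0 s0 L0)) h3.
  apply: le_trans; rewrite le_eqVlt; apply/orP; left; apply/eqP.
  have -> : s * L * (2 * (q * (f a - f (z - L *: e) - G * delta))) =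
    2 * s * (q * L) * (f a - f (z - L *: e) - G * delta) by ring.
  by rewrite qL s2; ring.
have near k : - (delta * s) <= k <= delta * s ->
    enorm (delta *: o + k *: e) <= delta.
  case/andP=> k0 ks; rewrite -(@ler_pXn2r _ 2) ?nnegrE ?enorm_ge0 ?(ltW d0)//.
  rewrite enormD_sqr innerZl innerZr oe !mulr0 addr0 !enormZ e1 mulr1.
  rewrite (gtr0_norm d0) real_normK ?num_real// exprMn.
  have : k ^+ 2 <= (delta * s) ^+ 2 by nra.
  by rewrite exprMn; have := sqr_ge0 delta; nra.
have D0 : f a - f (z - L *: e) - G * delta <= 0.
  have := subdifferentiable_lipschitz sf Xa Xy0.
  have -> : a - (z - L *: e) = delta *: o + L *: e.
    by apply/rowP => k; rewrite !mxE; ring.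
  have hn : enorm (delta *: o + L *: e) <= delta by apply: near; lra.
  move=> h.
  have hG : G * enorm (delta *: o + L *: e) <= G * delta by rewrite ler_wpM2l.
  lra.
have D1 : fm - f (z - L *: e) <= G * delta.
  apply: le_trans (subdifferentiable_lipschitz sf Xm Xy0) _.
  have -> : z + delta *: (o - s *: e) - (z - L *: e) =
      delta *: o + (- (delta * s - L)) *: e.
    by apply/rowP => k; rewrite !mxE; ring.
  by rewrite ler_wpM2l//; apply: near; lra.
set D := f a - f (z - L *: e) - G * delta in D0 *.
have h3 : 2 * D <= fp - fm by rewrite /D; lra.
have h4 : 2 * delta * s ^+ 2 * D <= s * L * (2 * D) 
  by rewrite s2; have : 0 < s * (delta * s - L) by [rewrite mulr_gt0 ?subr_gt0]; nra.
by apply: le_trans h4 _; rewrite ler_pM2l// mulr_gt0.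
Qed.

(** Reflection of row vectors in the hyperplane orthogonal to [h]. *)
Definition reflection (R : realType) (p : nat) (h : 'rV[R]_p) : 'M[R]_p :=
  1%:M - (2 / inner h h) *: (h^T *m h).

Lemma mul_reflection (R : realType) (p : nat) (h u : 'rV[R]_p) :
  u *m reflection h = u - (2 * inner u h / inner h h) *: h.
Proof.
rewrite mulmxBr mulmx1 -scalemxAr mulmxA; congr (_ - _).
have -> : u *m h^T = (inner u h)%:M.
  by apply/rowP => k; rewrite inner_mul !mxE ord1 eqxx mulr1n.
by rewrite mul_scalar_mx scalerA; congr (_ *: _); ring.
Qed.

Lemma reflection_orthogonal (R : realType) (p : nat) (h : 'rV[R]_p) :
  reflection h *m (reflection h)^T = 1%:M.
Proof.
have -> : (reflection h)^T = reflection h.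
  by rewrite /reflection linearB linearZ/= trmx1 trmx_mul trmxK.
apply/row_matrixP => i; rewrite row_mul !rowE mulmx1 !mul_reflection.
set u := delta_mx _ _; have [->|h0] := eqVneq h 0; first by rewrite !scaler0 !subr0.
have hh : inner h h != 0 by rewrite -enorm_sqr expf_neq0// enorm_eq0.
rewrite innerBl innerZl -addrA -opprD -scalerDl.
have -> : 2 * inner u h / inner h h +
  2 * (inner u h - 2 * inner u h / inner h h * inner h h) / inner h h = 0.
  by field.
by rewrite scale0r subr0.
Qed.

Lemma enorm_orthogonal (R : realType) (p : nat) (Q : 'M[R]_p) (v : 'rV[R]_p) :
  Q *m Q^T = 1%:M -> enorm (v *m Q) = enorm v.
Proof.
by move=> QQ; rewrite !enormE !inner_mul trmx_mul mulmxA -(mulmxA v) QQ mulmx1.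
Qed.

(** The previous estimate for a point [u] of the sphere, in a form ready to be
    averaged: the average of the right hand side is twice the quantity of
    interest, since the reflection preserves the uniform distribution, and the
    last term on the left is odd in [u]. *)
Lemma one_point_pairing (R : realType) (p : nat) (X : set 'rV[R]_p)
    (G : R) (f : 'rV[R]_p -> R) (z y : 'rV[R]_p) (delta : R) :
  convex_set (M := 'rV[R]_p) X -> subdifferentiable X G f ->
  0 <= G -> 0 < delta -> z != y ->
  (forall v, enorm v <= 1 -> X (z + delta *: v)) ->
  (forall v, enorm v <= 1 -> X (y + delta *: v)) ->
  exists d : 'rV[R]_p, forall u, enorm u = 1 ->
    let h := z - y in
    let F := fun v => inner v h * f (z + delta *: v) in
    let S := inner u h ^+ 2 / inner h h in
    (2 * delta * (f z - f y - G * delta) * S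
      + 2 * delta ^+ 2 * (S * inner d (u - (inner u h / inner h h) *: h))
    <= F u + F (u *m reflection h) : Prop).
Proof.
move=> cX sf G0 d0 zy Xz Xy.
have Xz0 : X z by have := Xz 0; rewrite enorm0 scaler0 addr0; apply; exact: ler01.
have [d _ dz] := sf z Xz0; exists d => u u1 h F S.
have h0 : h != 0 by rewrite subr_eq0.
set L := enorm h.
have L0 : 0 < L by rewrite lt_def enorm_ge0 enorm_eq0 h0.
have hh : inner h h = L ^+ 2 by rewrite -enorm_sqr.
pose e := L^-1 *: h; pose s := inner u h / L; pose o := u - s *: e.
have Le : L *: e = h by rewrite scalerA mulfV ?scale1r// gt_eqF.
have e1 : enorm e = 1.
  by rewrite enormZ ger0_norm ?invr_ge0 ?(ltW L0)// mulVf// gt_eqF.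
have ue : inner u e = s by rewrite innerZr mulrC.
have oe : inner o e = 0.
  by rewrite innerBl innerZl ue -enorm_sqr e1 expr1n mulr1 subrr.
have os : enorm o ^+ 2 + s ^+ 2 = 1.
  rewrite enormB_sqr u1 enormZ e1 mulr1 real_normK ?num_real// innerZr ue; ring.
have yE : z - L *: e = y by rewrite Le opprB addrC subrK.
have Xy' v : enorm v <= 1 -> X (z - L *: e + delta *: v) by rewrite yE; exact: Xy.
have o1 : enorm o <= 1.
  by rewrite -(@ler_pXn2r _ 2) ?nnegrE ?enorm_ge0// expr1n; nra.
have := reflected_difference_ge cX sf G0 d0 L0 Xz Xy' e1 oe os.
rewrite yE.
have -> : o + s *: e = u by rewrite subrK.
have -> : o - s *: e = u *m reflection h.
  rewrite mul_reflection /o -addrA -opprD -scalerDl hh; congr (_ - _).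
  by rewrite scalerA; congr (_ *: _); rewrite /s; field; rewrite gt_eqF.
have oE : o = u - (inner u h / inner h h) *: h.
  by rewrite /o scalerA hh; congr (_ - _ *: _); rewrite /s; field; rewrite gt_eqF.
have SE : S = s ^+ 2 by rewrite /S /s hh; field; rewrite gt_eqF.
have uh : inner u h = s * L by rewrite /s divfK// gt_eqF.
have Fr : inner (u *m reflection h) h = - (s * L).
  by rewrite mul_reflection innerBl innerZl hh uh; field; rewrite gt_eqF.
rewrite -oE /F Fr uh SE => h1.
have := dz _ (Xz _ o1); rewrite addrAC subrr add0r innerZr => h2.
have h3 : 2 * delta * s ^+ 2 * (f z + delta * inner d o) <=
    2 * delta * s ^+ 2 * f (z + delta *: o).
  by rewrite ler_wpM2l// mulr_ge0 ?sqr_ge0// mulr_ge0// ltW.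
by apply: le_trans (le_trans _ h1) _; [|lra]; rewrite expr2; lra.
Qed.

(** * Consensus over time-varying graphs *)

Definition mix (R : realType) (n : nat) (A : 'M[R]_n) (x : 'I_n -> R) : 'I_n -> R :=
  fun i => \sum_(j < n) A i j * x j.

Definition mean (R : realType) (n : nat) (x : 'I_n -> R) : R :=
  (\sum_(i < n) x i) / n%:R.

Definition variance (R : realType) (n : nat) (x : 'I_n -> R) : R :=
  \sum_(i < n) (x i - mean x) ^+ 2.

Lemma variance_ge0 (R : realType) (n : nat) (x : 'I_n -> R) : 0 <= variance x.
Proof. by apply: sumr_ge0 => i _; exact: sqr_ge0. Qed.

Lemma sum_mix (R : realType) (n : nat) (A : 'M[R]_n) (F : 'I_n -> R) :
  doubly_stochastic A ->
  \sum_(i < n) \sum_(j < n) A i j * F j = \sum_(j < n) F j.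
Proof.
move=> [_ _ cA]; rewrite exchange_big/=; apply: eq_bigr => j _.
by rewrite -mulr_suml cA mul1r.
Qed.

Lemma mean_mix (R : realType) (n : nat) (A : 'M[R]_n) (x : 'I_n -> R) :
  doubly_stochastic A -> mean (mix A x) = mean x.
Proof. by move=> dA; rewrite /mean sum_mix. Qed.

(** The parallel axis theorem; so the mean minimizes the sum of squared
    distances. *)
Lemma sum_sqr_shift (R : realType) (n : nat) (x : 'I_n -> R) (c : R) :
  (0 < n)%N ->
  \sum_(i < n) (x i - c) ^+ 2 = variance x + n%:R * (mean x - c) ^+ 2.
Proof.
move=> n0; rewrite /variance.
have -> : n%:R * (mean x - c) ^+ 2 = \sum_(i < n) (mean x - c) ^+ 2.
  by rewrite sumr_const card_ord mulr_natl.
have s0 : \sum_(i < n) (x i - mean x) = 0.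
  rewrite big_split/= sumr_const card_ord -mulr_natl /mean.
  by rewrite mulrN mulrCA divff ?mulr1 ?subrr// pnatr_eq0 -lt0n.
have -> : \sum_(i < n) (x i - c) ^+ 2 = \sum_(i < n) ((x i - mean x) ^+ 2 +
   (mean x - c) ^+ 2 + 2 * (mean x - c) * (x i - mean x)).
  by apply: eq_bigr => i _; ring.
by rewrite big_split/= -mulr_sumr s0 mulr0 addr0 big_split.
Qed.

(** One round of mixing loses exactly the sum over the rows of the variances
    under the weights of the row. *)
Lemma variance_mix (R : realType) (n : nat) (A : 'M[R]_n) (x : 'I_n -> R) :
  (0 < n)%N -> doubly_stochastic A ->
  variance (mix A x) =
    variance x - \sum_(i < n) \sum_(j < n) A i j * (x j - mix A x i) ^+ 2.
Proof.
move=> n0 dA; have [_ rA _] := dA.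
have e1 := sum_sqr_shift x 0 n0; have e2 := sum_sqr_shift (mix A x) 0 n0.
rewrite mean_mix// in e2.
have -> : \sum_(i < n) \sum_(j < n) A i j * (x j - mix A x i) ^+ 2 =
    \sum_(i < n) (x i - 0) ^+ 2 - \sum_(i < n) (mix A x i - 0) ^+ 2.
  rewrite -(sum_mix (fun j => (x j - 0) ^+ 2) dA) -sumrB; apply: eq_bigr => i _.
  have -> : (mix A x i - 0) ^+ 2 =
      \sum_(j < n) A i j * (2 * mix A x i * x j - mix A x i ^+ 2).
    rewrite (eq_bigr (fun j => 2 * mix A x i * (A i j * x j) - A i j * mix A x i ^+ 2));
      last by move=> j _; ring.
    by rewrite sumrB -mulr_sumr -mulr_suml rA /mix; ring.
  by rewrite -sumrB; apply: eq_bigr => j _; ring.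
by rewrite e1 e2; ring.
Qed.

Lemma variance_mix_le (R : realType) (n : nat) (A : 'M[R]_n) (x : 'I_n -> R) :
  (0 < n)%N -> doubly_stochastic A -> variance (mix A x) <= variance x.
Proof.
move=> n0 dA; have [A0 _ _] := dA; rewrite variance_mix// gerBl.
by apply: sumr_ge0 => i _; apply: sumr_ge0 => j _; rewrite mulr_ge0 ?sqr_ge0.
Qed.

(** Two neighbours of [i] with distant values force a loss in row [i], whatever
    the centre [c]. *)
Lemma row_variance_ge (R : realType) (n : nat) (A : 'M[R]_n) (w : R)
    (x : 'I_n -> R) (i j k : 'I_n) (c : R) :
  (forall i j, 0 <= A i j) -> w <= A i j -> w <= A i k -> 0 <= w ->
  w / 2 * (x j - x k) ^+ 2 <= \sum_(l < n) A i l * (x l - c) ^+ 2.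
Proof.
move=> A0 wj wk w0; have t0 l : 0 <= A i l * (x l - c) ^+ 2.
  by rewrite mulr_ge0 ?sqr_ge0.
have [->|jk] := eqVneq j k.
  by rewrite subrr expr0n mulr0 sumr_ge0.
rewrite (bigD1 j)//= (bigD1 k) 1?eq_sym//= addrA.
apply: le_trans (_ : w * (x j - c) ^+ 2 + w * (x k - c) ^+ 2 <= _).
  by have := sqr_ge0 ((x j - c) + (x k - c)); nra.
rewrite -[leLHS]addr0; apply: lerD; last by apply: sumr_ge0.
by apply: lerD; rewrite ler_wpM2r ?sqr_ge0.
Qed.

(** Clamping the endpoints to [l, h] changes none of the selected intervals and
    makes the sum over all intervals telescope to at most [h - l]. *)
Lemma sum_gaps_le (R : realType) (N : nat) (s : nat -> R) (Q : pred 'I_N)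
    (l h : R) :
  (forall d, (d < N)%N -> s d <= s d.+1) -> l <= h ->
  (forall d : 'I_N, Q d -> l <= s d /\ s d.+1 <= h) ->
  \sum_(d < N | Q d) (s d.+1 - s d) <= h - l.
Proof.
move=> s_mon lh Qs; pose c y := if y <= l then l else if h <= y then h else y.
have c_mon y y' : y <= y' -> c y <= c y'.
  rewrite /c; case: (leP y l); case: (leP y' l); case: (leP h y); case: (leP h y');
    lra.
have c_rng y : l <= c y <= h by rewrite /c; case: (leP y l); case: (leP h y); lra.
have c_id y : l <= y <= h -> c y = y.
  by rewrite /c; case: (leP y l); case: (leP h y); lra.
have -> : \sum_(d < N | Q d) (s d.+1 - s d) =
    \sum_(d < N | Q d) (c (s d.+1) - c (s d)).
  by apply: eq_bigr => d /Qs[h1 h2]; have := s_mon d (ltn_ord d) => ?; rewrite !c_id; lra.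
apply: le_trans (_ : \sum_(d < N) (c (s d.+1) - c (s d)) <= _).
  rewrite [leRHS](bigID Q)/= lerDl sumr_ge0// => d _.
  by rewrite subr_ge0 c_mon// s_mon.
rewrite -(big_mkord xpredT (fun d => c (s d.+1) - c (s d))) telescope_sumr//.
by have := c_rng (s N); have := c_rng (s 0%N); lra.
Qed.

Lemma sum_sqr_le_sqr_sum (R : realType) (I : finType) (Q : pred I) (g : I -> R) :
  (forall d, Q d -> 0 <= g d) ->
  \sum_(d | Q d) g d ^+ 2 <= (\sum_(d | Q d) g d) ^+ 2.
Proof.
move=> g0; rewrite expr2 mulr_suml; apply: ler_sum => d Qd.
rewrite expr2 ler_wpM2l ?g0// (bigD1 d)//= lerDl sumr_ge0// => e /andP[Qe _].
exact: g0.
Qed.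

Lemma sqr_sum_le (R : realType) (N : nat) (g : 'I_N -> R) :
  (\sum_(d < N) g d) ^+ 2 <= N%:R * \sum_(d < N) g d ^+ 2.
Proof.
have [N0|N0] := posnP N.
  by move: g; rewrite N0 => g; rewrite !big_ord0 expr0n mul0r.
have := sum_sqr_shift g 0 N0; have := variance_ge0 g.
rewrite /mean subr0 (eq_bigr (fun i => g i ^+ 2)) => [|i _]; last by rewrite subr0.
move=> v0 ->; set S := \sum_(i < N) g i.
have N1 : 0 < N%:R :> R by rewrite ltr0n.
have -> : N%:R * (variance g + N%:R * (S / N%:R) ^+ 2) = N%:R * variance g + S ^+ 2.
  by field; rewrite gt_eqF.
by rewrite lerDr mulr_ge0// ltW.
Qed.

(** The values after the [k] rounds [t], ..., [t + k - 1] of mixing. *)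
Fixpoint mix_iter (R : realType) (n : nat) (W : nat -> 'M[R]_n) (t : nat)
    (x : 'I_n -> R) (k : nat) : 'I_n -> R :=
  if k is k'.+1 then mix (W (t + k')%N) (mix_iter W t x k') else x.

Lemma mix_iterD (R : realType) (n : nat) (W : nat -> 'M[R]_n) (t : nat)
    (x : 'I_n -> R) (k l : nat) :
  mix_iter W t x (k + l) = mix_iter W (t + k) (mix_iter W t x k) l.
Proof. by elim: l => [|l IH]; rewrite ?addn0//= addnS /= IH addnA. Qed.

Lemma mix_bound (R : realType) (n : nat) (A : 'M[R]_n) (x : 'I_n -> R) (i : 'I_n)
    (b : R) :
  doubly_stochastic A -> (forall j, A i j != 0 -> x j <= b) -> mix A x i <= b.
Proof.
move=> [A0 rA _] xb; rewrite -[b]mul1r -(rA i) mulr_suml; apply: ler_sum => j _.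
have [->|Aij] := eqVneq (A i j) 0; first by rewrite !mul0r.
by rewrite ler_wpM2l// xb.
Qed.

Lemma mixN (R : realType) (n : nat) (A : 'M[R]_n) (x : 'I_n -> R) (i : 'I_n) :
  mix A (fun j => - x j) i = - mix A x i.
Proof. by rewrite /mix -sumrN; apply: eq_bigr => j _; rewrite mulrN. Qed.

Lemma connect_crossing (n : nat) (e : rel 'I_n) (S : pred 'I_n) (a b : 'I_n) :
  connect e a b -> S a -> ~~ S b -> exists c d, [/\ e c d, S c & ~~ S d].
Proof.
move=> /connectP[s]; elim: s a => [|c s IH] a /=; first by move=> _ -> ->.
move=> /andP[ac cs] bE Sa Sb; case: (boolP (S c)) => Sc; first exact: IH cs bE Sc Sb.
by exists a, c.
Qed.

Section contraction.
Context (R : realType) (n iota : nat) (w : R) (W : nat -> 'M[R]_n) (t : nat).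
Hypotheses (n0 : (0 < n)%N) (iota0 : (0 < iota)%N) (w0 : 0 < w).
Hypotheses (dW : forall k, doubly_stochastic (W (t + k)%N)).
Hypotheses (diagW : forall k i, 0 < W (t + k)%N i i).
Hypotheses (wW : forall k i j, 0 < W (t + k)%N i j -> w <= W (t + k)%N i j).
Hypothesis cW : strongly_connected
  [rel a b : 'I_n | [exists l : 'I_iota, 0 < W (t + l)%N b a]].

(** Consider a gap between two consecutive values of [x].  Until some edge
    joins the agents above it to those below it, each side averages among
    itself and the gap persists; so when such an edge first appears, at time
    [k] and into agent [i], the neighbourhood of [i] straddles the whole
    gap. *)
Lemma first_crossing (x : 'I_n -> R) (a b : R) :
  a < b -> (forall i, x i <= a \/ b <= x i) ->
  (exists i, x i <= a) -> (exists i, b <= x i) ->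
  exists (k : 'I_iota) (i j l : 'I_n),
    [/\ 0 < W (t + k)%N i j, 0 < W (t + k)%N i l,
        mix_iter W t x k j <= a & b <= mix_iter W t x k l].
Proof.
move=> ab xab [ia xia] [ib xib].
pose S : pred 'I_n := fun i => b <= x i.
pose cross k := [exists i, exists j, (0 < W (t + k)%N i j) && (S i != S j)].
have exk : exists k, (k < iota)%N && cross k.
  have Sib : S ib by [].
  have Sia : ~~ S ia by rewrite /S -ltNge; lra.
  have [c [d [/existsP[l Wl] Sc Sd]]] := connect_crossing (cW ib ia) Sib Sia.
  exists l; rewrite ltn_ord/=; apply/existsP; exists d; apply/existsP; exists c.
  by rewrite Wl Sc (negbTE Sd).
have [k /andP[ki ck] kmin] := ex_minnP exk.
have sides l : (l <= k)%N -> forall i, if S i then b <= mix_iter W t x l i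
    else mix_iter W t x l i <= a.
  elim: l => [_|l IH lk] i /=.
    case: ifP => // Si; case: (xab i) => //; by rewrite -/(S i) Si.
  have side j : W (t + l)%N i j != 0 -> S i = S j.
    move=> Wij; apply/eqP; case: eqVneq => // Sij.
    have : cross l.
      apply/existsP; exists i; apply/existsP; exists j; rewrite Sij andbT.
      by have [W0 _ _] := dW l; rewrite lt_def Wij W0.
    move=> cl; have := kmin l; rewrite cl (ltn_trans lk ki) => /(_ isT).
    by rewrite leqNgt lk.
  have {}IH := IH (ltnW lk).
  case: ifP => Si.
    rewrite -[leRHS]opprK -mixN lerNr; apply: mix_bound => // j /side Sj.
    by rewrite lerN2; have := IH j; rewrite -Sj Si.
  by apply: mix_bound => // j /side Sj; have := IH j; rewrite -Sj Si.
have {}sides := sides k (leqnn k).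
have /existsP[i /existsP[j /andP[Wij Sij]]] := ck.
exists (Ordinal ki), i.
have := sides i; have := sides j; case: (boolP (S i)) Sij => Si; case: (boolP (S j)) => Sj // _.
  by exists j, i; split.
by exists i, j; split.
Qed.

Local Notation loss x k i :=
  (\sum_(j < n) W (t + k)%N i j * (mix_iter W t x k j - mix_iter W t x k.+1 i) ^+ 2).

Lemma variance_mix_iter (x : 'I_n -> R) (K : nat) :
  variance (mix_iter W t x K) =
    variance x - \sum_(k < K) \sum_(i < n) loss x k i.
Proof.
elim: K => [|K IH]; first by rewrite big_ord0 subr0.
by rewrite big_ord_recr/= variance_mix// IH opprD addrA.
Qed.

(** Every gap between consecutive levels of [x] is charged to a pair (round,
    agent) that straddles it.  The gaps charged to the same pair are disjoint
    and lie within the range of the values seen by that agent, so the loss of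
    the pair dominates the sum of their squares. *)
Lemma variance_loss_ge (x : 'I_n -> R) (N : nat) (s : nat -> R) :
  (forall d, (d < N)%N -> s d <= s d.+1) ->
  (forall d i, (d < N)%N -> x i <= s d \/ s d.+1 <= x i) ->
  (forall d, (d <= N)%N -> exists i, x i = s d) ->
  w / 2 * \sum_(d < N) (s d.+1 - s d) ^+ 2 <=
    variance x - variance (mix_iter W t x iota).
Proof.
move=> s_mon s_cut s_val.
rewrite variance_mix_iter opprB addrCA subrr addr0.
have /choice[c hc] : forall d : 'I_N, exists c : 'I_iota * 'I_n, s d < s d.+1 ->
    exists j l, [/\ 0 < W (t + c.1)%N c.2 j, 0 < W (t + c.1)%N c.2 l,
        mix_iter W t x c.1 j <= s d & s d.+1 <= mix_iter W t x c.1 l].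
  move=> d; have [sd|sd] := ltP (s d) (s d.+1).
    have [i xi] := s_val d (ltnW (ltn_ord d)); have [i' xi'] := s_val d.+1 (ltn_ord d).
    have [|||k [i1 [j [l h]]]] := @first_crossing x (s d) (s d.+1) sd.
    - by move=> k; exact: s_cut.
    - by exists i; rewrite xi.
    - by exists i'; rewrite xi'.
    by exists (k, i1) => _; exists j, l.
  have [i _] := s_val 0%N (leq0n N).
  by exists (Ordinal iota0, i).
rewrite (partition_big c xpredT)//= mulr_sumr pair_big/=.
apply: ler_sum => -[k i] _ /=.
have Wi := diagW k i.
have [j0 Wj0 jmin] := arg_minP (mix_iter W t x k) (P := fun j => 0 < W (t + k)%N i j) Wi.
have [l0 Wl0 lmax] := arg_maxP (mix_iter W t x k) (P := fun j => 0 < W (t + k)%N i j) Wi.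
set H := mix_iter W t x k l0 in lmax; set L := mix_iter W t x k j0 in jmin.
have W0 : forall i j, 0 <= W (t + k)%N i j by have [] := dW k.
apply: le_trans (row_variance_ge _ _ W0 (wW Wl0) (wW Wj0) (ltW w0)).
rewrite ler_pM2l ?divr_gt0// -/H -/L.
pose Q d := (c d == (k, i)) && (s d < s d.+1).
have -> : \sum_(d < N | c d == (k, i)) (s d.+1 - s d) ^+ 2 =
    \sum_(d < N | Q d) (s d.+1 - s d) ^+ 2.
  rewrite (bigID (fun d : 'I_N => s d < s d.+1))/= [X in _ + X]big1 ?addr0// => d.
  case/andP=> _; rewrite -leNgt => h; have := s_mon d (ltn_ord d) => h'.
  by rewrite (_ : s d.+1 = s d) ?subrr ?expr0n//; lra.
apply: le_trans (sum_sqr_le_sqr_sum _) _ => [d _|].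
  by rewrite subr_ge0 s_mon.
have LH : L <= H by exact: le_trans (jmin _ Wi) (lmax _ Wi).
have g0 : 0 <= \sum_(d < N | Q d) (s d.+1 - s d).
  by apply: sumr_ge0 => d _; rewrite subr_ge0 s_mon.
rewrite ler_pXn2r// ?nnegrE ?subr_ge0//.
apply: sum_gaps_le => // d /andP[/eqP cd sd].
have [j [l]] := hc d sd; rewrite cd /= => -[Wj Wl h1 h2].
split; first exact: le_trans (jmin _ Wj) h1.
exact: le_trans h2 (lmax _ Wl).
Qed.

(** The squared range is at most [n] times the sum of the squared gaps between
    consecutive values, and the variance is at most [n / 4] times the squared
    range; hence a window of [iota] rounds removes the fraction
    [2 * w / n ^+ 2] of the variance. *)
Lemma variance_window (x : 'I_n -> R) :
  variance (mix_iter W t x iota) <= (1 - 2 * w / n%:R ^+ 2) * variance x.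
Proof.
pose sq := sort <=%R (codom x); pose s := nth 0 sq.
have ssz : size sq = n by rewrite size_sort size_codom card_ord.
have ssort : sorted <=%R sq by exact: sort_le_sorted.
have smem y : (y \in sq) = (y \in codom x) by rewrite mem_sort.
have s_le d e : (d <= e)%N -> (e < n)%N -> s d <= s e.
  move=> de en; apply: (sorted_leq_nth le_trans le_refl 0 ssort) => //.
    by rewrite inE ssz (leq_ltn_trans de en).
  by rewrite inE ssz.
have s_ix i : exists2 d, (d < n)%N & x i = s d.
  have : x i \in sq by rewrite smem codom_f.
  by move=> /(nthP 0)[d]; rewrite ssz => dn <-; exists d.
have s_val d : (d <= n.-1)%N -> exists i, x i = s d.
  rewrite -ltnS prednK// => dn; have : s d \in codom x.
    by rewrite -smem mem_nth// ssz.
  by move=> /codomP[i ->]; exists i.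
have s_mon d : (d < n.-1)%N -> s d <= s d.+1.
  by move=> dn; apply: s_le => //; lia.
have s_cut d i : (d < n.-1)%N -> x i <= s d \/ s d.+1 <= x i.
  rewrite -ltnS prednK// => dn; have [e en ->] := s_ix i.
  by have [ed|de] := leqP e d; [left|right]; apply: s_le => //; exact: ltn_trans dn.
have := variance_loss_ge s_mon s_cut s_val.
set D := \sum_(d < _) _ => loss.
have Dge : (s n.-1 - s 0%N) ^+ 2 <= n%:R * D.
  have -> : s n.-1 - s 0%N = \sum_(d < n.-1) (s d.+1 - s d).
    by rewrite -(big_mkord xpredT (fun d => s d.+1 - s d)) telescope_sumr.
  apply: le_trans (sqr_sum_le _) _; rewrite ler_wpM2r ?ler_nat ?leq_pred//.
  by apply: sumr_ge0 => d _; exact: sqr_ge0.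
have nR : 0 < n%:R :> R by rewrite ltr0n.
pose c := (s 0%N + s n.-1) / 2.
have vle : variance x <= n%:R * ((s n.-1 - s 0%N) ^+ 2 / 4).
  apply: le_trans (_ : \sum_(i < n) (x i - c) ^+ 2 <= _).
    by rewrite sum_sqr_shift// lerDl mulr_ge0 ?sqr_ge0 ?ltW.
  have -> : n%:R * ((s n.-1 - s 0%N) ^+ 2 / 4) =
      \sum_(i < n) (s n.-1 - s 0%N) ^+ 2 / 4.
    by rewrite sumr_const card_ord mulr_natl.
  apply: ler_sum => i _; have [d dn ->] := s_ix i.
  have h1 : s 0%N <= s d by exact: s_le.
  have h2 : s d <= s n.-1 by apply: s_le; lia.
  by rewrite /c; nra.
have vD : variance x <= n%:R ^+ 2 / 4 * D.
  by apply: le_trans vle _; rewrite expr2; nra.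
have : 2 * w / n%:R ^+ 2 * variance x <= w / 2 * D.
  have -> : w / 2 * D = 2 * w / n%:R ^+ 2 * (n%:R ^+ 2 / 4 * D).
    by field; rewrite gt_eqF.
  by rewrite ler_wpM2l// divr_ge0 ?sqr_ge0// mulr_ge0// ltW.
by lra.
Qed.
End contraction.

(** Contraction factor, over a window of [iota] rounds, of the Euclidean distance
    to consensus; its square bounds the factor [1 - 2 * w / n ^+ 2] of the
    variance. *)
Definition window_rate (R : realType) (n : nat) (w : R) : R :=
  1 - w / (2 * n%:R ^+ 2).

Lemma window_rate_bounds (R : realType) (n : nat) (w : R) :
  (0 < n)%N -> 0 < w < 1 -> 0 < window_rate n w < 1.
Proof.
move=> n0 /andP[w0 w1]; rewrite /window_rate.
have n1 : 1 <= n%:R ^+ 2 :> R by rewrite exprn_ege1// ler1n.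
have n2 : 0 < 2 * n%:R ^+ 2 :> R by lra.
have : 0 < w / (2 * n%:R ^+ 2) by rewrite divr_gt0.
have : w / (2 * n%:R ^+ 2) < 1 by rewrite ltr_pdivrMr//; lra.
lra.
Qed.

Section rate.
Context (R : realType) (n iota : nat) (w : R) (E : nat -> rel 'I_n).
Context (W : nat -> 'M[R]_n).
Hypotheses (n0 : (0 < n)%N) (hW : mixing_matrix E W) (hA : assumption_A E W w iota).
Local Notation kappa := (window_rate n w).

Lemma variance_rate (t : nat) (x : 'I_n -> R) (k : nat) : (1 <= t)%N ->
  variance (mix_iter W t x k) <= (kappa ^+ (k %/ iota)) ^+ 2 * variance x.
Proof.
move=> t1; have [w01 iota0 A] := hA; have /andP[k0 k1] := window_rate_bounds n0 w01.
have dW s : (1 <= s)%N -> doubly_stochastic (W s) by move=> /A[].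
have wW s i j : (1 <= s)%N -> 0 < W s i j -> w <= W s i j by move=> /A[+ _ _]; exact.
have posW s i j : (1 <= s)%N -> E s j i || (i == j) -> 0 < W s i j.
  by move=> s1; have [] := hW i j s1.
have cW s : (1 <= s)%N -> strongly_connected
    [rel a b : 'I_n | [exists l : 'I_iota, 0 < W (s + l)%N b a]].
  move=> s1 a b; have [_ _ /(_ a b)] := A s s1.
  apply: connect_sub => {}a {}b /= /existsP[l El]; apply: connect1.
  by apply/existsP; exists l; apply: posW; rewrite ?addn_gt0 ?s1// El.
have nonincr s y l : (1 <= s)%N -> variance (mix_iter W s y l) <= variance y.
  move=> s1; elim: l => //= l; apply: le_trans.
  by apply: variance_mix_le => //; apply: dW; rewrite addn_gt0 s1.
have window s y : (1 <= s)%N ->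
    variance (mix_iter W s y iota) <= kappa ^+ 2 * variance y.
  move=> s1; have w0 : 0 < w by case/andP: w01.
  have sk k' : (1 <= s + k')%N by rewrite addn_gt0 s1.
  apply: le_trans (variance_window n0 iota0 w0 _ _ _ (cW s s1) y) _.
  - by move=> k'; exact: dW.
  - by move=> k' i; apply: posW; rewrite ?eqxx ?orbT.
  - by move=> k' i j; exact: wW.
  rewrite ler_wpM2r ?variance_ge0// /window_rate.
  set a := w / (2 * n%:R ^+ 2).
  have -> : 2 * w / n%:R ^+ 2 = 4 * a.
    by rewrite /a; field; rewrite pnatr_eq0 -lt0n.
  have a0 : 0 <= a by rewrite divr_ge0 ?mulr_ge0 ?sqr_ge0// ltW.
  by nra.
have iter l : variance (mix_iter W t x (l * iota)) <= (kappa ^+ l) ^+ 2 * variance x.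
  elim: l => [|l IH]; first by rewrite mul0n expr0 expr1n mul1r.
  rewrite mulSn addnC mix_iterD; apply: le_trans (window _ _ _) _.
    by rewrite addn_gt0 t1.
  by apply: le_trans (ler_wpM2l (sqr_ge0 _) IH) _; rewrite mulrA -exprMn -exprS.
rewrite {1}(divn_eq k iota) mix_iterD; apply: le_trans (iter _).
by apply: nonincr; rewrite addn_gt0 t1.
Qed.

Definition spread (x : 'I_n -> R) : R := enorm (\row_i (x i - mean x)).

Lemma spread_sqr x : spread x ^+ 2 = variance x.
Proof. by rewrite enorm_sqr; apply: eq_bigr => i _; rewrite !mxE. Qed.

Lemma spread_sum (K : nat) (F : 'I_K -> 'I_n -> R) :
  spread (fun i => \sum_(s < K) F s i) <= \sum_(s < K) spread (F s).
Proof.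
apply: le_trans (enorm_sum _ _ _); rewrite le_eqVlt; apply/orP; left; apply/eqP.
congr enorm; apply/rowP => i; rewrite summxE mxE.
under [RHS]eq_bigr do rewrite mxE.
rewrite sumrB; congr (_ - _).
by rewrite /mean exchange_big/= mulr_suml.
Qed.

Lemma sum_abs_dev_le x : \sum_(i < n) `|x i - mean x| <= Num.sqrt n%:R * spread x.
Proof.
rewrite -(@ler_pXn2r _ 2)// ?nnegrE ?sumr_ge0 ?mulr_ge0 ?sqrtr_ge0 ?enorm_ge0//.
rewrite exprMn sqr_sqrtr ?ler0n// spread_sqr; apply: le_trans (sqr_sum_le _) _.
rewrite ler_wpM2l ?ler0n//; apply: ler_sum => i _.
by rewrite real_normK ?num_real.
Qed.

Lemma spread_le (x : 'I_n -> R) (b : R) :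
  (forall i, `|x i| <= b) -> spread x <= Num.sqrt n%:R * b.
Proof.
move=> xb; have b0 : 0 <= b by apply: le_trans (xb (Ordinal n0)).
rewrite -(@ler_pXn2r _ 2)// ?nnegrE ?mulr_ge0 ?sqrtr_ge0 ?enorm_ge0//.
rewrite spread_sqr exprMn sqr_sqrtr ?ler0n//.
apply: le_trans (_ : \sum_(i < n) (x i - 0) ^+ 2 <= _).
  by rewrite sum_sqr_shift// lerDl mulr_ge0 ?sqr_ge0.
have -> : n%:R * b ^+ 2 = \sum_(i < n) b ^+ 2.
  by rewrite sumr_const card_ord mulr_natl.
apply: ler_sum => i _; rewrite subr0 -real_normK ?num_real//.
by rewrite lerXn2r// ?nnegrE// xb.
Qed.

Lemma spread_rate (t : nat) (x : 'I_n -> R) (k : nat) : (1 <= t)%N ->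
  spread (mix_iter W t x k) <= kappa ^+ (k %/ iota) * spread x.
Proof.
move=> t1; have [w01 _ _] := hA; have /andP[k0 _] := window_rate_bounds n0 w01.
rewrite -(@ler_pXn2r _ 2)// ?nnegrE ?mulr_ge0 ?enorm_ge0 ?exprn_ge0 ?(ltW k0)//.
by rewrite exprMn !spread_sqr variance_rate.
Qed.

(** Rounding the exponent of a geometric sequence up to whole windows costs one
    factor [kappa]. *)
Lemma geometric_window (lambda : R) (K : nat) :
  0 < lambda < 1 -> lambda ^+ iota = kappa ->
  \sum_(j < K) kappa ^+ (j %/ iota) <= (kappa * (1 - lambda))^-1.
Proof.
move=> /andP[l0 l1] lk; have [w01 iota0 _] := hA.
have /andP[k0 k1] := window_rate_bounds n0 w01.
have step j : kappa ^+ (j %/ iota) <= kappa^-1 * lambda ^+ j.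
  rewrite {2}(divn_eq j iota) exprD mulnC exprM lk mulrCA ler_peMr ?exprn_ge0 ?(ltW k0)//.
  rewrite ler_pdivlMl// mulr1 -lk; apply: ler_wiXn2l; rewrite ?(ltW l0) ?(ltW l1)//.
  by rewrite ltnW// ltn_mod.
apply: le_trans (ler_sum _ (fun (j : 'I_K) _ => step j)) _.
rewrite -mulr_sumr invfM ler_wpM2l ?invr_ge0 ?(ltW k0)//.
rewrite -[leRHS]mul1r ler_pdivlMr ?subr_gt0// mulrC.
have := subrX1 lambda K => h.
have : 0 <= lambda ^+ K by rewrite exprn_ge0// ltW.
have -> : (1 - lambda) * \sum_(i < K) lambda ^+ i = 1 - lambda ^+ K.
  by rewrite -opprB mulNr -h opprB.
lra.
Qed.

(** Perturbed consensus: every perturbation injected at a round is forgotten at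
    the geometric rate, so the total disagreement is proportional to the total
    size of the perturbations. *)
Lemma total_disagreement (lambda : R) (V e : nat -> 'I_n -> R) (b : nat -> R)
    (T : nat) :
  0 < lambda < 1 -> lambda ^+ iota = kappa ->
  (forall i, V 0%N i = 0) ->
  (forall k i, V k.+1 i = mix (W k.+1) (V k) i + e k i) ->
  (forall k i, `|e k i| <= b k) ->
  \sum_(k < T) \sum_(i < n) `|mix (W k.+1) (V k) i - mean (V k)|
    <= n%:R / (kappa * (1 - lambda)) * \sum_(k < T) b k.
Proof.
move=> l01 lk V0 Vrec eb; have [w01 iota0 A] := hA.
have /andP[k0 k1] := window_rate_bounds n0 w01.
have dW s : (1 <= s)%N -> doubly_stochastic (W s) by move=> /A[].
have unroll k i : V k i = \sum_(s < k) mix_iter W s.+2 (e s) (k.-1 - s) i.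
  elim: k i => [|k IH] i; first by rewrite big_ord0.
  rewrite Vrec big_ord_recr/= subnn/=; congr (_ + _).
  rewrite /mix (eq_bigr (fun j => \sum_(s < k) W k.+1 i j * mix_iter W s.+2 (e s) (k.-1 - s) j));
    last by move=> j _; rewrite IH mulr_sumr.
  rewrite exchange_big/=; apply: eq_bigr => s _.
  have -> : (k - s = (k.-1 - s).+1)%N by have := ltn_ord s; lia.
  by rewrite /= /mix; have -> : (s.+2 + (k.-1 - s) = k.+1)%N by have := ltn_ord s; lia.
have b0 k : 0 <= b k by apply: le_trans (eb k (Ordinal n0)).
have spV k : spread (V k) <=
    Num.sqrt n%:R * \sum_(s < k) kappa ^+ ((k.-1 - s) %/ iota) * b s.
  have -> : V k = fun i => \sum_(s < k) mix_iter W s.+2 (e s) (k.-1 - s) i.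
    by apply/funext => i; exact: unroll.
  apply: le_trans (spread_sum _) _; rewrite mulr_sumr; apply: ler_sum => s _.
  apply: le_trans (spread_rate _ _ _) _ => //.
  by rewrite mulrCA ler_wpM2l ?exprn_ge0 ?(ltW k0)// spread_le.
have dis k : \sum_(i < n) `|mix (W k.+1) (V k) i - mean (V k)| <=
    n%:R * \sum_(s < k) kappa ^+ ((k.-1 - s) %/ iota) * b s.
  rewrite -(mean_mix (V k) (dW k.+1 isT)).
  apply: le_trans (sum_abs_dev_le _) _.
  have e1 : n%:R = Num.sqrt n%:R * Num.sqrt n%:R :> R.
    by rewrite -expr2 sqr_sqrtr ?ler0n.
  rewrite [X in _ <= X * _]e1 -mulrA ler_wpM2l ?sqrtr_ge0//; apply: le_trans (spV k).
  rewrite -(@ler_pXn2r _ 2)// ?nnegrE ?enorm_ge0// !spread_sqr.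
  exact: variance_mix_le (dW _ _).
apply: le_trans (ler_sum _ (fun (k : 'I_T) _ => dis k)) _.
rewrite -mulr_sumr -mulrA ler_wpM2l ?ler0n//.
have -> : \sum_(k < T) \sum_(s < k) kappa ^+ ((k.-1 - s) %/ iota) * b s =
    \sum_(s < T) \sum_(k < T | (s < k)%N) kappa ^+ ((k.-1 - s) %/ iota) * b s.
  rewrite (exchange_big_dep xpredT)//=; apply: eq_bigr => k _.
  rewrite (big_ord_widen_cond T xpredT
    (fun s => kappa ^+ ((k.-1 - s) %/ iota) * b s)) ?(ltnW (ltn_ord k))//.
rewrite mulr_sumr; apply: ler_sum => s _; rewrite -mulr_suml ler_wpM2r//.
apply: le_trans (geometric_window T l01 lk).
have -> : \sum_(k < T | (s < k)%N) kappa ^+ ((k.-1 - s) %/ iota) =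
    \sum_(j < T - s.+1) kappa ^+ (j %/ iota).
  rewrite -(big_mkord (fun k => (s < k)%N) (fun k => kappa ^+ ((k.-1 - s) %/ iota))).
  rewrite -(big_mkord xpredT (fun k => kappa ^+ (k %/ iota))).
  rewrite (@big_cat_nat _ _ _ s.+1)//= big_nat_cond big1 ?Monoid.mul1m; last first.
    by move=> k; rewrite ltnS => /andP[/andP[_ ks] sk]; move: ks; rewrite leqNgt sk.
  rewrite -{1}(add0n s.+1) big_addn.
  rewrite big_nat_cond [RHS]big_nat_cond; apply: eq_big => [k|k _].
    by rewrite addnS ltnS leq_addl andbT.
  by rewrite addnS/= addnK.
rewrite -!(big_mkord xpredT (fun k => kappa ^+ (k %/ iota))).
rewrite [leRHS](@big_cat_nat _ _ _ (T - s.+1))//= ?leq_subr// lerDl sumr_ge0// => k _.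
by rewrite exprn_ge0// ltW.
Qed.
End rate.

(** * Sums of powers *)

(** Concavity of the power [b], as the weighted arithmetic-geometric mean
    inequality. *)
Lemma powR_increment_ge (R : realType) (b : R) (k : nat) : 0 < b < 1 ->
  b * k.+1%:R `^ (b - 1) <= k.+1%:R `^ b - k%:R `^ b.
Proof.
move=> /andP[b0 b1]; have k1 : 0 < k.+1%:R :> R by rewrite ltr0n.
have kn0 : k.+1%:R != 0 :> R by rewrite gt_eqF.
have h : k%:R `^ b * k.+1%:R `^ (1 - b) <= k.+1%:R - b.
  have := @conjugate_powR R (k%:R `^ b) (k.+1%:R `^ (1 - b)) b^-1 (1 - b)^-1.
  rewrite !powR_ge0 !invr_gt0 b0 subr_gt0 b1 !invrK addrC subrK.
  move=> /(_ isT isT isT isT erefl).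
  rewrite -!powRrM !divff ?gt_eqF ?subr_gt0// !powRr1 ?ler0n// -natr1; lra.
have e1 : k.+1%:R `^ b = k.+1%:R `^ (b - 1) * k.+1%:R :> R.
  rewrite -[X in _ * X]powRr1 ?ler0n// -powRD ?subrK//.
  by rewrite kn0 implybT.
have e2 : k.+1%:R `^ (1 - b) * k.+1%:R `^ (b - 1) = 1 :> R.
  by rewrite -powRD ?kn0 ?implybT// addrA subrK subrr powRr0.
have p0 : 0 < k.+1%:R `^ (b - 1) :> R by rewrite powR_gt0.
have := ler_wpM2r (ltW p0) h; rewrite -mulrA e2 mulr1 mulrBl (mulrC k.+1%:R) -e1.
lra.
Qed.

Lemma sum_powR_le (R : realType) (b : R) (T : nat) : 0 < b < 1 ->
  \sum_(1 <= t < T.+1) t.+1%:R `^ (b - 1) <= T%:R `^ b / b.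
Proof.
move=> b01; have /andP[b0 b1] := b01.
rewrite ler_pdivlMr// mulrC big_add1/= mulr_sumr.
have -> : T%:R `^ b = \sum_(0 <= k < T) (k.+1%:R `^ b - k%:R `^ b) :> R.
  by rewrite telescope_sumr// (_ : 0%:R `^ b = 0) ?subr0// powR0// gt_eqF.
apply: ler_sum => k _; apply: le_trans (powR_increment_ge k b01).
rewrite ler_pM2l//.
have -> : b - 1 = - (1 - b) by ring.
rewrite !powRN lef_pV2 ?posrE ?powR_gt0 ?ltr0n//.
by rewrite ge0_ler_powR ?nnegrE ?ler0n ?ler_nat// subr_ge0 ltW.
Qed.

Lemma powR_nat_ge1 (R : realType) (a : R) (t : nat) : 0 <= a -> (1 <= t)%N ->
  1 <= t%:R `^ a.
Proof.
move=> a0 t1; rewrite -[leLHS](powRr0 t%:R) ler_powR ?ler1n//.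
Qed.

Lemma powR_nat_le (R : realType) (a : R) (s t : nat) : 0 <= a -> (s <= t)%N ->
  s%:R `^ a <= t%:R `^ a.
Proof. by move=> a0 st; rewrite ge0_ler_powR ?nnegrE ?ler0n ?ler_nat. Qed.

Lemma powRS_le2 (R : realType) (a : R) (t : nat) : 0 <= a <= 1 -> (1 <= t)%N ->
  t.+1%:R `^ a <= 2 * t%:R `^ a.
Proof.
move=> /andP[a0 a1] t1; apply: le_trans (_ : (2 * t%:R) `^ a <= _).
  by rewrite ge0_ler_powR ?nnegrE ?mulr_ge0 ?ler0n// -natrM ler_nat; lia.
rewrite powRM ?ler0n// ler_wpM2r ?powR_ge0//.
by rewrite -[leRHS]powRr1// ler_powR// ler1n.
Qed.

(** Write the left power as [t * t ^ (- a)] and use that [t ^ (- a)]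
    decreases. *)
Lemma powR_increment_le (R : realType) (a : R) (t : nat) : 0 <= a ->
  t.+1%:R `^ (1 - a) - t%:R `^ (1 - a) <= t.+1%:R `^ (- a).
Proof.
move=> a0; have t1 : t.+1%:R != 0 :> R by rewrite pnatr_eq0.
have e1 : t.+1%:R `^ (1 - a) = t.+1%:R * t.+1%:R `^ (- a) :> R.
  by rewrite powRD ?t1 ?implybT// powRr1 ?ler0n.
case: t t1 e1 => [|t] t1 e1; first by rewrite e1 mul1r gerBl powR_ge0.
have t2 : t.+1%:R != 0 :> R by rewrite pnatr_eq0.
have -> : t.+1%:R `^ (1 - a) = t.+1%:R * t.+1%:R `^ (- a) :> R.
  by rewrite powRD ?t2 ?implybT// powRr1 ?ler0n.
have : t.+2%:R `^ (- a) <= t.+1%:R `^ (- a) :> R.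
  by rewrite !powRN lef_pV2 ?posrE ?powR_gt0 ?ltr0n// powR_nat_le.
move=> h; rewrite e1 lerBlDr -[X in _ <= X + _]mul1r.
apply: le_trans (_ : 1 * t.+2%:R `^ (- a) + t.+1%:R * t.+2%:R `^ (- a) <= _).
  by rewrite -mulrDl (addrC 1) natr1.
by rewrite lerD2l ler_wpM2l ?ler0n.
Qed.

(** * Shrunk decision sets *)

Lemma mx_norm_le_enorm (R : realType) (p : nat) (v : 'rV[R]_p) :
  `|v| <= enorm v.
Proof.
rewrite -[`|v|]/(mx_norm v) mx_normrE; apply: bigmax_le; first exact: enorm_ge0.
by move=> [i k] _ /=; rewrite ord1 coord_le_enorm.
Qed.

Lemma ball_bounded_compact (R : realType) (p : nat) (K : set 'rV[R]_p) (M : R) :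
  closed K -> (forall v, K v -> enorm v <= M) -> compact K.
Proof.
move=> cK KM; apply: bounded_closed_compact => //.
exists M; split; first exact: num_real.
move=> M' MM' v Kv /=; apply: le_trans (mx_norm_le_enorm v) _.
by apply: le_trans (KM v Kv) (ltW MM').
Qed.

Lemma scaled_set_compact (R : realType) (p : nat) (K : set 'rV[R]_p) (c : R) :
  compact K -> compact (scaled_set c K).
Proof.
move=> cK; apply: continuous_compact => //.
by apply: continuous_subspaceT => v; exact: scaler_continuous.
Qed.

Lemma scaled_set_convex (R : realType) (p : nat) (K : set 'rV[R]_p) (c : R) :
  convex_set (M := 'rV[R]_p) K -> convex_set (M := 'rV[R]_p) (scaled_set c K).
Proof.
move=> cK x y t; rewrite !inE => -[x' Kx' <-] [y' Ky' <-].
exists (t%:num *: x' + (1 - t%:num) *: y').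
  by have := cK x' y' t; rewrite !inE; exact.
rewrite -[RHS]/(t%:num *: (c *: x') + (1 - t%:num) *: (c *: y')).
by apply/rowP => k; rewrite !mxE; ring.
Qed.

Lemma le_max_over (R : realType) (n : nat) (F : 'I_n -> R) i : F i <= max_over F.
Proof. exact: le_bigmax. Qed.

Section run.
Context (R : realType) (n m : nat) (p : 'I_n -> nat).
Context (X : forall i : 'I_n, set 'rV[R]_(p i)).
Context (f : strategy R p R) (g : strategy R p 'rV[R]_m).
Context (E : nat -> rel 'I_n) (W : nat -> 'M[R]_n) (w : R) (iota : nat).
Context (r Rad Ff Fg Gf Gg : 'I_n -> R) (theta1 theta2 theta3 : R).
Context (u z x : path_of R p) (q : nat -> 'I_n -> 'rV[R]_m).
Local Arguments X : clear implicits.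
Local Arguments f : clear implicits.
Local Arguments g : clear implicits.
Hypotheses (hn : (0 < n)%N) (hm : (0 < m)%N) (hp : forall i, (0 < p i)%N).
Hypotheses (hW : mixing_matrix E W) (hA : assumption_A E W w iota).
Hypothesis hB : assumption_B X r Rad Ff Fg Gf Gg f g.
Hypotheses (htheta1 : 0 < theta1 < 1) (htheta2 : 0 < theta2 < theta1 / 3).
Hypothesis htheta3 : theta2 < theta3 <= (theta1 - theta2) / 2.
Hypothesis hu : forall t i, (1 <= t)%N -> enorm (u t i) = 1.

Local Notation alpha i t := (r i ^+ 2 /
        (4 * m%:R * (p i)%:R ^+ 2 * Fg i ^+ 2 * t%:R `^ theta1)).
Local Notation beta t := (2 / t%:R `^ theta2).
Local Notation gamma t := (1 / t%:R `^ (1 - theta2)).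
Local Notation xi t := (1 / (t + 1)%:R `^ theta3).
Local Notation delta i t := (r i / (t + 1)%:R `^ theta3).
Hypothesis halg : algorithm1 X W (fun i t => alpha i t) (fun i t => beta t)
  (fun i t => gamma t) (fun i t => xi t) (fun i t => delta i t) f g u z x q.
Local Notation FG := (max_over Fg).

Lemma Fg_le i : Fg i <= FG. Proof. exact: le_max_over. Qed.

Lemma FG_ge0 : 0 <= FG.
Proof.
have [_ _ _ [_ Fg0 _ _] _] := hB (Ordinal hn).
by apply: le_trans (ltW Fg0) (Fg_le _).
Qed.

Lemma X_convex i : convex_set (M := 'rV[R]_(p i)) (X i).
Proof. by have [[]] := hB i. Qed.

Lemma X_bounded i v : X i v -> enorm v <= Rad i.
Proof.
have [_ [_ Rad0] [_ h] _ _] := hB i => /h[b b1 <-].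
by rewrite enormZ gtr0_norm// ler_piMr// ltW.
Qed.

Lemma X_ball i v : enorm v <= 1 -> X i (r i *: v).
Proof. by have [_ _ [h _] _ _] := hB i => v1; apply: h; exists v. Qed.

Lemma X_compact i : compact (X i).
Proof.
have [[_ cX] _ _ _ _] := hB i.
by apply: (ball_bounded_compact (M := Rad i)) => // v; exact: X_bounded.
Qed.

Lemma X_zero i : X i 0.
Proof. by have := @X_ball i 0; rewrite enorm0 scaler0; apply; exact: ler01. Qed.

Lemma theta3_gt0 : 0 < theta3.
Proof. by case/andP: htheta3; case/andP: htheta2; lra. Qed.

Lemma xi_gt0 t : 0 < xi t.
Proof. by rewrite divr_gt0// powR_gt0// ltr0n addn1. Qed.

Lemma xi_le1 t : xi t <= 1.
Proof.
rewrite ler_pdivrMr ?powR_gt0 ?ltr0n ?addn1// mul1r powR_nat_ge1//.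
exact: ltW theta3_gt0.
Qed.

Lemma xi_mono t : xi t.+1 <= xi t.
Proof.
rewrite !mul1r lef_pV2 ?posrE ?powR_gt0 ?ltr0n ?addn1// powR_nat_le//.
exact: ltW theta3_gt0.
Qed.

Lemma deltaE i t : delta i t = r i * xi t.
Proof. by rewrite mul1r. Qed.

Lemma delta_gt0 i t : 0 < delta i t.
Proof. by have [_ [r0 _] _ _ _] := hB i; rewrite deltaE mulr_gt0// xi_gt0. Qed.

(** Shrinking makes room for the perturbation. *)
Lemma shrunk_ball i t y v : scaled_set (1 - xi t) (X i) y -> enorm v <= 1 ->
  X i (y + delta i t *: v).
Proof.
move=> [y' Xy' <-] v1; rewrite deltaE.
have -> : (1 - xi t) *: y' + (r i * xi t) *: v =
    xi t *: (r i *: v) + (1 - xi t) *: y'.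
  by rewrite scalerA (mulrC (xi t)) addrC.
apply: convex_setP => //; [exact: X_convex|exact: X_ball|].
by rewrite (ltW (xi_gt0 t)) xi_le1.
Qed.

Lemma shrunk_in i t y : scaled_set (1 - xi t) (X i) y -> X i y.
Proof.
move=> /shrunk_ball => /(_ 0); rewrite enorm0 scaler0 addr0; apply; exact: ler01.
Qed.

Lemma shrunk_mono i t y :
  scaled_set (1 - xi t) (X i) y -> scaled_set (1 - xi t.+1) (X i) y.
Proof.
move=> [y' Xy' <-].
have h1 := xi_mono t; have h2 := xi_gt0 t.+1; have h3 := xi_le1 t.
have [e|e] := eqVneq (1 - xi t.+1) 0.
  exists y' => //; rewrite e; congr (_ *: _); lra.
have e0 : 0 < 1 - xi t.+1 by rewrite lt_def e; lra.
pose s := (1 - xi t) / (1 - xi t.+1).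
exists (s *: y' + (1 - s) *: 0).
  apply: convex_setP => //; [exact: X_convex|exact: X_zero|].
  rewrite /s; move: h1 h2 h3 e0.
  set a := xi t; set b := xi t.+1 => h1 h2 h3 e0.
  by rewrite ler_pdivrMr// mul1r divr_ge0/=; lra.
by rewrite scaler0 addr0 scalerA mulrC divfK.
Qed.

(** * One run of the algorithm *)

(** The mixed multipliers are indexed by the round whose multipliers are mixed,
    so that round [t] is governed by [qmix t]. *)
Definition qmix t i : 'rV[R]_m := \sum_(j < n) W t i j *: q t j.

Definition gval t i : 'rV[R]_m := g i t x (x t i).

(** The two gradient estimates add up to the estimate of this Lagrangian. *)
Definition lagrangian t i (v : 'rV[R]_(p i)) : R :=
  f i t x v + \sum_(j < m) qmix t i ord0 j * g i t x v ord0 j.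

Definition direction t i : 'rV[R]_(p i) :=
  ((p i)%:R / delta i t * lagrangian t (x t i)) *: u t i.

Lemma z_shrunk t i : (1 <= t)%N -> scaled_set (1 - xi t) (X i) (z t i).
Proof.
have [z1 _ _ rec] := halg; case: t => // -[_|t _]; first exact: z1.
have [-> _] := rec i t.+2 isT.
apply: (proj1 (proj_nearest _ _ _)); first exact/scaled_set_compact/X_compact.
by exists ((1 - xi t.+2) *: 0), 0 => //; exact: X_zero.
Qed.

Lemma x_def t i : (1 <= t)%N -> x t i = z t i + delta i t *: u t i.
Proof. by have [_ _ h _] := halg => t1; rewrite h. Qed.

Lemma x_in t i : (1 <= t)%N -> X i (x t i).
Proof.
by move=> t1; rewrite x_def//; apply: shrunk_ball; [exact: z_shrunk|rewrite hu].
Qed.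

Lemma past_x t : past_in X t x.
Proof. by move=> s i /andP[s1 _]; exact: x_in. Qed.

Lemma f_subdiff t i : (1 <= t)%N -> subdifferentiable (X i) (Gf i) (f i t x).
Proof.
move=> t1; have [_ _ _ _ /(_ t x t1 (@past_x t))[h _]] := hB i.
exact: regular_on_subdifferentiable (@X_convex i) h.
Qed.

Lemma g_subdiff t i j : (1 <= t)%N ->
  subdifferentiable (X i) (Gg i) (fun v => g i t x v ord0 j).
Proof.
move=> t1; have [_ _ _ _ /(_ t x t1 (@past_x t))[_ h]] := hB i.
exact: regular_on_subdifferentiable (@X_convex i) (h j).
Qed.

Lemma f_bound t i v : (1 <= t)%N -> X i v -> `|f i t x v| <= Ff i.
Proof.
move=> t1; have [_ _ _ _ /(_ t x t1 (@past_x t))[[_ h _] _]] := hB i.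
exact: h.
Qed.

Lemma g_bound t i v j : (1 <= t)%N -> X i v -> `|g i t x v ord0 j| <= Fg i.
Proof.
move=> t1; have [_ _ _ _ /(_ t x t1 (@past_x t))[_ /(_ j)[_ h _]]] := hB i.
exact: h.
Qed.

Lemma gval_bound t i j : (1 <= t)%N -> `|gval t i ord0 j| <= FG.
Proof. by move=> t1; apply: le_trans (Fg_le i); apply: g_bound => //; exact: x_in. Qed.

Lemma z_step t i : (1 <= t)%N ->
  nearest (scaled_set (1 - xi t.+1) (X i))
    (z t i - alpha i t.+1 *: direction t i) (z t.+1 i).
Proof.
move=> t1; have [_ _ _ /(_ i t.+1)] := halg; rewrite ltnS => /(_ t1)[/= zE _].
have <- : grad_est_f (f i t x) (delta i t) (z t i) (u t i)
    + qmix t i *m grad_est_g (g i t x) (delta i t) (z t i) (u t i) = direction t i.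
  rewrite /grad_est_f /grad_est_g -scalemxAr mulmxA -x_def//.
  have -> : qmix t i *m (g i t x (x t i))^T =
      (\sum_(j < m) qmix t i ord0 j * g i t x (x t i) ord0 j)%:M.
    by apply/rowP => k; rewrite !mxE ord1 eqxx mulr1n; apply: eq_bigr => j _; rewrite mxE.
  by rewrite mul_scalar_mx scalerA -scalerDl -mulrDr.
rewrite zE; apply: proj_nearest; first exact/scaled_set_compact/X_compact.
by exists ((1 - xi t.+1) *: 0), 0 => //; exact: X_zero.
Qed.

Lemma q_step t i : (1 <= t)%N ->
  q t.+1 i = pospart ((1 - beta t.+1 * gamma t.+1) *: qmix t i
                      + gamma t.+1 *: gval t i).
Proof.
by move=> t1; have [_ _ _ /(_ i t.+1)] := halg; rewrite ltnS => /(_ t1)[].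
Qed.

Lemma q_one i : q 1 i = 0.
Proof. by have [_ h _ _] := halg. Qed.

Lemma dsW t : (1 <= t)%N -> doubly_stochastic (W t).
Proof. by move=> t1; have [_ _ /(_ t t1)[]] := hA. Qed.

Lemma qmix_coord t i j : qmix t i ord0 j = mix (W t) (fun k => q t k ord0 j) i.
Proof. by rewrite /qmix summxE; apply: eq_bigr => k _; rewrite mxE. Qed.

Lemma qmix_one i : qmix 1 i = 0.
Proof. by rewrite /qmix big1// => j _; rewrite q_one scaler0. Qed.

Lemma theta2_gt0 : 0 < theta2. Proof. by case/andP: htheta2. Qed.
Lemma theta2_lt : theta2 < 1 / 3.
Proof. by case/andP: htheta2; case/andP: htheta1; lra. Qed.

Lemma gamma_gt0 t : 0 < gamma t.+1.
Proof. by rewrite divr_gt0// powR_gt0// ltr0n. Qed.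
Lemma beta_gt0 t : 0 < beta t.+1.
Proof. by rewrite divr_gt0// powR_gt0// ltr0n. Qed.

Lemma beta_gamma t : beta t.+1 * gamma t.+1 = 2 / t.+1%:R.
Proof.
rewrite mul1r -mulrA -invfM -powRD; last by rewrite pnatr_eq0 implybT.
by rewrite addrC subrK powRr1 ?ler0n.
Qed.

(** The regularization caps the multipliers at [FG / beta t]. *)
Lemma q_bounds t i j : (1 <= t)%N ->
  0 <= q t i ord0 j <= FG * (t%:R `^ theta2 / 2).
Proof.
have FG0 := FG_ge0.
case: t => // t _; elim: t i => [|t IH] i.
  by rewrite q_one mxE lexx/= mulr_ge0// divr_ge0// powR_ge0.
rewrite q_step// pospartE !mxE le_max lexx/= ge_max.
rewrite mulr_ge0 ?divr_ge0 ?powR_ge0//=.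
set s := (1 - _); set B := t.+2%:R `^ theta2.
have s0 : 0 <= s.
  by rewrite /s beta_gamma subr_ge0 ler_pdivrMr ?ltr0n// mul1r ler_nat.
have qm : qmix t.+1 i ord0 j <= FG * (B / 2).
  rewrite qmix_coord; apply: mix_bound; first exact: dsW.
  move=> k _; have /andP[_ h] := IH k; apply: le_trans h _.
  by rewrite ler_wpM2l// ler_wpM2r// powR_nat_le// ltW// theta2_gt0.
have gv : gval t.+1 i ord0 j <= FG.
  by apply: le_trans (ler_norm _) _; exact: gval_bound.
have h1 : s * qmix t.+1 i ord0 j <= s * (FG * (B / 2)) by rewrite ler_wpM2l.
have h2 : gamma t.+2 * gval t.+1 i ord0 j <= gamma t.+2 * FG.
  by rewrite ler_wpM2l// ltW// gamma_gt0.
apply: le_trans (lerD h1 h2) _; rewrite le_eqVlt; apply/orP; left; apply/eqP.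
have B0 : B != 0 by rewrite gt_eqF// powR_gt0// ltr0n.
have -> : s = 1 - 2 / B * gamma t.+2 by [].
by set ga := gamma t.+2; field.
Qed.

Lemma qmix_bounds t i j : (1 <= t)%N ->
  0 <= qmix t i ord0 j <= FG * (t%:R `^ theta2 / 2).
Proof.
move=> t1; rewrite qmix_coord; apply/andP; split.
  have [W0 _ _] := dsW t1; apply: sumr_ge0 => k _.
  by rewrite mulr_ge0//; have /andP[] := q_bounds k j t1.
by apply: mix_bound => [|k _]; [exact: dsW|have /andP[] := q_bounds k j t1].
Qed.

(** * The dual update *)

Lemma dual_increment t i j : (1 <= t)%N ->
  `|gval t i ord0 j - beta t.+1 * qmix t i ord0 j| <= 2 * FG.
Proof.
move=> t1; have FG0 := FG_ge0.
have /andP[q0 qb] := qmix_bounds i j t1.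
have b1 : beta t.+1 * qmix t i ord0 j <= FG.
  apply: le_trans (_ : beta t.+1 * (FG * (t.+1%:R `^ theta2 / 2)) <= _).
    rewrite ler_wpM2l ?(ltW (beta_gt0 _))//; apply: le_trans qb _.
    by rewrite ler_wpM2l// ler_wpM2r// powR_nat_le// ltW// theta2_gt0.
  have B0 : t.+1%:R `^ theta2 != 0 :> R by rewrite gt_eqF// powR_gt0// ltr0n.
  by rewrite le_eqVlt; apply/orP; left; apply/eqP; field.
have b0 : 0 <= beta t.+1 * qmix t i ord0 j by rewrite mulr_ge0// ltW// beta_gt0.
have := gval_bound i j t1; rewrite !ler_norml; lra.
Qed.

(** Expand the squared distance to [c] after one dual step; the projection on the
    orthant can only decrease it as [c] is nonnegative. *)
Lemma dual_step t i (c : 'rV[R]_m) : (1 <= t)%N -> (forall j, 0 <= c ord0 j) ->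
  inner c (gval t i) + t.+1%:R `^ (1 - theta2) / 2 * enorm (q t.+1 i - c) ^+ 2 <=
  inner (qmix t i) (gval t i) + 2 * m%:R * FG ^+ 2 * gamma t.+1
  + t.+1%:R `^ (1 - theta2) / 2 * enorm (qmix t i - c) ^+ 2
  - beta t.+1 * inner (qmix t i - c) (qmix t i).
Proof.
move=> t1 c0; set P := t.+1%:R `^ (1 - theta2).
have P0 : 0 < P by rewrite powR_gt0// ltr0n.
set ga := gamma t.+1; have gaE : ga = P^-1 by rewrite /ga mul1r.
set b := beta t.+1.
pose v := gval t i - b *: qmix t i.
have h1 : enorm v ^+ 2 <= m%:R * (2 * FG) ^+ 2.
  apply: enorm_le_coord => j; have := dual_increment i j t1.
  by rewrite /v !mxE.
have h2 : enorm (q t.+1 i - c) ^+ 2 <= enorm ((qmix t i - c) + ga *: v) ^+ 2.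
  rewrite -enorm_le_sqr q_step//; apply: le_trans (pospart_contract _ c0) _.
  rewrite le_eqVlt; apply/orP; left; apply/eqP; congr enorm.
  by apply/rowP => j; rewrite !mxE -/ga -/b; ring.
rewrite (enormD_sqr (qmix t i - c)) enormZ exprMn real_normK ?num_real// innerZr in h2.
have h3 : inner (qmix t i - c) v = inner (qmix t i) (gval t i) - inner c (gval t i)
    - b * inner (qmix t i - c) (qmix t i).
  by rewrite /v innerBr innerZr innerBl.
have h4 : P / 2 * enorm (q t.+1 i - c) ^+ 2 <= P / 2 * (enorm (qmix t i - c) ^+ 2 +
   2 * (ga * inner (qmix t i - c) v) + ga ^+ 2 * (m%:R * (2 * FG) ^+ 2)).
  rewrite ler_pM2l ?divr_gt0//; apply: le_trans h2 _.
  by rewrite lerD2l ler_wpM2l ?sqr_ge0.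
have e : P / 2 * (enorm (qmix t i - c) ^+ 2 +
   2 * (ga * inner (qmix t i - c) v) + ga ^+ 2 * (m%:R * (2 * FG) ^+ 2)) =
   P / 2 * enorm (qmix t i - c) ^+ 2 + inner (qmix t i - c) v
   + 2 * m%:R * FG ^+ 2 * ga.
  by rewrite gaE; field; rewrite gt_eqF.
by rewrite e h3 in h4; lra.
Qed.

Local Notation dual_reward t :=
  (\sum_(i < n) (inner (qmix t i) (gval t i) + 2 * m%:R * FG ^+ 2 * gamma t.+1
    - beta t.+1 / 8 * enorm (qmix t i) ^+ 2)).

(** Mixing with doubly stochastic weights keeps the mean and does not increase
    the variance. *)
Lemma qmix_dist t (c : 'rV[R]_m) : (1 <= t)%N ->
  \sum_(i < n) enorm (qmix t i - c) ^+ 2 <= \sum_(i < n) enorm (q t i - c) ^+ 2.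
Proof.
move=> t1; have dW := dsW t1; have [W0 rW _] := dW.
under eq_bigr do rewrite enorm_sqr /inner.
under [leRHS]eq_bigr do rewrite enorm_sqr /inner.
rewrite exchange_big/= [leRHS]exchange_big/=; apply: ler_sum => j _.
have hv := variance_mix_le (fun k => q t k ord0 j) hn dW.
have e1 := sum_sqr_shift (mix (W t) (fun k => q t k ord0 j)) (c ord0 j) hn.
have e2 := sum_sqr_shift (fun k => q t k ord0 j) (c ord0 j) hn.
rewrite mean_mix// in e1.
under eq_bigr do rewrite !mxE -expr2 -/(qmix _ _ _ _) qmix_coord.
rewrite [leRHS](eq_bigr (fun i => (q t i ord0 j - c ord0 j) ^+ 2)) => [|i _].
  by rewrite e1 e2; lra.
by rewrite !mxE -expr2.
Qed.

(** The price, in units of [|c| ^ 2], of comparing one learner's multipliers with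
    [c] until round [T]. *)
Definition dual_cost (T : nat) : R :=
  2 `^ (- theta2) + 3 / 4 * \sum_(2 <= t < T.+1) t.+1%:R `^ (- theta2).

Lemma powR_split t : t.+1%:R `^ (1 - theta2) = t.+1%:R * t.+1%:R `^ (- theta2) :> R.
Proof. by rewrite powRD ?pnatr_eq0 ?implybT// powRr1 ?ler0n. Qed.

Lemma betaE t : beta t.+1 = 2 * t.+1%:R `^ (- theta2).
Proof. by rewrite powRN. Qed.

(** The regularization pays for the growth of the telescoping weights
    [t ^ (1 - theta2) / 2].  In the first round [qmix] vanishes and the initial
    weight has to be paid in full: this is the first term of [dual_cost]. *)
Lemma dual_sum (T : nat) (c : 'rV[R]_m) : (forall j, 0 <= c ord0 j) ->
  \sum_(1 <= t < T.+2) \sum_(i < n) inner c (gval t i)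
    + T.+2%:R `^ (1 - theta2) / 2 * \sum_(i < n) enorm (q T.+2 i - c) ^+ 2 <=
  \sum_(1 <= t < T.+2) dual_reward t + n%:R * enorm c ^+ 2 * dual_cost T.+1.
Proof.
move=> c0.
have step t : (1 <= t)%N -> \sum_(i < n) inner c (gval t i)
    + t.+1%:R `^ (1 - theta2) / 2 * \sum_(i < n) enorm (q t.+1 i - c) ^+ 2 <=
    \sum_(i < n) (inner (qmix t i) (gval t i) + 2 * m%:R * FG ^+ 2 * gamma t.+1
    + t.+1%:R `^ (1 - theta2) / 2 * enorm (qmix t i - c) ^+ 2
    - beta t.+1 * inner (qmix t i - c) (qmix t i)).
  move=> t1; rewrite mulr_sumr -big_split/=; apply: ler_sum => i _.
  exact: dual_step.
elim: T => [|T IH].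
  rewrite !big_nat1 /dual_cost big_geq// mulr0 addr0.
  apply: le_trans (step 1%N isT) _.
  have -> : n%:R * enorm c ^+ 2 * 2 `^ (- theta2) =
      \sum_(i < n) enorm c ^+ 2 * 2 `^ (- theta2).
    by rewrite sumr_const card_ord -mulrA mulr_natl.
  rewrite -big_split/=; apply: ler_sum => i _.
  rewrite qmix_one !inner0l inner0r enorm0 sub0r enormN expr0n/=.
  rewrite (powR_split 1) !mulr0 !subr0 add0r lerD2l.
  by rewrite le_eqVlt; apply/orP; left; apply/eqP; field.
rewrite big_nat_recr//= [in leRHS]big_nat_recr//=.
have -> : dual_cost T.+2 = dual_cost T.+1 + 3 / 4 * T.+3%:R `^ (- theta2).
  by rewrite /dual_cost big_nat_recr//= mulrDr addrA.
rewrite mulrDr; have := step T.+2 isT.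
set s := T.+3%:R `^ (- theta2); set P := T.+3%:R `^ (1 - theta2).
have s0 : 0 <= s by exact: powR_ge0.
have PE : P = T.+3%:R * s by exact: powR_split.
rewrite betaE -/s.
set D := \sum_(i < n) enorm (q T.+2 i - c) ^+ 2 in IH *.
have Ps : 0 <= P / 2 - 2 * s / 4.
  have : 3 * s <= T.+3%:R * s by rewrite ler_wpM2r// ler_nat.
  by rewrite PE; lra.
have hD : (P / 2 - 2 * s / 4) * \sum_(i < n) enorm (qmix T.+2 i - c) ^+ 2 <=
   T.+2%:R `^ (1 - theta2) / 2 * D.
  apply: le_trans (ler_wpM2l Ps (qmix_dist c (isT : (1 <= T.+2)%N))) _.
  rewrite ler_wpM2r ?sumr_ge0// => [i _|]; first exact: sqr_ge0.
  by have := powR_increment_le T.+2 (ltW theta2_gt0); rewrite -/P -/s; lra.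
have hv : \sum_(i < n) (inner (qmix T.+2 i) (gval T.+2 i) + 2 * m%:R * FG ^+ 2 * gamma T.+3
    + P / 2 * enorm (qmix T.+2 i - c) ^+ 2
    - 2 * s * inner (qmix T.+2 i - c) (qmix T.+2 i)) <=
  dual_reward T.+2 + n%:R * enorm c ^+ 2 * (3 / 4 * s)
  + (P / 2 - 2 * s / 4) * \sum_(i < n) enorm (qmix T.+2 i - c) ^+ 2.
  have -> : n%:R * enorm c ^+ 2 * (3 / 4 * s) = \sum_(i < n) enorm c ^+ 2 * (3 / 4 * s).
    by rewrite sumr_const card_ord -mulrA mulr_natl.
  rewrite mulr_sumr -!big_split/=; apply: ler_sum => i _.
  set Q := qmix T.+2 i; set G := inner Q _ + _.
  rewrite betaE -/s innerBl -enorm_sqr enormB_sqr (innerC c Q).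
  (* what is left over is s times |Q - c / 2|^2 + |Q|^2 / 4 *)
  have : 0 <= s * enorm (Q - 2^-1 *: c) ^+ 2 by rewrite mulr_ge0// sqr_ge0.
  rewrite enormB_sqr innerZr enormZ exprMn real_normK ?num_real//.
  have := mulr_ge0 s0 (sqr_ge0 (enorm Q)); have := mulr_ge0 s0 (sqr_ge0 (enorm c)).
  nra.
move=> h; move: IH h hv hD; rewrite betaE -/s.
set S1 := \sum_(1 <= t < T.+2) \sum_(i < n) inner c (gval t i).
lra.
Qed.

(** By concavity of the power [1 - theta2], an increment of the right hand side
    exceeds [(1 - theta2 / 2) * t ^ (- theta2)], and [theta2 <= 1 / 2]. *)
Lemma dual_cost_le (T : nat) :
  dual_cost T.+1 <= (1 + 1 / (1 - theta2)) / 2 * T.+1%:R `^ (1 - theta2).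
Proof.
have t2 := theta2_gt0; have t2' := theta2_lt.
have x1 : 1 <= 1 / (1 - theta2) by rewrite ler_pdivlMr ?mul1r; lra.
elim: T => [|T IH].
  rewrite /dual_cost big_geq// mulr0 addr0 powR1 mulr1.
  apply: le_trans (_ : 1 <= _); last by lra.
  by rewrite powRN invf_le1 ?powR_gt0// (powR_nat_ge1 (t := 2))// ltW.
have -> : dual_cost T.+2 = dual_cost T.+1 + 3 / 4 * T.+3%:R `^ (- theta2).
  by rewrite /dual_cost big_nat_recr//= mulrDr addrA.
have b01 : 0 < 1 - theta2 < 1 by lra.
have := powR_increment_ge T.+1 b01.
have -> : 1 - theta2 - 1 = - theta2 by ring.
have : T.+3%:R `^ (- theta2) <= T.+2%:R `^ (- theta2) :> R.
  by rewrite !powRN lef_pV2 ?posrE ?powR_gt0 ?ltr0n// powR_nat_le// ltW.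
have := powR_ge0 T.+3%:R (- theta2) : 0 <= _ :> R.
move: IH; set a := T.+3%:R `^ (- theta2); set b := T.+2%:R `^ (- theta2).
set B := (1 + _) / 2 => IH a0 ab h.
have BB : B * (1 - theta2) = 1 - theta2 / 2 by rewrite /B; field; lra.
have B1 : 1 <= B by rewrite /B; lra.
have h1 : B * ((1 - theta2) * b) <= B * (T.+2%:R `^ (1 - theta2) - T.+1%:R `^ (1 - theta2)).
  by rewrite ler_wpM2l//; lra.
rewrite mulrA BB in h1; nra.
Qed.

(** * The primal update *)

(* [eta i t] is the inverse of [2 * alpha i t]. *)
Local Notation eta i t := (2 * m%:R * (p i)%:R ^+ 2 * Fg i ^+ 2 / r i ^+ 2
  * t%:R `^ theta1).

Lemma alpha_gt0 i t : 0 < alpha i t.+1.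
Proof.
have [_ [r0 _] _ [_ Fg0 _ _] _] := hB i.
by rewrite divr_gt0 ?exprn_gt0// !mulr_gt0 ?exprn_gt0 ?powR_gt0 ?ltr0n.
Qed.

Lemma eta_alpha i t : 2 * eta i t.+1 * alpha i t.+1 = 1.
Proof.
have [_ [r0 _] _ [_ Fg0 _ _] _] := hB i.
have T0 : t.+1%:R `^ theta1 != 0 :> R by rewrite gt_eqF// powR_gt0// ltr0n.
have m0 : m%:R != 0 :> R by rewrite pnatr_eq0 -lt0n.
have p0 : (p i)%:R != 0 :> R by rewrite pnatr_eq0 -lt0n.
by field; rewrite T0 m0 p0 !gt_eqF.
Qed.

Lemma eta_mono i s t : (s <= t)%N -> eta i s <= eta i t.
Proof.
have [_ [r0 _] _ [_ Fg0 _ _] _] := hB i => st.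
rewrite ler_wpM2l//; last by rewrite powR_nat_le//; case/andP: htheta1; lra.
by rewrite divr_ge0 ?sqr_ge0// !mulr_ge0 ?(ltW Fg0).
Qed.

Lemma eta_ge0 i t : 0 <= eta i t.
Proof.
have [_ [r0 _] _ [_ Fg0 _ _] _] := hB i.
by rewrite mulr_ge0 ?powR_ge0// divr_ge0 ?sqr_ge0// !mulr_ge0 ?(ltW Fg0).
Qed.

(** The projection does not move [z t.+1] away from [y]; expand the square of the
    distance before projecting. *)
Lemma primal_step t i (y : 'rV[R]_(p i)) : (1 <= t)%N ->
  scaled_set (1 - xi t.+1) (X i) y ->
  inner (direction t i) (z t i - y) <=
  eta i t.+1 * (enorm (z t i - y) ^+ 2 - enorm (z t.+1 i - y) ^+ 2)
  + alpha i t.+1 / 2 * enorm (direction t i) ^+ 2.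
Proof.
move=> t1 Ky; have a0 := alpha_gt0 i t; have ea := eta_alpha i t.
have e0 := eta_ge0 i t.+1.
have := nearest_contract (scaled_set_convex (c := 1 - xi t.+1) (@X_convex i)) (z_step i t1) Ky.
rewrite enorm_le_sqr.
have -> : z t i - alpha i t.+1 *: direction t i - y =
  (z t i - y) - alpha i t.+1 *: direction t i by rewrite addrAC.
rewrite (enormB_sqr (z t i - y)) enormZ exprMn real_normK ?num_real// innerZr.
rewrite (innerC (z t i - y)).
move: a0 ea e0; set A := alpha i t.+1; set e := eta i t.+1 => a0 ea e0 h.
have h' := ler_wpM2l e0 h.
set I := inner _ _ in h' *; set N := enorm (direction t i) ^+ 2 in h' *.
have e1 : e * (2 * (A * I)) = I.
  have -> : e * (2 * (A * I)) = 2 * e * A * I by ring.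
  by rewrite ea mul1r.
have e2 : e * (A ^+ 2 * N) = A / 2 * N.
  have -> : e * (A ^+ 2 * N) = (2 * e * A) * (A / 2 * N) by field.
  by rewrite ea mul1r.
by rewrite mulrDr mulrBr e1 e2 in h'; lra.
Qed.

(** The comparator has to lie in the sets on which [z] is projected. *)
Definition shrink (y : path_of R p) t i : 'rV[R]_(p i) := (1 - xi t) *: y t i.

Lemma shrink_in (y : path_of R p) t i : X i (y t i) ->
  scaled_set (1 - xi t) (X i) (shrink y t i).
Proof. by move=> Xy; exists (y t i). Qed.

Lemma shrink_move (y : path_of R p) t i : X i (y t i) ->
  enorm (shrink y t.+1 i - shrink y t i) <=
  enorm (y t.+1 i - y t i) + (xi t - xi t.+1) * Rad i.
Proof.
move=> Xy; have h1 := xi_mono t; have h2 := xi_gt0 t.+1; have h3 := xi_le1 t.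
have -> : shrink y t.+1 i - shrink y t i =
    (1 - xi t.+1) *: (y t.+1 i - y t i) + (xi t - xi t.+1) *: y t i.
  by apply/rowP => k; rewrite !mxE; move: (xi t) (xi t.+1) => a b; ring.
move: h1 h2 h3; set a := xi t; set b := xi t.+1 => h1 h2 h3.
apply: le_trans (enormD _ _) _; rewrite !enormZ !ger0_norm; try lra.
apply: lerD; first by rewrite ler_piMl ?enorm_ge0//; lra.
by rewrite ler_wpM2l ?X_bounded//; lra.
Qed.

Lemma dist_bound i v v' : X i v -> X i v' -> enorm (v - v') <= 2 * Rad i.
Proof.
move=> Xv Xv'; apply: le_trans (enormB _ _) _.
by have := X_bounded Xv; have := X_bounded Xv'; lra.
Qed.

Lemma sqr_dist_change i (v a b : 'rV[R]_(p i)) : X i v -> X i a -> X i b ->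
  enorm (v - a) ^+ 2 <= enorm (v - b) ^+ 2 + 4 * Rad i * enorm (a - b).
Proof.
move=> Xv Xa Xb; have h1 := dist_bound Xv Xa; have h2 := dist_bound Xv Xb.
have := enormD (v - b) (b - a); rewrite addrA subrK (enormC b).
have := enorm_ge0 (v - a); have := enorm_ge0 (v - b); have := enorm_ge0 (a - b).
nra.
Qed.

(** Summation by parts with increasing weights.  The comparator moves, and each
    move changes a squared distance by at most four radii times its length. *)
Lemma primal_telescope (y : path_of R p) i (T : nat) :
  (forall t, (1 <= t <= T.+1)%N -> X i (y t i)) ->
  \sum_(1 <= t < T.+2) eta i t.+1 *
     (enorm (z t i - shrink y t i) ^+ 2 - enorm (z t.+1 i - shrink y t i) ^+ 2)
  + eta i T.+2 * enorm (z T.+2 i - shrink y T.+1 i) ^+ 2 <=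
  eta i T.+2 * (4 * Rad i ^+ 2)
  + \sum_(1 <= t < T.+1) eta i t.+1 *
      (4 * Rad i * enorm (shrink y t.+1 i - shrink y t i)).
Proof.
have sq v v' : X i v -> X i v' -> enorm (v - v') ^+ 2 <= 4 * Rad i ^+ 2.
  by move=> Xv Xv'; have := dist_bound Xv Xv'; have := enorm_ge0 (v - v'); nra.
have zX t : (1 <= t)%N -> X i (z t i) by move=> t1; exact: shrunk_in (z_shrunk i t1).
elim: T => [|T IH] Xy.
  rewrite big_nat1 (big_geq (leqnn 1)) addr0 mulrBr subrK ler_wpM2l ?eta_ge0//.
  by apply: sq; [exact: zX|exact: shrunk_in (shrink_in (Xy 1%N isT))].
have Xs t : (1 <= t <= T.+2)%N -> X i (shrink y t i).
  by move=> tT; exact: shrunk_in (shrink_in (Xy t tT)).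
rewrite big_nat_recr//= [in leRHS]big_nat_recr//=.
have wide t : (1 <= t <= T.+1)%N -> (1 <= t <= T.+2)%N by lia.
have {}IH := IH (fun t tT => Xy t (wide t tT)).
have h1 := sq _ _ (zX T.+2 isT) (Xs T.+2 _).
have h2 := @sqr_dist_change i (z T.+2 i) (shrink y T.+2 i) (shrink y T.+1 i)
  (zX T.+2 isT) (Xs T.+2 _) (Xs T.+1 _).
rewrite !ltnS !leqnn leqnSn in h1 h2.
have {}h1 := h1 isT; have {}h2 := h2 isT isT.
have h3 := eta_mono i (leqnSn T.+2); have h4 := eta_ge0 i T.+2.
have h5 : (eta i T.+3 - eta i T.+2) * enorm (z T.+2 i - shrink y T.+2 i) ^+ 2 <=
  (eta i T.+3 - eta i T.+2) * (4 * Rad i ^+ 2) by rewrite ler_wpM2l ?subr_ge0.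
have h6 := ler_wpM2l h4 h2.
move: IH h5 h6; set e3 := eta i T.+3; set e2 := eta i T.+2.
lra.
Qed.

Lemma primal_sum (y : path_of R p) i (T : nat) :
  (forall t, (1 <= t <= T.+1)%N -> X i (y t i)) ->
  \sum_(1 <= t < T.+2) inner (direction t i) (z t i - shrink y t i) <=
  \sum_(1 <= t < T.+2) alpha i t.+1 / 2 * enorm (direction t i) ^+ 2
  + eta i T.+1 * (12 * Rad i ^+ 2)
  + eta i T.+1 * (4 * Rad i * \sum_(1 <= t < T.+1) enorm (y t.+1 i - y t i)).
Proof.
move=> Xy; have [_ [r0 Rad0] _ _ _] := hB i.
have h1 : \sum_(1 <= t < T.+2) inner (direction t i) (z t i - shrink y t i) <=
   \sum_(1 <= t < T.+2) eta i t.+1 *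
     (enorm (z t i - shrink y t i) ^+ 2 - enorm (z t.+1 i - shrink y t i) ^+ 2)
   + \sum_(1 <= t < T.+2) alpha i t.+1 / 2 * enorm (direction t i) ^+ 2.
  rewrite -big_split/= big_nat_cond [leRHS]big_nat_cond; apply: ler_sum => t.
  rewrite andbT ltnS => tT; apply: primal_step; first by case/andP: tT.
  by apply: shrunk_mono; apply: shrink_in; exact: Xy.
have h2 := primal_telescope Xy.
have h3 : 0 <= eta i T.+2 * enorm (z T.+2 i - shrink y T.+1 i) ^+ 2.
  by rewrite mulr_ge0 ?eta_ge0 ?sqr_ge0.
have h4 : eta i T.+2 * (4 * Rad i ^+ 2) <= eta i T.+1 * (8 * Rad i ^+ 2).
  have : T.+2%:R `^ theta1 <= 2 * T.+1%:R `^ theta1 :> R.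
    by apply: powRS_le2 => //; case/andP: htheta1 => *; rewrite !ltW.
  move=> hT; have C0 : 0 <= 2 * m%:R * (p i)%:R ^+ 2 * Fg i ^+ 2 / r i ^+ 2.
    have [_ _ _ [_ Fg0 _ _] _] := hB i.
    by rewrite divr_ge0 ?sqr_ge0// !mulr_ge0 ?(ltW Fg0).
  have := ler_wpM2l C0 hT; have := sqr_ge0 (Rad i); nra.
pose D t := enorm (y t.+1 i - y t i) + (xi t - xi t.+1) * Rad i.
have h5 : \sum_(1 <= t < T.+1) eta i t.+1 *
      (4 * Rad i * enorm (shrink y t.+1 i - shrink y t i)) <=
    eta i T.+1 * (4 * Rad i) * \sum_(1 <= t < T.+1) D t.
  rewrite mulr_sumr big_nat_cond [leRHS]big_nat_cond; apply: ler_sum => t.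
  rewrite andbT ltnS => /andP[t1 tT]; rewrite -[leRHS]mulrA.
  have h := shrink_move (Xy t _); have {}h := h (_ : (1 <= t <= T.+1)%N).
  apply: ler_pM; [exact: eta_ge0| |exact: eta_mono|].
    by rewrite !mulr_ge0 ?enorm_ge0 ?(ltW Rad0).
  by rewrite ler_wpM2l ?mulr_ge0 ?(ltW Rad0)//; apply: h; rewrite t1 ltnW.
have h6 : \sum_(1 <= t < T.+1) D t <=
    \sum_(1 <= t < T.+1) enorm (y t.+1 i - y t i) + Rad i.
  rewrite /D big_split/= lerD2l -mulr_suml ler_piMl ?(ltW Rad0)//.
  have -> : \sum_(1 <= t < T.+1) (xi t - xi t.+1) = xi 1 - xi T.+1.
    rewrite -opprB -(telescope_sumr (fun t => xi t)) ?ltnS// -sumrN.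
    by apply: eq_bigr => t _; rewrite opprB.
  by have := xi_gt0 T.+1; have := xi_le1 1; move: (xi 1) (xi T.+1) => a b; lra.
have h7 : eta i T.+1 * (4 * Rad i) * \sum_(1 <= t < T.+1) D t <=
    eta i T.+1 * (4 * Rad i) * (\sum_(1 <= t < T.+1) enorm (y t.+1 i - y t i) + Rad i).
  by rewrite ler_wpM2l// mulr_ge0 ?eta_ge0// mulr_ge0// ltW.
move: h1 h2 h3 h4 h5 h7; set e1 := eta i T.+1; set e2 := eta i T.+2.
rewrite expr2; lra.
Qed.

Lemma sum_qmix_sqr t i : (\sum_(j < m) qmix t i ord0 j) ^+ 2 <= m%:R * enorm (qmix t i) ^+ 2.
Proof.
apply: le_trans (sqr_sum_le _) _; rewrite ler_wpM2l// enorm_sqr.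
by apply: ler_sum => j _; rewrite expr2.
Qed.

Lemma lagrangian_bound t i v : (1 <= t)%N -> X i v ->
  `|lagrangian t v| <= Ff i + Fg i * \sum_(j < m) qmix t i ord0 j.
Proof.
move=> t1 Xv; apply: le_trans (ler_normD _ _) _; apply: lerD; first exact: f_bound.
rewrite mulr_sumr; apply: le_trans (ler_norm_sum _ _ _) _; apply: ler_sum => j _.
have /andP[q0 _] := qmix_bounds i j t1.
by rewrite normrM ger0_norm// mulrC ler_wpM2r// g_bound.
Qed.

(** The step sizes are tuned so that the second moment of the one-point
    estimate, of order [t ^ (2 theta3)] times the squared multipliers, is
    absorbed by the dual regularization. *)
Lemma direction_cost t i : (1 <= t)%N ->
  alpha i t.+1 / 2 * enorm (direction t i) ^+ 2 <=
  Ff i ^+ 2 / (4 * m%:R * Fg i ^+ 2) * t.+1%:R `^ (2 * theta3 - theta1)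
  + beta t.+1 / 8 * enorm (qmix t i) ^+ 2.
Proof.
move=> t1; have [_ [r0 _] _ [Ff0 Fg0 _ _] _] := hB i.
rewrite enormZ hu// mulr1 real_normK ?num_real// addn1.
set Phi := lagrangian t (x t i); set Q := enorm (qmix t i) ^+ 2.
have Phi2 : Phi ^+ 2 <= 2 * Ff i ^+ 2 + 2 * Fg i ^+ 2 * (m%:R * Q).
  have := lagrangian_bound t1 (x_in i t1); rewrite -/Phi.
  have := sum_qmix_sqr t i; rewrite -/Q.
  set S := \sum_(j < m) _ => hS hP.
  have S0 : 0 <= S by apply: sumr_ge0 => j _; have /andP[] := qmix_bounds i j t1.
  have h1 : Phi ^+ 2 <= (Ff i + Fg i * S) ^+ 2.
    by rewrite -[leLHS]real_normK ?num_real// lerXn2r// nnegrE (le_trans (normr_ge0 Phi)).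
  have h2 : Fg i ^+ 2 * S ^+ 2 <= Fg i ^+ 2 * (m%:R * Q) by rewrite ler_wpM2l ?sqr_ge0.
  have h3 := sqr_ge0 (Ff i - Fg i * S).
  nra.
have m0 : m%:R != 0 :> R by rewrite pnatr_eq0 -lt0n.
have p0 : (p i)%:R != 0 :> R by rewrite pnatr_eq0 -lt0n.
set P3 := t.+1%:R `^ theta3; set P1 := t.+1%:R `^ theta1.
have P30 : 0 < P3 by rewrite powR_gt0// ltr0n.
have P10 : 0 < P1 by rewrite powR_gt0// ltr0n.
have tn0 : t.+1%:R != 0 :> R by rewrite pnatr_eq0.
have PE : t.+1%:R `^ (2 * theta3 - theta1) = P3 ^+ 2 / P1 :> R.
  rewrite powRB ?tn0 ?implybT// -/P1; congr (_ / _).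
  by rewrite mulrDl mul1r powRD ?tn0 ?implybT// expr2.
have K0 : 0 <= P3 ^+ 2 / P1 / (8 * m%:R * Fg i ^+ 2).
  by rewrite divr_ge0 ?divr_ge0 ?(ltW P10) ?sqr_ge0// mulr_ge0 ?sqr_ge0// mulr_ge0.
have -> : r i ^+ 2 / (4 * m%:R * (p i)%:R ^+ 2 * Fg i ^+ 2 * P1) / 2 *
    ((p i)%:R / (r i / P3) * Phi) ^+ 2 = P3 ^+ 2 / P1 / (8 * m%:R * Fg i ^+ 2) * Phi ^+ 2.
  by field; rewrite m0 p0 !gt_eqF.
apply: le_trans (ler_wpM2l K0 Phi2) _.
have Q0 : 0 <= Q by exact: sqr_ge0.
have h : P3 ^+ 2 / P1 <= t.+1%:R `^ (- theta2).
  rewrite -PE ler_powR// ?ler1n//.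
  by case/andP: htheta3; case/andP: htheta1; lra.
have -> : P3 ^+ 2 / P1 / (8 * m%:R * Fg i ^+ 2) *
    (2 * Ff i ^+ 2 + 2 * Fg i ^+ 2 * (m%:R * Q)) =
    Ff i ^+ 2 / (4 * m%:R * Fg i ^+ 2) * (P3 ^+ 2 / P1) + P3 ^+ 2 / P1 * Q / 4.
  by field; rewrite m0 !gt_eqF.
rewrite PE lerD2l betaE; have := ler_wpM2r Q0 h; lra.
Qed.

(** * Regret and violation along one run *)

Definition lagrangian_slope t i : R := Gf i + \sum_(j < m) qmix t i ord0 j * Gg i.

Lemma lagrangian_subdiff t i : (1 <= t)%N ->
  subdifferentiable (X i) (lagrangian_slope t i) (lagrangian t (i := i)).
Proof.
move=> t1; apply: subdifferentiableD; first exact: f_subdiff.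
apply: (subdifferentiable_sum (f := fun j v => g i t x v ord0 j)) => j.
  by have /andP[] := qmix_bounds i j t1.
exact: g_subdiff.
Qed.

Lemma lagrangian_slope_bounds t i : (1 <= t)%N ->
  0 <= lagrangian_slope t i <= Gf i + m%:R * FG * Gg i * (t%:R `^ theta2 / 2).
Proof.
move=> t1; have [_ _ _ [_ _ Gf0 Gg0] _] := hB i.
rewrite /lagrangian_slope -mulr_suml; apply/andP; split.
  rewrite addr_ge0 ?(ltW Gf0)// mulr_ge0 ?(ltW Gg0)// sumr_ge0// => j _.
  by have /andP[] := qmix_bounds i j t1.
rewrite lerD2l mulrAC ler_pM2r//.
have -> : m%:R * FG * (t%:R `^ theta2 / 2) = \sum_(j < m) FG * (t%:R `^ theta2 / 2).
  by rewrite sumr_const card_ord -mulrA mulr_natl.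
by apply: ler_sum => j _; have /andP[] := qmix_bounds i j t1.
Qed.

(** The error of the gradient estimate in the direction of the comparator; its
    expectation is nonnegative. *)
Definition estimation_gap t i (y : 'rV[R]_(p i)) : R :=
  inner (direction t i) (z t i - y)
  - (lagrangian t (z t i) - lagrangian t y - lagrangian_slope t i * delta i t).

(** The learner plays [x] instead of [z] and competes with [y] instead of its
    shrunk copy; each replacement is a Lipschitz error of order
    [t ^ (- theta3)]. *)
Lemma lagrangian_regret (y : path_of R p) t i : (1 <= t)%N -> X i (y t i) ->
  lagrangian t (x t i) - lagrangian t (y t i) <=
  inner (direction t i) (z t i - shrink y t i) - estimation_gap t (shrink y t i)
  + lagrangian_slope t i * (2 * r i + Rad i) * t.+1%:R `^ (- theta3).
Proof.
move=> t1 Xy; have sL := @lagrangian_subdiff t i t1.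
have /andP[L0 _] := lagrangian_slope_bounds i t1.
have d0 := delta_gt0 i t.
have zX := shrunk_in (z_shrunk i t1); have sX := shrunk_in (shrink_in Xy).
have h1 : lagrangian t (x t i) - lagrangian t (z t i) <= lagrangian_slope t i * delta i t.
  apply: le_trans (subdifferentiable_lipschitz sL (x_in i t1) zX) _.
  by rewrite x_def// addrAC subrr add0r enormZ hu// mulr1 (gtr0_norm d0).
have h2 : lagrangian t (shrink y t i) - lagrangian t (y t i) <=
    lagrangian_slope t i * (xi t * Rad i).
  apply: le_trans (subdifferentiable_lipschitz sL sX Xy) _.
  have -> : shrink y t i - y t i = (- xi t) *: y t i.
    by rewrite /shrink scalerBl scale1r addrAC subrr add0r scaleNr.
  rewrite enormZ normrN (gtr0_norm (xi_gt0 t)) ler_wpM2l// ler_wpM2l ?(ltW (xi_gt0 t))//.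
  exact: X_bounded.
rewrite /estimation_gap powRN -(addn1 t).
move: h1 h2; rewrite !mul1r; set P := (t + 1)%:R `^ theta3.
lra.
Qed.

Local Notation exponent :=
  (Num.max theta1 (Num.max (1 - theta1 + 2 * theta3) (1 - theta3 + theta2))).

Lemma powR_exponent_le (a : R) (T : nat) : (1 <= T)%N ->
  [|| a <= theta1, a <= 1 - theta1 + 2 * theta3 | a <= 1 - theta3 + theta2] ->
  T%:R `^ a <= T%:R `^ exponent.
Proof.
by move=> T1 h; rewrite ler_powR ?ler1n// !le_max.
Qed.

Definition learner_constant i : R :=
  m%:R * FG * Gg i * (2 * r i + Rad i) / (1 - theta3 + theta2)
  + Gf i * (2 * r i + Rad i) / (1 - theta3)
  + 8 * m%:R * (p i)%:R ^+ 2 * Fg i ^+ 2 * Rad i ^+ 2 / r i ^+ 2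
  + Ff i ^+ 2 / (4 * m%:R * Fg i ^+ 2 * (1 - theta1 + 2 * theta3))
  + 16 * m%:R * (p i)%:R ^+ 2 * Fg i ^+ 2 * Rad i ^+ 2 / r i ^+ 2.

Definition path_constant i : R :=
  8 * m%:R * (p i)%:R ^+ 2 * Fg i ^+ 2 * Rad i / r i ^+ 2.

Lemma sum_combination (s : seq nat) (A B C D N : nat -> R) (a b : R) :
  \sum_(t <- s) (A t - B t + (a * C t + b * D t) - N t) =
  \sum_(t <- s) A t - \sum_(t <- s) B t
  + (a * \sum_(t <- s) C t + b * \sum_(t <- s) D t) - \sum_(t <- s) N t.
Proof. by rewrite !(big_split, sumrN)/= -!mulr_sumr. Qed.

(** The primal bound of one learner.  The cost of the gradient estimates is
    passed on to the dual regularization. *)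
Lemma learner_bound (y : path_of R p) i (T : nat) :
  (forall t, (1 <= t <= T.+1)%N -> X i (y t i)) ->
  \sum_(1 <= t < T.+2) (lagrangian t (x t i) - lagrangian t (y t i)
     - beta t.+1 / 8 * enorm (qmix t i) ^+ 2) <=
  learner_constant i * T.+1%:R `^ exponent
  + path_constant i * T.+1%:R `^ theta1
    * \sum_(1 <= t < T.+1) enorm (y t.+1 i - y t i)
  - \sum_(1 <= t < T.+2) estimation_gap t (shrink y t i).
Proof.
move=> Xy; have [_ [r0 Rad0] _ [Ff0 Fg0 Gf0 Gg0] _] := hB i.
have FG0 := FG_ge0.
have t2 := theta2_gt0; have t2' := theta2_lt; have t3 := theta3_gt0.
have t1b : theta1 < 1 by case/andP: htheta1.
have t32 : theta2 < theta3 by case/andP: htheta3.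
have t31 : theta3 <= (theta1 - theta2) / 2 by case/andP: htheta3.
have m0 : 0 < m%:R :> R by rewrite ltr0n.
set M := T.+1%:R `^ exponent.
have M0 : 0 <= M by exact: powR_ge0.
pose rR := 2 * r i + Rad i.
have rR0 : 0 < rR by rewrite /rR; lra.
have slope t : (1 <= t)%N -> lagrangian_slope t i * rR * t.+1%:R `^ (- theta3) <=
    Gf i * rR * t.+1%:R `^ (1 - theta3 - 1)
    + m%:R * FG * Gg i * rR / 2 * t.+1%:R `^ (1 - theta3 + theta2 - 1).
  move=> t1; have /andP[_ hL] := lagrangian_slope_bounds i t1.
  have -> : 1 - theta3 - 1 = - theta3 by ring.
  have -> : 1 - theta3 + theta2 - 1 = theta2 + (- theta3) by ring.
  rewrite powRD ?pnatr_eq0 ?implybT//.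
  have : t%:R `^ theta2 <= t.+1%:R `^ theta2 :> R by rewrite powR_nat_le// ltW.
  have : 0 <= t.+1%:R `^ (- theta3) :> R by exact: powR_ge0.
  set a := t.+1%:R `^ (- theta3); set b := t%:R `^ theta2; set b' := t.+1%:R `^ theta2.
  move=> a0 bb; set C := m%:R * FG * Gg i in hL *.
  have C0 : 0 <= C by rewrite !mulr_ge0// ltW.
  have h1 : lagrangian_slope t i <= Gf i + C * (b' / 2).
    have bb2 : b / 2 <= b' / 2 by rewrite ler_pM2r ?invr_gt0.
    by apply: le_trans hL _; rewrite lerD2l; exact: ler_wpM2l.
  have := ler_wpM2r (mulr_ge0 (ltW rR0) a0) h1; lra.
have h1 : \sum_(1 <= t < T.+2) (lagrangian t (x t i) - lagrangian t (y t i)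
     - beta t.+1 / 8 * enorm (qmix t i) ^+ 2) <=
  \sum_(1 <= t < T.+2) (inner (direction t i) (z t i - shrink y t i)
    - estimation_gap t (shrink y t i)
    + (Gf i * rR * t.+1%:R `^ (1 - theta3 - 1)
       + m%:R * FG * Gg i * rR / 2 * t.+1%:R `^ (1 - theta3 + theta2 - 1))
    - beta t.+1 / 8 * enorm (qmix t i) ^+ 2).
  rewrite big_nat_cond [leRHS]big_nat_cond; apply: ler_sum => t.
  rewrite andbT ltnS => tT; rewrite lerD2r; have /andP[t1 _] := tT.
  by apply: le_trans (lagrangian_regret t1 (Xy t tT)) _; rewrite lerD2l slope.
have h2 := primal_sum Xy.
have h3 : \sum_(1 <= t < T.+2) alpha i t.+1 / 2 * enorm (direction t i) ^+ 2 <=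
    \sum_(1 <= t < T.+2)
      (Ff i ^+ 2 / (4 * m%:R * Fg i ^+ 2) * t.+1%:R `^ (1 - theta1 + 2 * theta3 - 1)
      + beta t.+1 / 8 * enorm (qmix t i) ^+ 2).
  rewrite big_nat_cond [leRHS]big_nat_cond; apply: ler_sum => t.
  rewrite andbT => /andP[t1 _].
  have -> : 1 - theta1 + 2 * theta3 - 1 = 2 * theta3 - theta1 by ring.
  exact: direction_cost.
rewrite sum_combination in h1; rewrite big_split/= -mulr_sumr in h3.
have pw a : 0 < a < 1 -> [|| a <= theta1, a <= 1 - theta1 + 2 * theta3 | a <= 1 - theta3 + theta2] ->
    \sum_(1 <= t < T.+2) t.+1%:R `^ (a - 1) <= M / a.
  move=> a01 ha; apply: le_trans (sum_powR_le T.+1 a01) _.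
  by rewrite ler_pM2r ?invr_gt0; [exact: powR_exponent_le|case/andP: a01].
have hs1 : \sum_(1 <= t < T.+2) t.+1%:R `^ (1 - theta3 - 1) <= M / (1 - theta3).
  by apply: pw; [lra|apply/or3P; constructor 3; lra].
have hs2 : \sum_(1 <= t < T.+2) t.+1%:R `^ (1 - theta3 + theta2 - 1) <= M / (1 - theta3 + theta2).
  by apply: pw; [lra|apply/or3P; constructor 3; lra].
have hs3 : \sum_(1 <= t < T.+2) t.+1%:R `^ (1 - theta1 + 2 * theta3 - 1) <= M / (1 - theta1 + 2 * theta3).
  by apply: pw; [lra|apply/or3P; constructor 2; lra].
have k1 := ler_wpM2l (mulr_ge0 (ltW Gf0) (ltW rR0)) hs1.
have C20 : 0 <= m%:R * FG * Gg i * rR by rewrite !mulr_ge0// ltW.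
have k2 := ler_wpM2l C20 hs2.
have C30 : 0 <= Ff i ^+ 2 / (4 * m%:R * Fg i ^+ 2).
  by rewrite divr_ge0 ?sqr_ge0// !mulr_ge0 ?(ltW Fg0)// ltW.
have k3 := ler_wpM2l C30 hs3.
have s2 : 0 <= \sum_(1 <= t < T.+2) t.+1%:R `^ (1 - theta3 + theta2 - 1) :> R.
  by apply: sumr_ge0 => t _; exact: powR_ge0.
have k2' := mulr_ge0 C20 s2.
have k4 : T.+1%:R `^ theta1 <= M by rewrite powR_exponent_le// lexx.
pose cc := m%:R * (p i)%:R ^+ 2 * Fg i ^+ 2 / r i ^+ 2.
have cc0 : 0 <= cc by rewrite divr_ge0 ?sqr_ge0// !mulr_ge0 ?(ltW Fg0)// ltW.
have k5 := ler_wpM2l (mulr_ge0 cc0 (sqr_ge0 (Rad i))) k4.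
have eE : eta i T.+1 = 2 * cc * T.+1%:R `^ theta1 by rewrite /cc; ring.
have lE : learner_constant i = m%:R * FG * Gg i * rR / (1 - theta3 + theta2)
  + Gf i * rR / (1 - theta3) + 24 * (cc * Rad i ^+ 2)
  + Ff i ^+ 2 / (4 * m%:R * Fg i ^+ 2) / (1 - theta1 + 2 * theta3).
  have n1 : 1 - theta3 + theta2 != 0 by rewrite gt_eqF//; lra.
  have n2 : 1 - theta3 != 0 by rewrite gt_eqF//; lra.
  have n3 : 1 - theta1 + 2 * theta3 != 0 by rewrite gt_eqF//; lra.
  have n4 : r i != 0 by rewrite gt_eqF.
  have n5 : Fg i != 0 by rewrite gt_eqF.
  have n6 : m%:R != 0 :> R by rewrite gt_eqF.
  by rewrite /learner_constant /rR /cc; field; rewrite n1 n2 n3 n4 n5 n6.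
have pE : path_constant i = 8 * cc * Rad i by rewrite /path_constant /cc; ring.
rewrite eE in h2; rewrite lE pE.
set PL := \sum_(1 <= t < T.+1) _ in h2 *; set P1 := T.+1%:R `^ theta1 in h2 k4 k5 *.
set D1 := \sum_(1 <= t < T.+2) inner _ _ in h1 h2.
lra.
Qed.

Definition decay : R := window_rate n w `^ (1 / iota%:R).

Lemma decay_bounds : 0 < decay < 1.
Proof.
have [w01 i0 _] := hA; have /andP[k0 k1] := window_rate_bounds hn w01.
rewrite powR_gt0//=; have i1 : 0 < 1 / iota%:R :> R by rewrite divr_gt0// ltr0n.
have := @gt0_ltr_powR R (1 / iota%:R) i1 (window_rate n w) 1.
by rewrite powR1 !nnegrE (ltW k0) ler01; apply.
Qed.

Lemma decay_iota : decay ^+ iota = window_rate n w.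
Proof.
have [w01 i0 _] := hA; have /andP[k0 k1] := window_rate_bounds hn w01.
rewrite -powR_mulrn ?powR_ge0// -powRrM mul1r mulVf ?pnatr_eq0 -?lt0n//.
by rewrite powRr1// ltW.
Qed.

(** The dual updates are the perturbations of a consensus iteration; each has
    size at most [2 * FG * gamma]. *)
Lemma disagreement_sum j (T : nat) :
  \sum_(1 <= t < T.+1) \sum_(i < n)
     `|qmix t i ord0 j - mean (fun k => q t k ord0 j)| <=
  n%:R / (window_rate n w * (1 - decay)) * (2 * FG * (T%:R `^ theta2 / theta2)).
Proof.
have t2 := theta2_gt0; have t2' := theta2_lt.
have [w01 i0 _] := hA; have /andP[k0 k1] := window_rate_bounds hn w01.
have /andP[l0 l1] := decay_bounds.
have := @total_disagreement R n iota w E W hn hW hA decay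
  (fun k i => q k.+1 i ord0 j) (fun k i => q k.+2 i ord0 j - qmix k.+1 i ord0 j)
  (fun k => 2 * FG * gamma k.+2) T decay_bounds decay_iota _ _ _.
rewrite big_add1/= big_mkord.
under eq_bigr => k _ do under eq_bigr => i _ do rewrite -qmix_coord.
move=> h; apply: le_trans (h _ _ _) _ => [i|k i|k i|].
- by rewrite q_one mxE.
- by rewrite -qmix_coord addrC subrK.
- rewrite q_step// pospartE !mxE.
  have /andP[q0 _] := qmix_bounds i j (isT : (1 <= k.+1)%N).
  have g0 := gamma_gt0 k.+1; have := dual_increment i j (isT : (1 <= k.+1)%N).
  set ga := gamma k.+2; set b := beta k.+2; set Q := qmix k.+1 i ord0 j in q0 *.
  set G := gval k.+1 i ord0 j => hd.
  apply: le_trans (_ : `|ga * (G - b * Q)| <= _).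
    rewrite -(@ler_pXn2r _ 2) ?nnegrE// !real_normK ?num_real//.
    have -> : ga * (G - b * Q) = (1 - b * ga) * Q + ga * G - Q by ring.
    by rewrite !expr2; exact: max0_contract.
  by rewrite normrM gtr0_norm// mulrC ler_pM2r.
apply: ler_wpM2l.
  by apply: divr_ge0 => //; apply: mulr_ge0; [exact: ltW|rewrite subr_ge0 ltW].
rewrite -mulr_sumr ler_wpM2l ?mulr_ge0 ?FG_ge0//.
have b01 : 0 < theta2 < 1 by lra.
apply: le_trans (sum_powR_le T b01); rewrite big_add1/= big_mkord.
apply: ler_sum => k _; rewrite mul1r -powRN opprB//.
Qed.

(** Feasibility bounds only the sum over the learners of their constraint values.
    Replacing the multipliers by their mean, which is nonnegative, costs the
    disagreement. *)
Lemma comparator_constraint (y : path_of R p) (T : nat) : feasible X g x T y ->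
  \sum_(1 <= t < T.+1) \sum_(i < n) inner (qmix t i) (g i t x (y t i)) <=
  2 * m%:R * n%:R * FG ^+ 2 / (window_rate n w * (1 - decay))
    * (T%:R `^ theta2 / theta2).
Proof.
move=> fy; have FG0 := FG_ge0.
have h t : (1 <= t < T.+1)%N ->
    \sum_(i < n) inner (qmix t i) (g i t x (y t i)) <=
    FG * \sum_(j < m) \sum_(i < n) `|qmix t i ord0 j - mean (fun k => q t k ord0 j)|.
  rewrite ltnS => tT; have [Xy gy] := fy t tT; have /andP[t1 _] := tT.
  rewrite mulr_sumr /inner exchange_big/=; apply: ler_sum => j _.
  set mu := mean _.
  have mu0 : 0 <= mu.
    by rewrite divr_ge0// sumr_ge0// => i _; have /andP[] := q_bounds i j t1.
  have -> : \sum_(i < n) qmix t i ord0 j * g i t x (y t i) ord0 j =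
      \sum_(i < n) (qmix t i ord0 j - mu) * g i t x (y t i) ord0 j
      + mu * (\sum_(i < n) g i t x (y t i)) ord0 j.
    by rewrite summxE mulr_sumr -big_split/=; apply: eq_bigr => i _; ring.
  have : mu * (\sum_(i < n) g i t x (y t i)) ord0 j <= 0.
    by rewrite mulr_ge0_le0.
  have : \sum_(i < n) (qmix t i ord0 j - mu) * g i t x (y t i) ord0 j <=
      FG * \sum_(i < n) `|qmix t i ord0 j - mu|.
    rewrite mulr_sumr; apply: ler_sum => i _; apply: le_trans (ler_norm _) _.
    rewrite normrM mulrC ler_wpM2r//; apply: le_trans (Fg_le i).
    exact: g_bound.
  lra.
apply: le_trans (_ : \sum_(1 <= t < T.+1) FG * \sum_(j < m) \sum_(i < n)
    `|qmix t i ord0 j - mean (fun k => q t k ord0 j)| <= _).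
  rewrite big_nat_cond [leRHS]big_nat_cond; apply: ler_sum => t.
  by rewrite andbT; exact: h.
rewrite -mulr_sumr exchange_big/=.
apply: le_trans (ler_wpM2l FG0 (ler_sum _ (fun j _ => disagreement_sum j T))) _.
rewrite sumr_const card_ord -[_ *+ m]mulr_natl.
rewrite le_eqVlt; apply/orP; left; apply/eqP; ring.
Qed.

(** Adding the primal bounds of the learners, the dual bound and the bound on the
    comparator cancels all terms in the multipliers.  The choice [c = 0] gives
    the regret, and a multiple of the positive part of the total constraint
    value gives the violation. *)
Lemma run_bound (y : path_of R p) (T : nat) (c : 'rV[R]_m) :
  (1 <= T)%N -> feasible X g x T y -> (forall j, 0 <= c ord0 j) ->
  regret f x y T + inner c (\sum_(1 <= t < T.+1) \sum_(i < n) g i t x (x t i))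
    - n%:R * enorm c ^+ 2 * ((1 + 1 / (1 - theta2)) / 2 * T%:R `^ (1 - theta2)) <=
  (\sum_(i < n) learner_constant i
    + (6 * m%:R * n%:R ^+ 2 * FG ^+ 2 * window_rate n w ^- 2 / (1 - decay)
       + 2 * m%:R * n%:R * FG ^+ 2) / theta2) * T%:R `^ exponent
  + max_over path_constant * T%:R `^ theta1 * path_length y T
  - \sum_(1 <= t < T.+1) \sum_(i < n) estimation_gap t (shrink y t i).
Proof.
case: T => // T _ fy c0; have FG0 := FG_ge0.
have t2 := theta2_gt0; have t2' := theta2_lt.
have [w01 i0 _] := hA; have /andP[k0 k1] := window_rate_bounds hn w01.
have /andP[l0 l1] := decay_bounds.
have hd := dual_sum T c0.
have P0 : 0 <= T.+2%:R `^ (1 - theta2) / 2 * \sum_(i < n) enorm (q T.+2 i - c) ^+ 2.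
  by rewrite mulr_ge0 ?divr_ge0 ?powR_ge0// sumr_ge0// => i _; exact: sqr_ge0.
have hc := ler_wpM2l (mulr_ge0 (ler0n R n) (sqr_ge0 (enorm c))) (dual_cost_le T).
have Xy i t : (1 <= t <= T.+1)%N -> X i (y t i) by move=> /fy[].
have hl := ler_sum (index_enum 'I_n) (P := xpredT) (fun i _ => learner_bound (Xy i)).
have hk := comparator_constraint fy.
set M := T.+1%:R `^ exponent in hl *.
have split_f : regret f x y T.+1 =
    \sum_(1 <= t < T.+2) \sum_(i < n) (f i t x (x t i) - f i t x (y t i)).
  by rewrite /regret -sumrB; apply: eq_bigr => t _; rewrite sumrB.
have split_c : inner c (\sum_(1 <= t < T.+2) \sum_(i < n) g i t x (x t i)) =
    \sum_(1 <= t < T.+2) \sum_(i < n) inner c (gval t i).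
  by rewrite inner_sumr; apply: eq_bigr => t _; rewrite inner_sumr.
have lagE t i v : lagrangian t v = f i t x v + inner (qmix t i) (g i t x v) by [].
have hL : \sum_(i < n) \sum_(1 <= t < T.+2) (lagrangian t (x t i) - lagrangian t (y t i)
     - beta t.+1 / 8 * enorm (qmix t i) ^+ 2) =
   regret f x y T.+1 + \sum_(1 <= t < T.+2) dual_reward t
   - \sum_(1 <= t < T.+2) \sum_(i < n) inner (qmix t i) (g i t x (y t i))
   - 2 * m%:R * FG ^+ 2 * n%:R * \sum_(1 <= t < T.+2) gamma t.+1.
  rewrite exchange_big/= split_f mulr_sumr -!sumrN -!big_split/=; apply: eq_bigr => t _.
  have -> : 2 * m%:R * FG ^+ 2 * n%:R * gamma t.+1 =
      \sum_(i < n) 2 * m%:R * FG ^+ 2 * gamma t.+1.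
    by rewrite sumr_const card_ord -[in RHS]mulr_natl; ring.
  rewrite -!sumrN -!big_split/=; apply: eq_bigr => i _.
  by rewrite !lagE /gval; ring.
have hg : \sum_(1 <= t < T.+2) gamma t.+1 <= M / theta2.
  apply: le_trans (_ : T.+1%:R `^ theta2 / theta2 <= _).
    have b01 : 0 < theta2 < 1 by lra.
    apply: le_trans (sum_powR_le T.+1 b01); apply: ler_sum => t _.
    by rewrite mul1r -powRN opprB.
  rewrite ler_pM2r ?invr_gt0// powR_exponent_le//.
  by apply/or3P; constructor 1; case/andP: htheta1; case/andP: htheta2; lra.
have hM2 : T.+1%:R `^ theta2 / theta2 <= M / theta2.
  rewrite ler_pM2r ?invr_gt0// powR_exponent_le//.
  by apply/or3P; constructor 1; case/andP: htheta1; case/andP: htheta2; lra.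
rewrite hL !big_split/= -mulr_suml sumrN [in leRHS]exchange_big/= in hl.
have hpath : \sum_(i < n) path_constant i * T.+1%:R `^ theta1 *
     \sum_(1 <= t < T.+1) enorm (y t.+1 i - y t i) <=
   max_over path_constant * T.+1%:R `^ theta1 * path_length y T.+1.
  rewrite /path_length exchange_big/= mulr_sumr; apply: ler_sum => i _.
  apply: ler_wpM2r; first by apply: sumr_ge0 => t _; exact: enorm_ge0.
  by apply: ler_wpM2r; [exact: powR_ge0|exact: le_max_over].
set K1 := window_rate n w in k0 k1 hk *.
have L1 : 0 < 1 - decay by rewrite subr_gt0.
have kk : 2 * m%:R * n%:R * FG ^+ 2 / (K1 * (1 - decay)) <=
    6 * m%:R * n%:R ^+ 2 * FG ^+ 2 * K1 ^- 2 / (1 - decay).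
  rewrite invfM mulrA ler_pM2r ?invr_gt0//.
  have n1 : 1 <= n%:R :> R by rewrite ler1n.
  have c1 : 0 <= m%:R * n%:R * FG ^+ 2 :> R by rewrite !mulr_ge0 ?sqr_ge0.
  have k2 : K1^-1 <= K1 ^- 2.
    by rewrite lef_pV2 ?posrE ?exprn_gt0// expr2 ger_pMl// ltW.
  have k3 : 0 <= K1^-1 by rewrite invr_ge0 ltW.
  have -> : 6 * m%:R * n%:R ^+ 2 * FG ^+ 2 * K1 ^- 2 =
     6 * (m%:R * n%:R * FG ^+ 2) * (n%:R * K1 ^- 2) by ring.
  have -> : 2 * m%:R * n%:R * FG ^+ 2 * K1^-1 = 2 * (m%:R * n%:R * FG ^+ 2) * K1^-1 by ring.
  apply: ler_pM; rewrite ?mulr_ge0//; first by lra.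
  by apply: (le_trans k2); rewrite ler_peMl// (le_trans k3 k2).
have hk2 : \sum_(1 <= t < T.+2) \sum_(i < n) inner (qmix t i) (g i t x (y t i)) <=
    6 * m%:R * n%:R ^+ 2 * FG ^+ 2 * K1 ^- 2 / (1 - decay) * (M / theta2).
  apply: le_trans hk _; apply: ler_pM => //.
    by rewrite divr_ge0 ?mulr_ge0 ?sqr_ge0// ltW.
  by rewrite divr_ge0 ?powR_ge0// ltW.
have hg2 := ler_wpM2l (mulr_ge0 (mulr_ge0 (mulr_ge0 (ler0n R 2) (ler0n R m)) (sqr_ge0 FG)) (ler0n R n)) hg.
rewrite split_c.
set PT := max_over path_constant * _ * _ in hpath *.
set SG := \sum_(1 <= t < T.+2) gamma t.+1 in hl hg hg2.
set SD := \sum_(1 <= t < T.+2) dual_reward t in hl hd.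
have e : (6 * m%:R * n%:R ^+ 2 * FG ^+ 2 * K1 ^- 2 / (1 - decay)
       + 2 * m%:R * n%:R * FG ^+ 2) / theta2 * M =
   6 * m%:R * n%:R ^+ 2 * FG ^+ 2 * K1 ^- 2 / (1 - decay) * (M / theta2)
   + 2 * m%:R * FG ^+ 2 * n%:R * (M / theta2) by ring.
rewrite [X in _ <= X + _ - _]mulrDl e.
lra.
Qed.
End run.

(** * Measurability of random vectors *)

Definition borelType (R : realType) (p : nat) :=
  g_sigma_algebraType [set A : set 'rV[R]_p | open A].

Lemma continuous_borel (R : realType) (p : nat) (F : 'rV[R]_p -> R) :
  continuous F -> measurable_fun [set: borelType R p] (F : borelType R p -> R).
Proof.
move=> /continuousP cF; apply: (measurability _ (RGenOpens.measurableE R)).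
move=> _ [_ [a [b ->] <-]]; rewrite setTI; apply: sub_sigma_algebra.
exact/cF/interval_open.
Qed.

Lemma measurable_coord (R : realType) (p : nat) (k : 'I_p) :
  measurable_fun [set: borelType R p] (fun v : borelType R p => v ord0 k).
Proof. exact: (continuous_borel (@coord_continuous R 1 p ord0 k)). Qed.

Lemma measurable_enorm (R : realType) (p : nat) :
  measurable_fun [set: borelType R p] (@enorm R p : borelType R p -> R).
Proof.
apply: continuous_borel => v; have := @continuous_enorm R p 0 v.
by rewrite (_ : (fun v => enorm (v - 0)) = @enorm R p)//; apply/funext => w; rewrite subr0.
Qed.

Section random_vectors.
Context (d : measure_display) (S : measurableType d) (R : realType).

(** Open sets are countable unions of boxes with rational centres. *)
Lemma measurable_vector (p : nat) (V : S -> 'rV[R]_p) :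
  (forall k, measurable_fun [set: S] (fun s => V s ord0 k)) ->
  measurable_fun [set: S] (V : S -> borelType R p).
Proof.
move=> mV; apply: (@measurability _ _ S (borelType R p) setT _
  [set A : set 'rV[R]_p | open A]) => //.
move=> _ [U oU <-]; rewrite setTI.
pose box (c : 'rV[rat]_p * nat) : set 'rV[R]_p :=
  [set v | forall k, `|v ord0 k - ratr (c.1 ord0 k)| < c.2.+1%:R^-1].
pose F (c : 'rV[rat]_p * nat) : set S :=
  if pselect (box c `<=` U) then V @^-1` box c else set0.
have -> : V @^-1` U = \bigcup_c F c.
  apply/seteqP; split => [s Us|s [c _]]; last first.
    by rewrite /F; case: pselect => // cU /cU.
  have := open_nbhs_nbhs (conj oU Us : open_nbhs (V s) U).
  move=> /nbhs_ballP[e /= e0 eU].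
  pose N := Num.trunc (2 / e).
  have Ne : N.+1%:R^-1 < e / 2.
    rewrite -[e / 2]invrK ltf_pV2 ?posrE ?invr_gt0 ?divr_gt0// invf_div.
    exact: truncnS_gt.
  have /choice[c hc] : forall k : 'I_p, exists c : rat, `|V s ord0 k - ratr c| < N.+1%:R^-1.
    move=> k; have N0 : 0 < N.+1%:R^-1 :> R by rewrite invr_gt0 ltr0n.
    have h : V s ord0 k < V s ord0 k + N.+1%:R^-1 by rewrite ltrDl.
    have [c] := rat_in_itvoo h.
    rewrite in_itv/= => /andP[c1 c2]; exists c.
    rewrite distrC ltr_distl; move: c1 c2; set rc : R := ratr c => c1 c2.
    by rewrite c2 (lt_trans _ c1)// gtrBl.
  exists (\row_k c k, N) => //; rewrite /F; case: pselect => [_ k|]; first by rewrite mxE.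
  case=> v hv; apply: eU; split => // i k; rewrite ord1 /ball/=.
  have := hv k; have := hc k; rewrite /= mxE !ltr_distl .
  set a : R := ratr _; set b : R := v _ _; set b' : R := V s _ _.
  move: Ne; set iN : R := N.+1%:R^-1 => Ne.
  by move=> /andP[? ?] /andP[? ?]; apply/andP; split; lra.
apply: countable_bigcupT_measurable => [|c]; first exact: countableP.
rewrite /F; case: (pselect (box c `<=` U)) => [cU|cU] /=; last exact: measurable0.
have -> : V @^-1` box c = \bigcap_(k in [set: 'I_p])
    [set s | `|V s ord0 k - ratr (c.1 ord0 k)| < c.2.+1%:R^-1].
  by apply/seteqP; split => [s h k _|s h k]; [exact: h|exact: h].
apply: fin_bigcap_measurable; first exact: finite_finset.
move=> k _; have := mV k measurableT [set y : R | `|y - ratr (c.1 ord0 k)| < c.2.+1%:R^-1].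
rewrite setTI; apply; apply: open_measurable.
have -> : [set y : R | `|y - ratr (c.1 ord0 k)| < c.2.+1%:R^-1] =
   ball (ratr (c.1 ord0 k) : R) c.2.+1%:R^-1.
  by apply/seteqP; split => y; rewrite /ball/= distrC.
exact: ball_open.
Qed.

Lemma measurable_vector_coord (p : nat) (V : S -> 'rV[R]_p) (k : 'I_p) :
  measurable_fun [set: S] (V : S -> borelType R p) ->
  measurable_fun [set: S] (fun s => V s ord0 k).
Proof. by move=> mV; exact: (measurableT_comp (@measurable_coord R p k) mV). Qed.

Lemma measurable_vectorD (p : nat) (V V' : S -> 'rV[R]_p) :
  (forall k, measurable_fun [set: S] (fun s => V s ord0 k)) ->
  (forall k, measurable_fun [set: S] (fun s => V' s ord0 k)) ->
  forall k, measurable_fun [set: S] (fun s => (V s + V' s) ord0 k).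
Proof.
move=> mV mV' k; under eq_fun do rewrite mxE.
exact: measurable_funD (mV k) (mV' k).
Qed.

Lemma measurable_vectorZ (p : nat) (c : S -> R) (V : S -> 'rV[R]_p) :
  measurable_fun [set: S] c ->
  (forall k, measurable_fun [set: S] (fun s => V s ord0 k)) ->
  forall k, measurable_fun [set: S] (fun s => (c s *: V s) ord0 k).
Proof.
move=> mc mV k; under eq_fun do rewrite mxE.
exact: measurable_funM mc (mV k).
Qed.

Lemma measurable_inner (p : nat) (V V' : S -> 'rV[R]_p) :
  (forall k, measurable_fun [set: S] (fun s => V s ord0 k)) ->
  (forall k, measurable_fun [set: S] (fun s => V' s ord0 k)) ->
  measurable_fun [set: S] (fun s => inner (V s) (V' s)).
Proof.
move=> mV mV'; apply: measurable_sum => k.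
exact: measurable_funM (mV k) (mV' k).
Qed.

(** Projections are nonexpansive, hence continuous. *)
Lemma measurable_proj (p : nat) (K : set 'rV[R]_p) (V : S -> 'rV[R]_p) :
  compact K -> convex_set (M := 'rV[R]_p) K -> K !=set0 ->
  (forall k, measurable_fun [set: S] (fun s => V s ord0 k)) ->
  forall k, measurable_fun [set: S] (fun s => Defs.proj K (V s) ord0 k).
Proof.
move=> cK vK K0 mV k.
have cP : continuous (fun v : 'rV[R]_p => Defs.proj K v ord0 k).
  move=> v; have Fv : Filter (nbhs v) := nbhs_filter v.
  refine (proj2 (@cvgrPdist_lt R R^o _ (nbhs v) Fv
    (fun v => Defs.proj K v ord0 k) (Defs.proj K v ord0 k)) _) => e e0.
  have := proj1 (@cvgrPdist_lt R R^o _ (nbhs v) Fv _ _) (@continuous_enorm R p v v) e e0.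
  rewrite subrr enorm0; apply: filterS => w.
  rewrite sub0r normrN ger0_norm ?enorm_ge0// => we.
  have := nearest_nonexpansive vK (proj_nearest v cK K0) (proj_nearest w cK K0).
  rewrite (enormC v) => h.
  have := coord_le_enorm (Defs.proj K v - Defs.proj K w) k; rewrite !mxE => h'.
  exact: le_lt_trans h' (le_lt_trans h we).
exact: (measurableT_comp (continuous_borel cP) (measurable_vector mV)).
Qed.

(** The pairing of [H] and [V] pulls the generating coordinates of [past_sigma]
    back to measurable sets, hence the whole sigma-algebra. *)
Lemma adapted_measurable (n : nat) (p : 'I_n -> nat)
    (X : forall i : 'I_n, set 'rV[R]_(p i)) (f : strategy R p R) (t : nat) (i : 'I_n)
    (H : S -> path_of R p) (V : S -> 'rV[R]_(p i)) :
  adapted X f -> (1 <= t)%N ->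
  (forall s, past_in X t (H s)) -> (forall s, X i (V s)) ->
  (forall s j k, (1 <= s < t)%N -> measurable_fun [set: S] (fun w => H w s j ord0 k)) ->
  (forall k, measurable_fun [set: S] (fun w => V w ord0 k)) ->
  measurable_fun [set: S] (fun w => f i t (H w) (V w)).
Proof.
move=> af t1 pH XV mH mV _ C mC; rewrite setTI.
pose A : set (path_of R p * 'rV[R]_(p i)) := [set hv | [/\ past_in X t hv.1, X i hv.2 & C (f i t hv.1 hv.2)]].
have -> : (fun w => f i t (H w) (V w)) @^-1` C = (fun w => (H w, V w)) @^-1` A.
  apply/seteqP; split => [w Cw|w []//].
  by split; [exact: pH|exact: XV|exact: Cw].
have : past_sigma t A by exact: af.
rewrite /past_sigma; set G := (X in <<s X >>) => GA.
pose M : set (set (path_of R p * 'rV[R]_(p i))) :=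
  [set B | measurable ((fun w => (H w, V w)) @^-1` B)].
suff : <<s G >> `<=` M by apply.
apply: smallest_sub.
  split.
  - by rewrite /M/= preimage_set0; exact: measurable0.
  - move=> B mB; rewrite /M/= setTD preimage_setC; exact: measurableC.
  - move=> F mF; rewrite /M/= preimage_bigcup.
    by apply: bigcup_measurable => k _; exact: mF.
move=> B [[s [j [k [D [st mD ->]]]]]|[k [D [mD ->]]]].
  rewrite /M/=; have := mH s j k st measurableT D mD; by rewrite setTI.
by rewrite /M/=; have := mV k measurableT D mD; rewrite setTI.
Qed.
End random_vectors.

(** * Expectations of bounded random variables *)

Section bounded_expectation.
Context (d : measure_display) (S : measurableType d) (R : realType).
Context (P : probability S R).

Definition bounded_rv (F : S -> R) : Prop :=
  measurable_fun [set: S] F /\ exists M, forall s, `|F s| <= M.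

Lemma bounded_rv_integrable F : bounded_rv F -> P.-integrable [set: S] (EFin \o F).
Proof.
move=> [mF [M FM]]; apply: measurable_bounded_integrable => //.
  by apply: le_lt_trans (probability_le1 P _) (ltry 1).
exists M; split; first exact: num_real.
by move=> M' MM' s _ /=; apply: le_trans (FM s) (ltW MM').
Qed.

Lemma bounded_rv_cst c : bounded_rv (fun=> c).
Proof. by split; [exact: measurable_cst|exists `|c|]. Qed.

Lemma bounded_rvD F G : bounded_rv F -> bounded_rv G -> bounded_rv (fun s => F s + G s).
Proof.
move=> [mF [M FM]] [mG [N GN]]; split; first exact: measurable_funD.
by exists (M + N) => s; rewrite (le_trans (ler_normD _ _))// lerD.
Qed.

Lemma bounded_rvM F G : bounded_rv F -> bounded_rv G -> bounded_rv (fun s => F s * G s).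
Proof.
move=> [mF [M FM]] [mG [N GN]]; split; first exact: measurable_funM.
by exists (M * N) => s; rewrite normrM ler_pM.
Qed.

Lemma bounded_rvZ c F : bounded_rv F -> bounded_rv (fun s => c * F s).
Proof. by move=> bF; apply: bounded_rvM => //; exact: bounded_rv_cst. Qed.

Lemma bounded_rvN F : bounded_rv F -> bounded_rv (fun s => - F s).
Proof.
move=> /(bounded_rvZ (-1)) bF; rewrite (_ : (fun s => - F s) = (fun s => -1 * F s))//.
by apply/funext => s; rewrite mulN1r.
Qed.

Lemma bounded_rvB F G : bounded_rv F -> bounded_rv G -> bounded_rv (fun s => F s - G s).
Proof. by move=> bF bG; apply: bounded_rvD => //; exact: bounded_rvN. Qed.

Lemma bounded_rv_sum (I : Type) (s : seq I) (F : I -> S -> R) :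
  (forall i, bounded_rv (F i)) -> bounded_rv (fun w => \sum_(i <- s) F i w).
Proof.
move=> bF; elim: s => [|i s IH].
  under eq_fun do rewrite big_nil; exact: bounded_rv_cst.
under eq_fun do rewrite big_cons; exact: bounded_rvD.
Qed.

Lemma bounded_rv_sum_nat (a b : nat) (F : nat -> S -> R) :
  (forall t, (a <= t < b)%N -> bounded_rv (F t)) ->
  bounded_rv (fun w => \sum_(a <= t < b) F t w).
Proof.
move=> bF; under eq_fun do rewrite big_nat_cond big_mkcond.
apply: bounded_rv_sum => t; case h : (a <= t < b)%N => /=; first exact: bF.
exact: bounded_rv_cst.
Qed.

Local Notation Ex F := (\int[P]_w F w).

Lemma Ex_cst c : Ex (fun=> c) = c.
Proof.
have h : P [set: S] = 1%E := probability_setT P.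
transitivity (c * fine (P [set: S])); first exact: Rintegral_cst.
by rewrite h mulr1.
Qed.

Lemma ExD F G : bounded_rv F -> bounded_rv G ->
  Ex (fun s => F s + G s) = Ex F + Ex G.
Proof. by move=> bF bG; rewrite RintegralD//; exact: bounded_rv_integrable. Qed.

Lemma ExZ c F : bounded_rv F -> Ex (fun s => c * F s) = c * Ex F.
Proof. by move=> bF; rewrite RintegralZl//; exact: bounded_rv_integrable. Qed.

Lemma Ex_sum (I : Type) (s : seq I) (F : I -> S -> R) :
  (forall i, bounded_rv (F i)) ->
  Ex (fun w => \sum_(i <- s) F i w) = \sum_(i <- s) Ex (F i).
Proof.
move=> bF; elim: s => [|i s IH].
  under eq_Rintegral do rewrite big_nil.
  by rewrite Ex_cst big_nil.
under eq_Rintegral do rewrite big_cons.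
by rewrite big_cons ExD//; [rewrite IH|exact: bounded_rv_sum].
Qed.

Lemma Ex_le F G : bounded_rv F -> bounded_rv G -> (forall s, F s <= G s) -> Ex F <= Ex G.
Proof.
by move=> bF bG FG; apply: le_Rintegral => //; exact: bounded_rv_integrable.
Qed.

Lemma expectation_Ex F : bounded_rv F -> ('E_P[F] = (Ex F)%:E)%E.
Proof.
move=> bF; rewrite unlock /Rintegral fineK//.
by apply: integrable_fin_num => //; exact: bounded_rv_integrable.
Qed.

(** Truncation at [K] changes [F] on a null set only. *)
Lemma Ex_le_ae F (K : R) : bounded_rv F -> {ae P, forall s, F s <= K} ->
  Ex F <= K.
Proof.
move=> bF FK; have [mF [M FM]] := bF.
have mG : measurable_fun [set: S] (fun s => Num.min (F s) K).
  exact: (measurable_minr mF (@measurable_cst _ _ _ _ _ K)).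
have bG : bounded_rv (fun s => Num.min (F s) K).
  split=> //; exists (M + `|K|) => s; rewrite minEle; case: ifP => _.
    by apply: (le_trans (FM s)); rewrite lerDl.
  by rewrite lerDr (le_trans _ (FM s)).
have -> : Ex F = Ex (fun s => Num.min (F s) K).
  rewrite /Rintegral; congr fine; apply: ae_eq_integral => //.
  - exact/measurable_EFinP.
  - exact/measurable_EFinP.
  by apply: filterS FK => s /= Fs _; rewrite min_l.
rewrite -[leRHS]Ex_cst; apply: Ex_le => // [|s]; first exact: bounded_rv_cst.
by rewrite ge_min lexx orbT.
Qed.

Lemma ae_inhabited (Q : S -> Prop) : {ae P, forall s, Q s} -> exists s, Q s.
Proof.
move=> aeQ; apply: contrapT => nQ.
have : {ae P, forall s : S, 1 <= 0 :> R}.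
  by apply: filterS aeQ => s Qs; case: nQ; exists s.
by move=> /(Ex_le_ae (bounded_rv_cst 1)); rewrite Ex_cst ler10.
Qed.

Lemma bounded_rv_enorm (p : nat) (V : S -> 'rV[R]_p) :
  (forall k, bounded_rv (fun s => V s ord0 k)) -> bounded_rv (fun s => enorm (V s)).
Proof.
move=> bV; have [_ [M sM]] : bounded_rv (fun s => enorm (V s) ^+ 2).
  under eq_fun do rewrite enorm_sqr; apply: bounded_rv_sum => k.
  exact: bounded_rvM.
split; last first.
  exists (M + 1) => s; have := sM s; rewrite !ger0_norm ?sqr_ge0 ?enorm_ge0//.
  have := sqr_ge0 (enorm (V s) - 1); nra.
apply: (measurableT_comp (@measurable_enorm R p)); apply: measurable_vector => k.
by have [] := bV k.
Qed.

End bounded_expectation.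

(** * The uniform distribution on the sphere *)

(** Values off the unit ball are irrelevant for a vector on the sphere; replacing
    them makes [z + delta *: clamp v] admissible for every [v]. *)
Definition clamp (R : realType) (p : nat) (v : 'rV[R]_p) : 'rV[R]_p :=
  if enorm v <= 1 then v else 0.

Lemma clamp_le1 (R : realType) (p : nat) (v : 'rV[R]_p) : enorm (clamp v) <= 1.
Proof. by rewrite /clamp; case: ifP => // _; rewrite enorm0. Qed.

Lemma clampE (R : realType) (p : nat) (v : 'rV[R]_p) : enorm v = 1 -> clamp v = v.
Proof. by rewrite /clamp => ->; rewrite lexx. Qed.

Lemma measurable_clamp (R : realType) (p : nat) (k : 'I_p) :
  measurable_fun [set: borelType R p] (fun v : borelType R p => clamp v ord0 k).
Proof.
have -> : (fun v : borelType R p => clamp v ord0 k) =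
    (fun v : borelType R p => if enorm v <= 1 then v ord0 k else 0).
  by apply/funext => v; rewrite /clamp; case: ifP => // _; rewrite mxE.
apply: measurable_fun_ifT; [|exact: measurable_coord|exact: measurable_cst].
apply: measurable_fun_ler; last exact: measurable_cst.
exact: measurable_enorm.
Qed.

Section sphere.
Context (d : measure_display) (Omega : measurableType d) (R : realType).
Context (P : probability Omega R) (p : nat) (u : Omega -> 'rV[R]_p).
Hypotheses (p0 : (0 < p)%N) (hu : uniform_on_sphere P u).

Local Notation Ex F := (\int[P]_w F w).

Lemma sphere_unit w : enorm (u w) = 1.
Proof. by have [_ h _] := hu; exact: h. Qed.

Lemma sphere_measurable : measurable_fun [set: Omega] (u : Omega -> borelType R p).
Proof. by have [h _ _] := hu => _ A mA; rewrite setTI; exact: h. Qed.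

Lemma sphere_coord k : measurable_fun [set: Omega] (fun w => u w ord0 k).
Proof. exact: measurable_vector_coord sphere_measurable. Qed.

Lemma sphere_bounded (F : 'rV[R]_p -> R) (M : R) :
  measurable_fun [set: borelType R p] (F : borelType R p -> R) ->
  (forall v, enorm v = 1 -> `|F v| <= M) -> bounded_rv (fun w => F (u w)).
Proof.
move=> mF FM; split; first exact: (measurableT_comp mF sphere_measurable).
by exists M => w; apply: FM; exact: sphere_unit.
Qed.

Lemma mul_measurable (Q : 'M[R]_p) :
  measurable_fun [set: Omega] ((fun w => u w *m Q) : Omega -> borelType R p).
Proof.
apply: measurable_vector => k; under eq_fun do rewrite mxE.
apply: measurable_sum => l; apply: measurable_funM; [exact: sphere_coord|exact: measurable_cst].
Qed.

Lemma sphere_invariance (Q : 'M[R]_p) (F : 'rV[R]_p -> R) (M : R) :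
  Q *m Q^T = 1%:M ->
  measurable_fun [set: borelType R p] (F : borelType R p -> R) ->
  (forall v, enorm v = 1 -> `|F v| <= M) ->
  Ex (fun w => F (u w *m Q)) = Ex (fun w => F (u w)).
Proof.
move=> QQ mF FM; rewrite /Rintegral; congr fine.
pose X1 : {mfun Omega >-> borelType R p} := mfun_Sub (mem_set sphere_measurable).
pose X2 : {mfun Omega >-> borelType R p} := mfun_Sub (mem_set (mul_measurable Q)).
have mEF : measurable_fun [set: borelType R p] (EFin \o (F : borelType R p -> R)).
  exact/measurable_EFinP.
have b1 : P.-integrable [set: Omega] ((EFin \o F) \o X1).
  apply: (@bounded_rv_integrable _ _ _ P (fun w => F (u w))).
  exact: sphere_bounded mF FM.
have b2 : P.-integrable [set: Omega] ((EFin \o F) \o X2).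
  apply: (@bounded_rv_integrable _ _ _ P (fun w => F (u w *m Q))); split.
    exact: (measurableT_comp mF (mul_measurable Q)).
  by exists M => w; apply: FM; rewrite enorm_orthogonal// sphere_unit.
have e1 := @integral_distribution _ _ _ _ _ P X1 _ mEF b1.
have e2 := @integral_distribution _ _ _ _ _ P X2 _ mEF b2.
transitivity (\int[distribution P X2]_y (EFin \o F) y)%E; first exact: esym e2.
transitivity (\int[distribution P X1]_y (EFin \o F) y)%E; last exact: e1.
apply: eq_measure_integral => A mA _.
by have [_ _ h] := hu; exact: h.
Qed.

(** The antipodal map is orthogonal. *)
Lemma sphere_odd (F : 'rV[R]_p -> R) (M : R) :
  measurable_fun [set: borelType R p] (F : borelType R p -> R) ->
  (forall v, enorm v = 1 -> `|F v| <= M) -> (forall v, F (- v) = - F v) ->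
  Ex (fun w => F (u w)) = 0.
Proof.
move=> mF FM Fodd; have := @sphere_invariance (- 1%:M) F M _ mF FM.
rewrite linearN/= trmx1 mulNmx mul1mx opprK => /(_ erefl).
under eq_Rintegral do rewrite mulmxN mulmx1 Fodd -mulN1r.
rewrite ExZ; last exact: (sphere_bounded mF FM).
lra.
Qed.

Lemma measurable_inner_cst (h : 'rV[R]_p) :
  measurable_fun [set: borelType R p] (fun v : borelType R p => inner v h).
Proof.
apply: measurable_inner => k; [exact: measurable_coord|exact: measurable_cst].
Qed.

Lemma measurable_sqr_inner (h : 'rV[R]_p) :
  measurable_fun [set: borelType R p] (fun v : borelType R p => inner v h ^+ 2).
Proof. exact: measurable_funX (measurable_inner_cst h). Qed.

Lemma sqr_inner_bound (h v : 'rV[R]_p) : enorm v = 1 -> `|inner v h ^+ 2| <= enorm h ^+ 2.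
Proof.
move=> v1; rewrite normrX lerXn2r ?nnegrE ?enorm_ge0//.
by have := cauchy_schwarz_abs v h; rewrite v1 mul1r.
Qed.

(** All unit vectors give the same second moment, since reflections exchange
    them; the moments of the coordinates sum to one. *)
Lemma sphere_second_moment (e : 'rV[R]_p) : enorm e = 1 ->
  Ex (fun w => inner (u w) e ^+ 2) = p%:R^-1.
Proof.
move=> e1.
have same (a b : 'rV[R]_p) : enorm a = 1 -> enorm b = 1 ->
    Ex (fun w => inner (u w) a ^+ 2) = Ex (fun w => inner (u w) b ^+ 2).
  move=> a1 b1; have [->//|ab] := eqVneq a b.
  pose h := a - b.
  have := @sphere_invariance (reflection h) (fun v => inner v a ^+ 2) _
    (reflection_orthogonal h) (measurable_sqr_inner a) (@sqr_inner_bound a).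
  move=> <-; apply: eq_Rintegral => w _; congr (_ ^+ 2).
  have hh : inner h h != 0 by rewrite -enorm_sqr expf_neq0// enorm_eq0 subr_eq0.
  have ha : 2 * inner h a = inner h h.
    have := enormB_sqr a b; rewrite a1 b1 -/h enorm_sqr => ->.
    by rewrite /h innerBl -enorm_sqr a1 (innerC b); ring.
  rewrite mul_reflection innerBl innerZl.
  have -> : 2 * inner (u w) h / inner h h * inner h a = inner (u w) h.
    by rewrite -ha; field; move: hh; rewrite -ha mulf_eq0 negb_or => /andP[].
  by rewrite /h innerBr; ring.
pose ek (k : 'I_p) : 'rV[R]_p := delta_mx ord0 k.
have uk v k : inner v (ek k) = v ord0 k.
  rewrite /inner (bigD1 k)//= mxE !eqxx mulr1 big1 ?addr0// => j jk.
  by rewrite mxE (negbTE jk) andbF mulr0.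
have ek1 k : enorm (ek k) = 1.
  by rewrite enormE uk mxE !eqxx sqrtr1.
have bk k : bounded_rv (fun w => inner (u w) (ek k) ^+ 2).
  exact: (sphere_bounded (measurable_sqr_inner (ek k)) (@sqr_inner_bound (ek k))).
have h : Ex (fun w => \sum_(k < p) inner (u w) (ek k) ^+ 2) = 1.
  rewrite -[RHS](Ex_cst P 1); apply: eq_Rintegral => w _.
  under eq_bigr do rewrite uk expr2.
  by rewrite -[LHS]enorm_sqr sphere_unit expr1n.
rewrite Ex_sum// in h.
rewrite (eq_bigr (fun=> Ex (fun w => inner (u w) e ^+ 2))) in h; last first.
  by move=> k _; exact: same.
rewrite sumr_const card_ord -mulr_natl in h.
have pn0 : p%:R != 0 :> R by rewrite pnatr_eq0 -lt0n.
by rewrite -[LHS](mulKf pn0) h mulr1.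
Qed.

Lemma sphere_second_moment_normalized (h : 'rV[R]_p) : h != 0 ->
  Ex (fun w => inner (u w) h ^+ 2 / inner h h) = p%:R^-1.
Proof.
move=> h0; have L0 : enorm h != 0 by rewrite enorm_eq0.
rewrite -(@sphere_second_moment ((enorm h)^-1 *: h)).
  apply: eq_Rintegral => w _; rewrite innerZr -enorm_sqr; field; exact: L0.
by rewrite enormZ ger0_norm ?invr_ge0 ?enorm_ge0// mulVf.
Qed.

(** In expectation the one-point estimate acts as a subgradient of [f] at [z], up
    to the smoothing error.  This is the average of [one_point_pairing]: the two
    terms on the right have the same expectation, the second moment is [1 / p]
    and the odd term averages to zero. *)
Lemma one_point_expectation (X : set 'rV[R]_p) (G M : R) (f : 'rV[R]_p -> R)
    (z y : 'rV[R]_p) (delta : R) :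
  convex_set (M := 'rV[R]_p) X -> subdifferentiable X G f ->
  0 <= G -> 0 < delta ->
  (forall v, enorm v <= 1 -> X (z + delta *: v)) ->
  (forall v, enorm v <= 1 -> X (y + delta *: v)) ->
  (forall v, X v -> `|f v| <= M) ->
  measurable_fun [set: borelType R p]
    (fun v : borelType R p => f (z + delta *: clamp v)) ->
  f z - f y - G * delta <=
    Ex (fun w => p%:R / delta * f (z + delta *: clamp (u w)) * inner (u w) (z - y)).
Proof.
move=> cX sf G0 d0 Xz Xy fM mf.
have pn0 : p%:R != 0 :> R by rewrite pnatr_eq0 -lt0n.
have [->|zy] := eqVneq z y.
  under eq_Rintegral do rewrite subrr inner0r mulr0.
  by rewrite Ex_cst subrr sub0r oppr_le0 mulr_ge0// ltW.
have [g hg] := one_point_pairing cX sf G0 d0 zy Xz Xy.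
set h := z - y in hg *.
have h0 : h != 0 by rewrite subr_eq0.
pose F (v : 'rV[R]_p) := inner v h * f (z + delta *: clamp v).
have mF : measurable_fun [set: borelType R p] (F : borelType R p -> R).
  exact: measurable_funM (measurable_inner_cst h) mf.
have FM v : enorm v = 1 -> `|F v| <= enorm h * M.
  move=> v1; rewrite normrM ler_pM//.
    by have := cauchy_schwarz_abs v h; rewrite v1 mul1r.
  by apply: fM; apply: Xz; exact: clamp_le1.
pose S (v : 'rV[R]_p) := inner v h ^+ 2 / inner h h.
pose O (v : 'rV[R]_p) := S v * inner g (v - (inner v h / inner h h) *: h).
have mS : measurable_fun [set: borelType R p] (S : borelType R p -> R).
  by apply: measurable_funM; [exact: measurable_sqr_inner|exact: measurable_cst].
have SM v : enorm v = 1 -> `|S v| <= enorm h ^+ 2 / inner h h.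
  move=> v1; rewrite normrM (ger0_norm (_ : 0 <= (inner h h)^-1)) ?invr_ge0 ?inner_ge0//.
  by rewrite ler_wpM2r ?invr_ge0 ?inner_ge0// sqr_inner_bound.
pose O2 (v : 'rV[R]_p) := inner v g - inner v h / inner h h * inner h g.
have O2E v : inner g (v - (inner v h / inner h h) *: h) = O2 v.
  by rewrite innerC innerBl innerZl.
have mO : measurable_fun [set: borelType R p] (O : borelType R p -> R).
  have -> : O = fun v => S v * O2 v by apply/funext => v; rewrite /O O2E.
  apply: measurable_funM => //; apply: measurable_funB; first exact: measurable_inner_cst.
  apply: measurable_funM; last exact: measurable_cst.
  by apply: measurable_funM; [exact: measurable_inner_cst|exact: measurable_cst].
have innerb v k : enorm v = 1 -> `|inner v k| <= enorm k.
  by move=> v1; have := cauchy_schwarz_abs v k; rewrite v1 mul1r.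
have OM v : enorm v = 1 -> `|O v| <= enorm h ^+ 2 / inner h h *
    (enorm g + enorm h / inner h h * `|inner h g|).
  move=> v1; rewrite normrM O2E ler_pM//; first exact: SM.
  rewrite (le_trans (ler_normB _ _))// lerD ?innerb//.
  rewrite normrM ler_wpM2r// normrM (ger0_norm (_ : 0 <= (inner h h)^-1)) ?invr_ge0 ?inner_ge0//.
  by rewrite ler_wpM2r ?invr_ge0 ?inner_ge0// innerb.
have Oodd v : O (- v) = - O v.
  rewrite /O /S !O2E /O2 !innerNl; ring.
have EO := sphere_odd mO OM Oodd.
have ES := sphere_second_moment_normalized h0.
have bF := sphere_bounded mF FM; have bO := sphere_bounded mO OM.
have bS := sphere_bounded mS SM.
have EQ := sphere_invariance (reflection_orthogonal h) mF FM.
have bFQ : bounded_rv (fun w => F (u w *m reflection h)).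
  split; first exact: (measurableT_comp mF (mul_measurable _)).
  exists (enorm h * M) => w; apply: FM.
  by rewrite enorm_orthogonal ?sphere_unit//; exact: reflection_orthogonal.
set K := f z - f y - G * delta.
have le : Ex (fun w => 2 * delta * K * S (u w) + 2 * delta ^+ 2 * O (u w)) <=
    Ex (fun w => F (u w) + F (u w *m reflection h)).
  apply: Ex_le => [||w].
  - by apply: bounded_rvD; exact: bounded_rvZ.
  - exact: bounded_rvD.
  have := hg (u w) (sphere_unit w); rewrite /F !clampE ?sphere_unit//.
  by rewrite enorm_orthogonal ?sphere_unit//; exact: reflection_orthogonal.
rewrite !ExD ?ExZ ?EQ ?EO// in le; try exact: bounded_rvZ.
rewrite ES in le.
have -> : Ex (fun w => p%:R / delta * f (z + delta *: clamp (u w)) * inner (u w) h) =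
    p%:R / delta * Ex (fun w => F (u w)).
  by rewrite -ExZ//; apply: eq_Rintegral => w _; rewrite /F; ring.
have pd : 0 < p%:R / delta by rewrite divr_gt0// ltr0n.
have := ler_wpM2l (ltW pd) le.
have -> : p%:R / delta * (2 * delta * K * p%:R^-1 + 2 * delta ^+ 2 * 0) = 2 * K.
  by field; rewrite pn0 gt_eqF.
lra.
Qed.
End sphere.

(** * Freezing the past *)

Section freezing.
Context (d : measure_display) (Omega : measurableType d) (R : realType).
Context (P : probability Omega R) (p : nat) (u : Omega -> 'rV[R]_p).
Context (G : set (set Omega)).
Hypothesis mu : measurable_fun [set: Omega] (u : Omega -> borelType R p).
Hypotheses (mG : G `<=` measurable) (GI : setI_closed G) (GT : G setT).
Hypothesis indep : forall A (B : set (borelType R p)), G A -> measurable B ->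
  P (A `&` u @^-1` B) = (P A * P (u @^-1` B))%E.

Let past := g_sigma_algebraType G.

Lemma past_measurable : measurable_fun [set: Omega] (id : Omega -> past).
Proof.
move=> _ A mA; rewrite setTI preimage_id.
have : <<s G >> `<=` measurable by apply: smallest_sub => //; exact: sigma_algebra_measurable.
exact.
Qed.

(** Independence extends from the pi-system [G] to the sigma-algebra it
    generates, by uniqueness of measures. *)
Lemma generated_independence (A : set past) (B : set (borelType R p)) :
  measurable A -> measurable B ->
  P (A `&` u @^-1` B) = (P A * P (u @^-1` B))%E.
Proof.
move=> mA mB; have muB : measurable (u @^-1` B).
  by have := mu measurableT mB; rewrite setTI.
pose m1 := mrestr P muB.
have PB : 0 <= fine (P (u @^-1` B)) by apply: fine_ge0; exact: measure_ge0.
pose m2 := mscale (NngNum PB) P.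
have := @g_sigma_algebra_measure_unique _ _ _ G mG (fun=> setT) (fun=> GT) _ m1 m2 GI _ _ A mA.
have PBE : ((fine (P (u @^-1` B)))%:E = P (u @^-1` B))%E.
  by rewrite fineK// fin_num_measure.
have m1E Y : m1 Y = P (Y `&` u @^-1` B) by [].
have m2E Y : m2 Y = (P (u @^-1` B) * P Y)%E by rewrite -[in RHS]PBE.
move=> h; rewrite muleC -m1E -m2E; apply: h.
- by rewrite bigcup_const.
- move=> A' GA'; apply: (etrans (m1E A')); rewrite indep// muleC.
  exact/esym/m2E.
- move=> _; have : (P (setT `&` u @^-1` B) < +oo)%E; last exact.
  by rewrite setTI; exact: le_lt_trans (probability_le1 P muB) (ltry 1).
Qed.

(** [u] is independent of the past, so its law may be integrated first with the
    past frozen. *)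
Lemma freeze_ge0 (F : past * borelType R p -> R) (M : R) :
  measurable_fun [set: past * borelType R p] F -> (forall w v, `|F (w, v)| <= M) ->
  (forall w, 0 <= \int[P]_w' F (w, u w')) -> 0 <= \int[P]_w F (w, u w).
Proof.
move=> mF FM hF.
have mpair : measurable_fun [set: Omega] ((fun w => (w, u w)) : Omega -> past * borelType R p).
  exact: measurable_fun_pair past_measurable mu.
pose X1 : {mfun Omega >-> past} := mfun_Sub (mem_set past_measurable).
pose X2 : {mfun Omega >-> borelType R p} := mfun_Sub (mem_set mu).
pose XJ : {mfun Omega >-> (past * borelType R p)%type} := mfun_Sub (mem_set mpair).
have mEF : measurable_fun [set: past * borelType R p] (EFin \o F).
  exact/measurable_EFinP.
have bJ : P.-integrable [set: Omega] ((EFin \o F) \o XJ).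
  apply: (@bounded_rv_integrable _ _ _ P (fun w => F (w, u w))); split.
    exact: (measurableT_comp mF mpair).
  by exists M.
have prodE : forall X : set (past * borelType R p), measurable X ->
    (distribution P X1 \x distribution P X2)%E X = distribution P XJ X.
  apply: product_measure_unique => A B mA mB.
  rewrite -[LHS]/(P (A `&` u @^-1` B)); exact: generated_independence.
have intF : (distribution P X1 \x distribution P X2)%E.-integrable
    [set: past * borelType R p] (EFin \o F).
  apply: measurable_bounded_integrable => //.
    rewrite [X in (X < _)%E](prodE setT measurableT).
    exact: le_lt_trans (probability_le1 _ measurableT) (ltry 1).
  exists M; split; first exact: num_real.
  by move=> M' MM' [w v] _ /=; apply: le_trans (FM w v) (ltW MM').
have e1 : (\int[P]_w (F (w, u w))%:E =
    \int[distribution P X1]_w \int[distribution P X2]_v (F (w, v))%:E)%E.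
  rewrite -[LHS](@integral_distribution _ _ _ _ _ P XJ _ mEF bJ).
  rewrite (integral12_prod_meas1 intF).
  apply: eq_measure_integral => A mA _; exact/esym/prodE.
rewrite /Rintegral e1; apply: fine_ge0; apply: integral_ge0 => w _.
have bw : P.-integrable [set: Omega] ((EFin \o (fun v => F (w, v))) \o X2).
  apply: (@bounded_rv_integrable _ _ _ P (fun w' => F (w, u w'))); split; last by exists M.
  by apply: (measurableT_comp mF); exact: (measurableT_comp (pair1_measurable w) mu).
have mw : measurable_fun [set: borelType R p] (EFin \o (fun v => F (w, v))).
  by apply/measurable_EFinP; exact: (measurableT_comp mF (pair1_measurable w)).
rewrite (@integral_distribution _ _ _ _ _ P X2 _ mw bw).
have := hF w; rewrite /Rintegral.
have : (\int[P]_w' (F (w, u w'))%:E)%E \is a fin_num by exact: integrable_fin_num.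
by move=> h1 h2; rewrite -[leRHS](fineK h1) lee_fin.
Qed.
End freezing.

(** * The past of the random vectors *)

Section past_events.
Context (d : measure_display) (Omega : measurableType d) (R : realType).
Context (P : probability Omega R) (n : nat) (p : 'I_n -> nat).
Context (u : Omega -> path_of R p).
Hypothesis ru : forall i t, (1 <= t)%N -> random_vector (fun omega => u omega t i).

Definition history (t : nat) : seq ('I_n * nat) :=
  [seq (j, s) | j <- enum 'I_n, s <- iota 1 t.-1].

Lemma mem_history t k : (k \in history t) = (1 <= k.2 < t)%N.
Proof.
apply/allpairsP/idP => [[[j s] [_]]|].
  by rewrite mem_iota /= => st ->/=; case: t st => //=; lia.
case: k => j s /= st; exists (j, s); split => //; first by rewrite mem_enum.
by rewrite /= mem_iota; case: t st => //=; lia.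
Qed.

Lemma uniq_history t : uniq (history t).
Proof.
apply: allpairs_uniq; [exact: enum_uniq|exact: iota_uniq|].
by move=> [j s] [j' s'] _ _ [-> ->].
Qed.

(** Boxes in the vectors drawn before round [t]: a pi-system that generates the
    sigma-algebra of the past. *)
Definition past_events (t : nat) : set (set Omega) :=
  [set B | exists A : forall k : 'I_n * nat, set 'rV[R]_(p k.1),
     (forall k, borel (A k)) /\
     B = [set omega | forall k, k \in history t -> A k (u omega k.2 k.1)]].

Lemma borelT q : borel [set: 'rV[R]_q].
Proof. exact: (@measurableT _ (borelType R q)). Qed.

Lemma past_eventsT t : past_events t setT.
Proof.
exists (fun=> setT); split=> [k|]; first exact: borelT.
by apply/seteqP; split.
Qed.

Lemma past_eventsI t : setI_closed (past_events t).
Proof.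
move=> _ _ [A [bA ->]] [B [bB ->]]; exists (fun k => A k `&` B k); split=> [k|].
  exact: (@measurableI _ (borelType R (p k.1)) _ _ (bA k) (bB k)).
apply/seteqP; split=> omega.
  by move=> [hA hB] k kt; split; [exact: hA|exact: hB].
by move=> h; split=> k kt; have [] := h k kt.
Qed.

Lemma past_events_measurable t : past_events t `<=` measurable.
Proof.
move=> _ [A [bA ->]].
have -> : [set omega | forall k, k \in history t -> A k (u omega k.2 k.1)] =
    \bigcap_(k in [set` history t]) ((fun omega => u omega k.2 k.1) @^-1` A k).
  by apply/seteqP; split => omega h k; exact: h.
apply: fin_bigcap_measurable; first exact: finite_seq.
by move=> k /=; rewrite mem_history => /andP[k1 _]; exact: ru.
Qed.

Hypothesis hindep : independent_vectors P u.

(** The boxes of the past and [B] together concern a finite family of distinct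
    vectors, to which the product rule applies; so does its part in the past. *)
Lemma past_events_independent t i A (B : set (borelType R (p i))) : (1 <= t)%N ->
  past_events t A -> measurable B ->
  P (A `&` (fun omega => u omega t i) @^-1` B) =
  (P A * P ((fun omega => u omega t i) @^-1` B))%E.
Proof.
move=> t1 [F [bF ->]] bB.
pose F' := @dfwith _ (fun k : 'I_n * nat => set 'rV[R]_(p k.1)) F (i, t) B.
have neq k : k \in history t -> (i, t) != k.
  by rewrite mem_history => kt; apply: contraTneq kt => <- /=; rewrite ltnn andbF.
have bF' k : borel (F' k).
  rewrite /F'; have [<-|ik] := eqVneq (i, t) k; first by rewrite dfwithin.
  by rewrite dfwithout.
have pos k : k \in history t -> (1 <= k.2)%N by rewrite mem_history => /andP[].
have e1 := hindep (uniq_history t) pos bF.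
have uS : uniq ((i, t) :: history t).
  by rewrite /= uniq_history mem_history /= ltnn andbF.
have pS k : k \in (i, t) :: history t -> (1 <= k.2)%N.
  by rewrite inE => /predU1P[->//|/pos].
have := hindep uS pS bF'; rewrite big_cons /=.
rewrite [X in (_ * X)%E](eq_big_seq (fun k => P [set omega | F k (u omega k.2 k.1)])); last first.
  by move=> k kt; rewrite /F' dfwithout ?neq.
have -> : [set omega | F' (i, t) (u omega t i)] = (fun omega => u omega t i) @^-1` B.
  by rewrite /F' dfwithin.
rewrite muleC -e1 => <-; congr (P _); apply/seteqP; split=> omega /=.
  move=> [hF hB] k; rewrite inE => /predU1P[->/=|kt]; first by rewrite /F' dfwithin.
  by rewrite /F' dfwithout ?neq//; exact: hF.
move=> h; split=> [k kt|].
  by have := h k; rewrite inE kt orbT /F' dfwithout ?neq//; exact.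
by have := h (i, t); rewrite inE eqxx /F' dfwithin; exact.
Qed.

Lemma past_coord t s j k : (1 <= s < t)%N ->
  measurable_fun [set: g_sigma_algebraType (past_events t)]
    (fun omega : g_sigma_algebraType (past_events t) => u omega s j ord0 k).
Proof.
move=> st; apply: (@measurable_vector_coord _ (g_sigma_algebraType (past_events t)) R (p j) (fun omega => u omega s j)).
move=> _ A mA; rewrite setTI; apply: sub_sigma_algebra.
exists (@dfwith _ (fun k : 'I_n * nat => set 'rV[R]_(p k.1)) (fun=> setT) (j, s) A); split.
  move=> l; have [<-|jl] := eqVneq (j, s) l; first by rewrite dfwithin.
  by rewrite dfwithout//; exact: borelT.
apply/seteqP; split=> omega /=.
  move=> h l _; have [<-|jl] := eqVneq (j, s) l; first by rewrite dfwithin.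
  by rewrite dfwithout.
by move=> /(_ (j, s)); rewrite mem_history dfwithin; exact.
Qed.
End past_events.

(** * The run as a random process *)

Section process.
Context (R : realType) (n m : nat) (p : 'I_n -> nat).
Context (X : forall i : 'I_n, set 'rV[R]_(p i)).
Context (f : strategy R p R) (g : strategy R p 'rV[R]_m).
Context (E : nat -> rel 'I_n) (W : nat -> 'M[R]_n) (w : R) (iota : nat).
Context (r Rad Ff Fg Gf Gg : 'I_n -> R) (theta1 theta2 theta3 : R).
Context (d : measure_display) (Omega : measurableType d) (P : probability Omega R).
Context (u : Omega -> path_of R p) (z1 : profile R p) (z x : Omega -> path_of R p).
Context (q : Omega -> nat -> 'I_n -> 'rV[R]_m).
Local Arguments X : clear implicits.
Local Arguments f : clear implicits.
Local Arguments g : clear implicits.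
Hypotheses (hn : (0 < n)%N) (hm : (0 < m)%N) (hp : forall i, (0 < p i)%N).
Hypotheses (hf : adapted X f) (hg : forall j : 'I_m, adapted X (component g j)).
Hypotheses (hW : mixing_matrix E W) (hA : assumption_A E W w iota).
Hypothesis hB : assumption_B X r Rad Ff Fg Gf Gg f g.
Hypotheses (htheta1 : 0 < theta1 < 1) (htheta2 : 0 < theta2 < theta1 / 3).
Hypothesis htheta3 : theta2 < theta3 <= (theta1 - theta2) / 2.
Hypothesis hunif : forall (i : 'I_n) (t : nat), (1 <= t)%N ->
  uniform_on_sphere P (fun omega => u omega t i).
Hypothesis hindep : independent_vectors P u.
Hypothesis hz1 : forall omega, z omega 1%N = z1.
Hypothesis halg : forall omega, algorithm1 X W
     (fun i t => r i ^+ 2 /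
        (4 * m%:R * (p i)%:R ^+ 2 * Fg i ^+ 2 * t%:R `^ theta1))
     (fun i t => 2 / t%:R `^ theta2)
     (fun i t => 1 / t%:R `^ (1 - theta2))
     (fun i t => 1 / (t + 1)%:R `^ theta3)
     (fun i t => r i / (t + 1)%:R `^ theta3)
     f g (u omega) (z omega) (x omega) (q omega).
Local Notation FG := (max_over Fg).
Local Notation xi t := (1 / (t + 1)%:R `^ theta3).
Local Notation delta i t := (r i / (t + 1)%:R `^ theta3).

Lemma u_unit omega t i : (1 <= t)%N -> enorm (u omega t i) = 1.
Proof. by move=> t1; exact: (sphere_unit (hunif i t1)). Qed.

Let hu omega t i := @u_unit omega t i.
Let ru i t (t1 : (1 <= t)%N) : random_vector (fun omega => u omega t i).
Proof. by have [] := hunif i t1. Qed.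

Section sub_sigma_algebra.
Context (d' : measure_display) (S : measurableType d') (io : S -> Omega).

Lemma lagrangian_measurable t i (V : S -> 'rV[R]_(p i)) : (1 <= t)%N ->
  (forall s j k, (1 <= s < t)%N ->
    measurable_fun [set: S] (fun omega => x (io omega) s j ord0 k)) ->
  (forall j k, measurable_fun [set: S] (fun omega => q (io omega) t j ord0 k)) ->
  (forall omega, X i (V omega)) ->
  (forall k, measurable_fun [set: S] (fun omega => V omega ord0 k)) ->
  measurable_fun [set: S]
    (fun omega => lagrangian f g W (x (io omega)) (q (io omega)) t (V omega)).
Proof.
move=> t1 mx mq XV mV.
have px omega : past_in X t (x (io omega)).
  exact: (past_x hB htheta2 htheta3 (@hu _) (halg _)).
apply: measurable_funD; first exact: (adapted_measurable hf t1 px XV mx mV).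
apply: measurable_sum => j; apply: measurable_funM; last first.
  exact: (adapted_measurable (hg j) t1 px XV mx mV).
under eq_fun do rewrite qmix_coord; apply: measurable_sum => k.
by apply: measurable_funM; [exact: measurable_cst|exact: mq].
Qed.

(** The iterates of round [s] are functions of the perturbations of the rounds
    before [s].  The map [io] lets the sample space carry the sigma-algebra of
    the past instead of its own. *)
Lemma trajectory_measurable (t : nat) :
  (forall s j k, (1 <= s < t)%N ->
    measurable_fun [set: S] (fun omega => u (io omega) s j ord0 k)) ->
  forall s, (1 <= s <= t)%N ->
  [/\ forall i k, measurable_fun [set: S] (fun omega => z (io omega) s i ord0 k),
      forall i k, measurable_fun [set: S] (fun omega => q (io omega) s i ord0 k) &
      forall s' j k, (1 <= s' < s)%N ->
        measurable_fun [set: S] (fun omega => x (io omega) s' j ord0 k)].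
Proof.
move=> mu; case=> // s; elim: s => [|s IH] st.
  split=> [i k|i k|s' j k]; last by lia.
    by under eq_fun do rewrite hz1; exact: measurable_cst.
  by under eq_fun do rewrite (q_one (halg _)); exact: measurable_cst.
have [|mz mq mx] := IH; first by lia.
have s1 : (1 <= s.+1)%N by [].
have mxs j k : measurable_fun [set: S] (fun omega => x (io omega) s.+1 j ord0 k).
  under eq_fun do rewrite (x_def (halg _))//.
  apply: measurable_vectorD => {}k; first exact: mz.
  by apply: measurable_vectorZ; [exact: measurable_cst|move=> l; apply: mu; lia].
have Xx i omega : X i (x (io omega) s.+1 i).
  exact: (x_in hB htheta2 htheta3 (@hu _) (halg _)).
have px omega : past_in X s.+1 (x (io omega)).
  exact: (past_x hB htheta2 htheta3 (@hu _) (halg _)).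
split=> [i k|i k|s' j k s's].
- pose K := scaled_set (1 - xi s.+2) (X i).
  have cK : convex_set (M := 'rV[R]_(p i)) K by exact/scaled_set_convex/(X_convex hB).
  under eq_fun => omega do rewrite -(proj_eq cK (z_step hB (halg (io omega)) i s1)).
  apply: (measurable_proj _ cK); first exact/scaled_set_compact/(X_compact hB).
    by exists ((1 - xi s.+2) *: 0), 0 => //; exact: (X_zero hB).
  move=> {}k; under eq_fun do rewrite -scaleN1r scalerA.
  apply: measurable_vectorD => {}k; first exact: mz.
  apply: measurable_vectorZ => [|{}k]; first exact: measurable_cst.
  apply: measurable_vectorZ => [|{}k]; last by apply: mu; lia.
  apply: measurable_funM; first exact: measurable_cst.
  exact: lagrangian_measurable.
- under eq_fun do rewrite (q_step (halg _))// pospartE mxE.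
  apply: measurable_maxr; first exact: measurable_cst.
  apply: measurable_vectorD => {}k.
    apply: measurable_vectorZ => [|{}k]; first exact: measurable_cst.
    under eq_fun do rewrite qmix_coord; apply: measurable_sum => l.
    by apply: measurable_funM; [exact: measurable_cst|exact: mq].
  apply: measurable_vectorZ => [|{}k]; first exact: measurable_cst.
  exact: (adapted_measurable (hg k) s1 px (Xx i) mx (mxs i)).
- by have [->|ne] := eqVneq s' s.+1; [exact: mxs|apply: mx; lia].
Qed.
End sub_sigma_algebra.

Local Notation gap omega t y := (estimation_gap f g W r Gf Gg theta3
  (u omega) (z omega) (x omega) (q omega) t y).
Local Notation Ex F := (\int[P]_omega F omega).
Local Notation lagr omega t v := (lagrangian f g W (x omega) (q omega) t v).
Local Notation past t := (g_sigma_algebraType (past_events u t)).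

(** The estimation gap of round [t] as a function of the past and of the
    perturbation of round [t].  Clamping keeps the evaluation point in the
    decision set for all values of the perturbation. *)
Definition frozen_gap t i (y : 'rV[R]_(p i)) (s : past t * borelType R (p i)) : R :=
  (p i)%:R / delta i t * lagr s.1 t (z s.1 t i + delta i t *: clamp s.2)
    * inner (clamp s.2) (z s.1 t i - y)
  - (lagr s.1 t (z s.1 t i) - lagr s.1 t y
     - lagrangian_slope W Gf Gg (q s.1) t i * delta i t).

Lemma frozen_gapE t i (y : 'rV[R]_(p i)) omega : (1 <= t)%N ->
  frozen_gap y (omega : past t, u omega t i) = gap omega t y.
Proof.
move=> t1; rewrite /frozen_gap /estimation_gap /= clampE ?u_unit//.
by rewrite /direction -(x_def (halg omega))// innerZl.
Qed.

Lemma past_trajectory t : (1 <= t)%N ->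
  let z' := z : past t -> path_of R p in
  let q' := q : past t -> nat -> 'I_n -> 'rV[R]_m in
  let x' := x : past t -> path_of R p in
  [/\ forall i k, measurable_fun [set: past t] (fun omega => z' omega t i ord0 k),
      forall i k, measurable_fun [set: past t] (fun omega => q' omega t i ord0 k) &
      forall s j k, (1 <= s < t)%N ->
        measurable_fun [set: past t] (fun omega => x' omega s j ord0 k)].
Proof.
move=> t1; apply: (@trajectory_measurable _ (past t) id t) => [s j k st|].
  exact: past_coord.
by rewrite t1 leqnn.
Qed.

Lemma frozen_gap_measurable t i (y : 'rV[R]_(p i)) : (1 <= t)%N -> X i y ->
  measurable_fun [set: past t * borelType R (p i)] (frozen_gap y).
Proof.
move=> t1 Xy; have [mz mq mx] := past_trajectory t1.
pose S := (past t * borelType R (p i))%type.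
have fstm (F : past t -> R) : measurable_fun setT F ->
    measurable_fun [set: S] (fun s : S => F s.1).
  by move=> mF; exact: (measurableT_comp mF measurable_fst).
have mz' k := fstm (fun omega => z omega t i ord0 k) (mz i k).
have mq' j k := fstm (fun omega => q omega t j ord0 k) (mq j k).
have mx' s' j k : (1 <= s' < t)%N -> measurable_fun [set: S] (fun s : S => x s.1 s' j ord0 k).
  by move=> s't; exact: (fstm (fun omega => x omega s' j ord0 k) (mx s' j k s't)).
have mc k : measurable_fun [set: S] (fun s : S => clamp s.2 ord0 k).
  exact: (measurableT_comp (@measurable_clamp R (p i) k) measurable_snd).
have zX omega : X i (z omega t i).
  exact: (shrunk_in hB htheta2 htheta3 (z_shrunk hB (halg _) i t1)).
have mL V (XV : forall s : S, X i (V s)) := @lagrangian_measurable _ S fst t i V t1 mx' mq' XV.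
apply: measurable_funB.
  apply: measurable_funM; last first.
    apply: measurable_inner => k; first exact: mc.
    rewrite (_ : (fun s => _) = (fun s : S => z s.1 t i ord0 k - y ord0 k)); last first.
      by apply/funext => s; rewrite !mxE.
    by apply: measurable_funB; [exact: mz'|exact: measurable_cst].
  apply: measurable_funM; first exact: measurable_cst.
  apply: mL => [s|k].
    apply: (shrunk_ball hB htheta2 htheta3); last exact: clamp_le1.
    exact: (z_shrunk hB (halg _)).
  apply: (@measurable_vectorD _ S R _ (fun s : S => z s.1 t i)
    (fun s : S => delta i t *: clamp s.2)) => // {}k.
  by apply: measurable_vectorZ => //; exact: measurable_cst.
apply: measurable_funB; first apply: measurable_funB.
- by apply: mL => // s; exact: zX.
- by apply: mL => // k; exact: measurable_cst.
apply: measurable_funM; last exact: measurable_cst.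
apply: measurable_funD; first exact: measurable_cst.
apply: measurable_sum => j; apply: measurable_funM; last exact: measurable_cst.
rewrite (_ : (fun s => _) = (fun s : S => \sum_(k < n) W t i k * q s.1 t k ord0 j)); last first.
  by apply/funext => s; rewrite qmix_coord.
apply: measurable_sum => k.
by apply: measurable_funM; [exact: measurable_cst|exact: mq'].
Qed.

Lemma lagrangian_bounded t i : (1 <= t)%N -> exists2 M : R, 0 <= M &
  forall omega (v : 'rV[R]_(p i)), X i v -> `|lagr omega t v| <= M.
Proof.
move=> t1; have [_ _ _ [Ff0 Fg0 _ _] _] := hB i; have FG0 := FG_ge0 hn hB.
exists (Ff i + Fg i * \sum_(j < m) FG * (t%:R `^ theta2 / 2)).
  rewrite addr_ge0 ?(ltW Ff0)// mulr_ge0 ?(ltW Fg0)// sumr_ge0// => j _.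
  by rewrite mulr_ge0// divr_ge0// powR_ge0.
move=> omega v Xv.
apply: (le_trans (lagrangian_bound hn hA hB htheta2 htheta3 (@hu omega) (halg omega) t1 Xv)).
rewrite lerD2l ler_pM2l//; apply: ler_sum => j _.
by have /andP[] := qmix_bounds hn hA hB htheta2 htheta3 (@hu omega) (halg omega) i j t1.
Qed.

Lemma frozen_gap_bounded t i (y : 'rV[R]_(p i)) : (1 <= t)%N -> X i y ->
  exists M, forall s, `|frozen_gap (t := t) y s| <= M.
Proof.
move=> t1 Xy; have [M M0 LM] := lagrangian_bounded i t1.
have d0 := delta_gt0 theta3 hB i t.
pose SL := Gf i + m%:R * FG * Gg i * (t%:R `^ theta2 / 2).
exists ((p i)%:R / delta i t * M * (2 * Rad i) + (M + M + SL * delta i t)) => s.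
have zX := shrunk_in hB htheta2 htheta3 (z_shrunk hB (halg s.1) i t1).
have cX : X i (z s.1 t i + delta i t *: clamp s.2).
  apply: (shrunk_ball hB htheta2 htheta3); last exact: clamp_le1.
  exact: (z_shrunk hB (halg _)).
have /andP[s0 sS] := lagrangian_slope_bounds hn hA hB htheta2 htheta3 (@hu s.1) (halg s.1) i t1.
apply: (le_trans (ler_normB _ _)); apply: lerD.
  have pd : 0 <= (p i)%:R / delta i t by rewrite divr_ge0// ltW.
  rewrite !normrM (ger0_norm (ler0n _ _)) (ger0_norm (_ : 0 <= (delta i t)^-1)) ?invr_ge0 ?(ltW d0)//.
  apply: ler_pM; rewrite ?mulr_ge0 ?invr_ge0 ?(ltW d0)//.
    by rewrite ler_wpM2l// ?mulr_ge0 ?invr_ge0 ?(ltW d0)//; exact: LM.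
  apply: (le_trans (cauchy_schwarz_abs _ _)).
  apply: (@le_trans _ _ (1 * enorm (z s.1 t i - y))).
    by rewrite ler_wpM2r ?enorm_ge0// clamp_le1.
  by rewrite mul1r (dist_bound hB).
apply: (le_trans (ler_normB _ _)); apply: lerD.
  by apply: (le_trans (ler_normB _ _)); apply: lerD; exact: LM.
rewrite ger0_norm; first by rewrite ler_wpM2r// ltW.
by rewrite mulr_ge0// ltW.
Qed.

(** Given the past, the perturbation is still uniform on the sphere while the
    Lagrangian, [z] and the multipliers are fixed, so the one-point estimate
    applies to the frozen gap. *)
Lemma expected_gap_ge0 t i (y : 'rV[R]_(p i)) : (1 <= t)%N ->
  scaled_set (1 - xi t) (X i) y ->
  bounded_rv (fun omega => gap omega t y) /\ 0 <= Ex (fun omega => gap omega t y).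
Proof.
move=> t1 Sy; have Xy := shrunk_in hB htheta2 htheta3 Sy.
have mF := frozen_gap_measurable t1 Xy.
have [M FM] := frozen_gap_bounded t1 Xy.
have mu : measurable_fun [set: Omega] ((fun omega => u omega t i) : Omega -> borelType R (p i)).
  exact: sphere_measurable (hunif i t1).
have mG := past_events_measurable ru (t := t).
have gapE omega := frozen_gapE y omega t1.
have mp : measurable_fun [set: Omega]
    ((fun omega => (omega, u omega t i)) : Omega -> past t * borelType R (p i)).
  exact: measurable_fun_pair (past_measurable mG) mu.
split.
  split; last by exists M => omega; rewrite -gapE.
  under eq_fun do rewrite -gapE.
  exact: (measurableT_comp mF mp).
under eq_Rintegral do rewrite -gapE.
apply: (freeze_ge0 mu mG (@past_eventsI _ Omega R n p u t) (@past_eventsT _ Omega R n p u t)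
  _ mF (M := M)) => //.
- by move=> A B; exact: past_events_independent.
move=> omega.
have zS := z_shrunk hB (halg omega) i t1.
have [L L0 LM] := lagrangian_bounded i t1.
have /andP[s0 _] := lagrangian_slope_bounds hn hA hB htheta2 htheta3 (@hu omega) (halg omega) i t1.
have := one_point_expectation (hp i) (hunif i t1) (X_convex hB (i := i))
  (lagrangian_subdiff hn hA hB htheta2 htheta3 (@hu omega) (halg omega) (i := i) t1)
  s0 (delta_gt0 theta3 hB i t) (fun v v1 => shrunk_ball hB htheta2 htheta3 zS v1)
  (fun v v1 => shrunk_ball hB htheta2 htheta3 Sy v1) (LM omega).
set c := lagr omega t (z omega t i) - lagr omega t y - _ => h.
have {}h := h _.
have bF : bounded_rv (fun omega' => frozen_gap y (omega : past t, u omega' t i)).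
  split; last by exists M.
  by apply: (measurableT_comp mF); exact: (measurableT_comp (pair1_measurable _) mu).
have : c <= Ex (fun omega' => frozen_gap y (omega : past t, u omega' t i) + c).
  apply: le_trans (h _) _.
    have mcst (V : Omega -> R) : measurable_fun [set: borelType R (p i)] (fun=> V omega).
      exact: measurable_cst.
    apply: (@lagrangian_measurable _ (borelType R (p i)) (fun=> omega) t i
      (fun v => z omega t i + delta i t *: clamp v)) => // [v|].
      apply: (shrunk_ball hB htheta2 htheta3 zS); exact: clamp_le1.
    apply: (@measurable_vectorD _ (borelType R (p i)) R _ (fun=> z omega t i)) => // k.
    by apply: measurable_vectorZ => //; exact: measurable_clamp.
  rewrite le_eqVlt; apply/orP; left; apply/eqP; apply: eq_Rintegral => omega' _.
  by rewrite /frozen_gap/= -/c subrK clampE ?u_unit.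
by rewrite ExD ?Ex_cst//; [rewrite lerDr|exact: bounded_rv_cst].
Qed.

Lemma omega_trajectory t i k : (1 <= t)%N ->
  measurable_fun [set: Omega] (fun omega => x omega t i ord0 k).
Proof.
move=> t1; have [||_ _ mx] := @trajectory_measurable _ Omega id t.+1 _ t.+1.
- by move=> s j l /andP[s1 _]; exact: (sphere_coord (hunif j s1)).
- by rewrite ltnS leq0n leqnn.
- by apply: mx; rewrite t1 ltnSn.
Qed.

Lemma strategy_rv (h : strategy R p R) (M : R) t i (V : Omega -> 'rV[R]_(p i)) :
  adapted X h -> (1 <= t)%N -> (forall omega, X i (V omega)) ->
  (forall k, measurable_fun [set: Omega] (fun omega => V omega ord0 k)) ->
  (forall omega v, X i v -> `|h i t (x omega) v| <= M) ->
  bounded_rv (fun omega => h i t (x omega) (V omega)).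
Proof.
move=> ah t1 XV mV hM; split; last by exists M => omega; exact: hM.
apply: (adapted_measurable ah t1 _ XV _ mV) => [omega|s j k /andP[s1 _]].
  exact: (past_x hB htheta2 htheta3 (@hu _) (halg _)).
exact: omega_trajectory.
Qed.

Lemma x_decision omega t i : (1 <= t)%N -> X i (x omega t i).
Proof. exact: (x_in hB htheta2 htheta3 (@hu _) (halg _)). Qed.

Lemma f_rv t i (V : Omega -> 'rV[R]_(p i)) : (1 <= t)%N -> (forall omega, X i (V omega)) ->
  (forall k, measurable_fun [set: Omega] (fun omega => V omega ord0 k)) ->
  bounded_rv (fun omega => f i t (x omega) (V omega)).
Proof.
move=> t1 XV mV; apply: (strategy_rv hf t1 XV mV (M := Ff i)) => omega v.
exact: (f_bound hB htheta2 htheta3 (@hu _) (halg _)).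
Qed.

Lemma regret_rv (y : path_of R p) T : (forall t i, (1 <= t <= T)%N -> X i (y t i)) ->
  bounded_rv (fun omega => regret f (x omega) y T).
Proof.
move=> Xy; apply: bounded_rvB; apply: bounded_rv_sum_nat => t /andP[t1 tT];
  apply: bounded_rv_sum => i; apply: f_rv => //.
- by move=> omega; exact: x_decision.
- by move=> k; exact: omega_trajectory.
- by move=> _; apply: Xy; rewrite t1.
Qed.

Lemma violation_rv T : bounded_rv (fun omega => violation g (x omega) T).
Proof.
apply: bounded_rv_enorm => j; under eq_fun do rewrite pospartE mxE.
have [mG [M GM]] : bounded_rv (fun omega =>
    (\sum_(1 <= t < T.+1) \sum_(i < n) g i t (x omega) (x omega t i)) ord0 j).
  under eq_fun do rewrite summxE; apply: bounded_rv_sum_nat => t /andP[t1 _].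
  under eq_fun do rewrite summxE; apply: bounded_rv_sum => i.
  apply: (strategy_rv (hg j) t1 (M := Fg i)) => [omega|k|omega v].
  - exact: x_decision.
  - exact: omega_trajectory.
  - exact: (g_bound hB htheta2 htheta3 (@hu _) (halg _)).
split; first exact: (measurable_maxr (@measurable_cst _ _ _ _ _ (0 : R)) mG).
exists M => omega; rewrite maxEle; case: ifP => _; first exact: GM.
by rewrite normr0 (le_trans _ (GM omega)).
Qed.

(** Membership in the decision sets is deterministic, so a single feasible
    outcome suffices. *)
Lemma comparator_in (y : path_of R p) T : comparators P X g x T y ->
  forall t i, (1 <= t <= T)%N -> X i (y t i).
Proof. by move=> /ae_inhabited[omega fy] t i /fy[]. Qed.

Local Notation C1 :=
  (\sum_(i < n) learner_constant m p r Rad Ff Fg Gf Gg theta1 theta2 theta3 i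
    + (6 * m%:R * n%:R ^+ 2 * FG ^+ 2 * window_rate n w ^- 2 / (1 - decay n w iota)
       + 2 * m%:R * n%:R * FG ^+ 2) / theta2).
Local Notation exponent :=
  (Num.max theta1 (Num.max (1 - theta1 + 2 * theta3) (1 - theta3 + theta2))).
Local Notation gaps omega y T := (\sum_(1 <= t < T.+1) \sum_(i < n)
  gap omega t (shrink theta3 y t i)).

Lemma expected_gaps_ge0 (y : path_of R p) T :
  (forall t i, (1 <= t <= T)%N -> X i (y t i)) ->
  bounded_rv (fun omega => gaps omega y T) /\ 0 <= Ex (fun omega => gaps omega y T).
Proof.
move=> Xy; have h t i (tT : (1 <= t < T.+1)%N) :=
  expected_gap_ge0 (proj1 (andP tT)) (@shrink_in R n p X theta3 y t i (Xy t i tT)).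
split.
  by apply: bounded_rv_sum_nat => t tT; apply: bounded_rv_sum => i; have [] := h t i tT.
elim: T {Xy} h => [|T IH] h.
  by under eq_Rintegral do rewrite big_nil; rewrite Ex_cst.
have hT (t : nat) (i : 'I_n) (tT : (1 <= t < T.+1)%N) : (1 <= t < T.+2)%N by lia.
under eq_Rintegral do rewrite big_nat_recr//=.
have b1 : bounded_rv (fun omega => gaps omega y T).
  by apply: bounded_rv_sum_nat => t tT; apply: bounded_rv_sum => i; have [] := h t i (hT t i tT).
have l : (1 <= T.+1 < T.+2)%N by rewrite ltnSn.
have b2 i : bounded_rv (fun omega => gap omega T.+1 (shrink theta3 y T.+1 i)).
  by have [] := h T.+1 i l.
rewrite ExD//; last exact: bounded_rv_sum.
rewrite addr_ge0//; first by apply: IH => t i tT; exact: h (hT t i tT).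
by rewrite Ex_sum//; apply: sumr_ge0 => i _; have [] := h T.+1 i l.
Qed.

Lemma expected_regret_bound (y : path_of R p) T : (1 <= T)%N ->
  comparators P X g x T y ->
  ('E_P[fun omega => regret f (x omega) y T] <=
   (C1 * T%:R `^ exponent
    + max_over (path_constant m p r Rad Fg) * T%:R `^ theta1 * path_length y T)%:E)%E.
Proof.
move=> T1 cy; have Xy := comparator_in cy.
have bR := regret_rv Xy; have [bG G0] := expected_gaps_ge0 Xy.
rewrite expectation_Ex// lee_fin.
set K := C1 * _ + _.
have : Ex (fun omega => regret f (x omega) y T + gaps omega y T) <= K.
  apply: Ex_le_ae; first exact: bounded_rvD.
  apply: filterS cy => omega fy.
  have := run_bound hn hm hp hW hA hB htheta1 htheta2 htheta3 (@hu omega) (halg omega)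
    T1 fy (c := 0) _.
  rewrite inner0l enorm0 expr0n/= mulr0 mul0r addr0 subr0 lerBrDr; apply.
  by move=> j; rewrite mxE.
by rewrite ExD//; apply: le_trans; rewrite lerDl.
Qed.

Lemma regret_constant_ge0 : 0 <= C1.
Proof.
have FG0 := FG_ge0 hn hB.
have [w01 i0 _] := hA; have /andP[k0 k1] := window_rate_bounds hn w01.
have /andP[l0 l1] := decay_bounds hn hA.
have t20 : 0 < theta2 by case/andP: htheta2.
have t2b : theta2 < 1 / 3 by case/andP: htheta2; case/andP: htheta1; lra.
have t1b : theta1 < 1 by case/andP: htheta1.
have t32 : theta2 < theta3 by case/andP: htheta3.
have t31 : theta3 <= (theta1 - theta2) / 2 by case/andP: htheta3.
apply: addr_ge0.
  apply: sumr_ge0 => i _; have [_ [r0 Rad0] _ [Ff0 Fg0 Gf0 Gg0] _] := hB i.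
  have rR0 : 0 <= 2 * r i + Rad i by rewrite addr_ge0 ?mulr_ge0 ?(ltW r0) ?(ltW Rad0).
  rewrite /learner_constant !addr_ge0// divr_ge0 ?mulr_ge0 ?exprn_ge0 ?(ltW Fg0)
    ?(ltW Gf0) ?(ltW Gg0) ?(ltW Rad0) ?(ltW r0) ?(ltW Ff0)//; lra.
rewrite divr_ge0 ?(ltW t20)// addr_ge0 ?mulr_ge0 ?sqr_ge0 ?invr_ge0 ?sqr_ge0 ?(ltW k0)//.
by rewrite subr_ge0 ltW.
Qed.

Lemma regret_ge (y : path_of R p) T omega : (forall t i, (1 <= t <= T)%N -> X i (y t i)) ->
  - (2 * T%:R * \sum_(i < n) Ff i) <= regret f (x omega) y T.
Proof.
move=> Xy; rewrite /regret -sumrB.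
have -> : - (2 * T%:R * \sum_(i < n) Ff i) =
    \sum_(1 <= t < T.+1) \sum_(i < n) - (2 * Ff i).
  by rewrite sumr_const_nat subn1/= sumrN -mulr_sumr -[RHS]mulr_natl; ring.
rewrite big_nat_cond [leRHS]big_nat_cond; apply: ler_sum => t.
rewrite andbT ltnS => tT; have /andP[t1 _] := tT; rewrite -sumrB; apply: ler_sum => i _.
have := f_bound hB htheta2 htheta3 (@hu omega) (halg omega) t1 (x_decision omega i t1).
have := f_bound hB htheta2 htheta3 (@hu omega) (halg omega) t1 (Xy t i tT).
by rewrite !ler_norml; lra.
Qed.

Local Notation C21 := (2 * n%:R *
  (1 + max_over (fun i => Ff i ^+ 2 / (Fg i ^+ 2 * (1 - theta1 + 2 * theta3)))
   + 1 / (1 - theta2))).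
Local Notation C2 := (C21 * (2 * \sum_(i < n) Ff i + C1)).

Lemma max_over_ge0 (F : 'I_n -> R) : 0 <= max_over F.
Proof. exact: bigmax_ge_id. Qed.

Hypothesis hXT_static : forall T, (1 <= T)%N -> static_comparators P X g x T !=set0.

(** With a static comparator the path length vanishes; the multiplier is chosen
    to maximize the left side of the bound on a run. *)
Lemma expected_sqr_violation T : (1 <= T)%N ->
  Ex (fun omega => violation g (x omega) T ^+ 2) <= C2 * T%:R `^ (2 - theta2).
Proof.
move=> T1; have [y [cy [v yv]]] := hXT_static T1; have Xy := comparator_in cy.
have bV := violation_rv T; have [bG G0] := expected_gaps_ge0 Xy.
have bV2 : bounded_rv (fun omega => violation g (x omega) T ^+ 2).
  by under eq_fun do rewrite expr2; exact: bounded_rvM.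
have t20 : 0 < theta2 by case/andP: htheta2.
have t2b : theta2 < 1 / 3 by case/andP: htheta2; case/andP: htheta1; lra.
have t1b : theta1 < 1 by case/andP: htheta1.
have t32 : theta2 < theta3 by case/andP: htheta3.
have t31 : theta3 <= (theta1 - theta2) / 2 by case/andP: htheta3.
have T0 : 0 < T%:R :> R by rewrite ltr0n.
have n0 : 0 < n%:R :> R by rewrite ltr0n.
have C10 := regret_constant_ge0.
have PL0 : path_length y T = 0.
  rewrite /path_length big_nat_cond big1// => t /andP[/andP[t1 tT] _].
  have e : y t = v by apply: yv; rewrite t1 ltnW.
  by rewrite big1// => i _; rewrite (yv t.+1 tT) e subrr enorm0.
set B := (1 + 1 / (1 - theta2)) / 2; set D := B * T%:R `^ (1 - theta2).
have B0 : 0 < B by rewrite divr_gt0// addr_gt0// divr_gt0//; lra.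
have D0 : 0 < D by rewrite mulr_gt0// powR_gt0.
pose s := (2 * n%:R * D)^-1.
have s0 : 0 < s by rewrite /s invr_gt0 mulr_gt0// mulr_gt0.
set SF := \sum_(i < n) Ff i.
have SF0 : 0 <= SF by apply: sumr_ge0 => i _; have [_ _ _ [/ltW]] := hB i.
have eT : T%:R `^ exponent <= T%:R :> R.
  rewrite -[leRHS](powRr1 (ltW T0)) ler_powR ?ler1n// !ge_max; lra.
have main : Ex (fun omega => s / 2 * violation g (x omega) T ^+ 2 + gaps omega y T) <=
    (C1 + 2 * SF) * T%:R.
  apply: Ex_le_ae; first by apply: bounded_rvD => //; exact: bounded_rvZ.
  apply: filterS cy => omega fy.
  pose c := s *: pospart (\sum_(1 <= t < T.+1) \sum_(i < n) g i t (x omega) (x omega t i)).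
  have c0 j : 0 <= c ord0 j by rewrite mxE mulr_ge0 ?(ltW s0)// pospart_ge0.
  have := run_bound hn hm hp hW hA hB htheta1 htheta2 htheta3 (@hu omega) (halg omega)
    T1 fy c0.
  rewrite innerZl inner_pospart enormZ -[enorm _]/(violation g (x omega) T) PL0 mulr0 addr0.
  rewrite (gtr0_norm s0) exprMn -/B -/D.
  have hR := regret_ge omega Xy; rewrite -/SF in hR.
  set V := violation _ _ _.
  have -> : n%:R * (s ^+ 2 * V ^+ 2) * D = s / 2 * V ^+ 2.
    by rewrite /s; field; rewrite !gt_eqF.
  have h2 := ler_wpM2l C10 eT.
  lra.
rewrite ExD ?ExZ// in main; last exact: bounded_rvZ.
have : s / 2 * Ex (fun omega => violation g (x omega) T ^+ 2) <= (C1 + 2 * SF) * T%:R by lra.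
have s2 : 0 < s / 2 by rewrite divr_gt0.
rewrite mulrC -ler_pdivlMr// => h; apply: (le_trans h).
have -> : (C1 + 2 * SF) * T%:R / (s / 2) = 4 * n%:R * B * (2 * SF + C1) * T%:R `^ (2 - theta2).
  have -> : T%:R `^ (2 - theta2) = T%:R * T%:R `^ (1 - theta2) :> R.
    have -> : 2 - theta2 = 1 + (1 - theta2) by ring.
    by rewrite powRD ?(gt_eqF T0) ?implybT// powRr1// ltW.
  have -> : (s / 2)^-1 = 4 * n%:R * D by rewrite /s invfM !invrK; ring.
  by rewrite /D; set c1 := C1; ring.
have SC0 : 0 <= 2 * SF + C1 by apply: addr_ge0 => //; exact: mulr_ge0.
rewrite ler_wpM2r ?powR_ge0// ler_wpM2r//.
rewrite /B; have := max_over_ge0 (fun i => Ff i ^+ 2 / (Fg i ^+ 2 * (1 - theta1 + 2 * theta3))).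
set M := max_over _ => M0.
have -> : 4 * n%:R * ((1 + 1 / (1 - theta2)) / 2) = 2 * n%:R * (1 + 1 / (1 - theta2)).
  by set k := 1 / _; field.
by rewrite ler_pM2l ?mulr_gt0//; lra.
Qed.

(** Cauchy-Schwarz in the form [V <= V ^ 2 / (2 K) + K / 2], with the bound itself
    as [K]. *)
Lemma expected_violation_bound T : (1 <= T)%N ->
  ('E_P[fun omega => violation g (x omega) T] <=
   (Num.sqrt C2 * T%:R `^ (1 - theta2 / 2))%:E)%E.
Proof.
move=> T1; have bV := violation_rv T; have h := expected_sqr_violation T1.
have bV2 : bounded_rv (fun omega => violation g (x omega) T ^+ 2).
  by under eq_fun do rewrite expr2; exact: bounded_rvM.
have t2b : theta2 < 1 / 3 by case/andP: htheta2; case/andP: htheta1; lra.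
have T0 : 0 < T%:R :> R by rewrite ltr0n.
have C20 : 0 < C2.
  apply: mulr_gt0.
    rewrite !mulr_gt0 ?ltr0n// addr_gt0//; last by rewrite divr_gt0//; lra.
    by rewrite ltr_wpDr// max_over_ge0.
  rewrite ltr_wpDr ?regret_constant_ge0// mulr_gt0//.
  rewrite (bigD1 (Ordinal hn))//= ltr_wpDr//.
    by apply: sumr_ge0 => i _; have [_ _ _ [/ltW]] := hB i.
  by have [_ _ _ []] := hB (Ordinal hn).
set K := Num.sqrt C2 * _.
have K0 : 0 < K by rewrite mulr_gt0 ?sqrtr_gt0 ?powR_gt0.
have KE : C2 * T%:R `^ (2 - theta2) = K ^+ 2.
  rewrite /K exprMn sqr_sqrtr ?(ltW C20)//; congr (_ * _).
  by rewrite -powR_mulrn ?powR_ge0// -powRrM; congr (_ `^ _); lra.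
rewrite KE in h; rewrite expectation_Ex// lee_fin.
have : Ex (fun omega => violation g (x omega) T) <=
    Ex (fun omega => (2 * K)^-1 * violation g (x omega) T ^+ 2 + K / 2).
  apply: Ex_le => // [|omega].
    by apply: bounded_rvD; [exact: bounded_rvZ|exact: bounded_rv_cst].
  set V := violation _ _ _.
  have -> : (2 * K)^-1 * V ^+ 2 + K / 2 = V + (2 * K)^-1 * (V - K) ^+ 2.
    by field; rewrite gt_eqF.
  by rewrite lerDl mulr_ge0 ?sqr_ge0// invr_ge0 mulr_ge0// ltW.
rewrite ExD ?Ex_cst ?ExZ//; last 2 first.
- exact: bounded_rvZ.
- exact: bounded_rv_cst.
move/le_trans; apply.
have e : (2 * K)^-1 * K ^+ 2 + K / 2 = K by field; rewrite gt_eqF.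
by rewrite -[leRHS]e lerD2r ler_wpM2l// invr_ge0 mulr_ge0// ltW.
Qed.
End process.

Theorem theorem1
  (R : realType) (n m : nat) (hn : (0 < n)%N) (hm : (0 < m)%N)
  (p : 'I_n -> nat) (hp : forall i, (0 < p i)%N)
  (* decision sets and the adversary *)
  (X : forall i : 'I_n, set 'rV[R]_(p i))
  (f : strategy R p R) (g : strategy R p 'rV[R]_m)
  (hf : adapted X f) (hg : forall j : 'I_m, adapted X (component g j))
  (* communication graphs *)
  (E : nat -> rel 'I_n) (W : nat -> 'M[R]_n) (hW : mixing_matrix E W)
  (w : R) (iota : nat) (hA : assumption_A E W w iota)
  (r Rad Ff Fg Gf Gg : 'I_n -> R)
  (hB : assumption_B X r Rad Ff Fg Gf Gg f g)
  (* constants of the parameter sequences *)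
  (theta1 theta2 theta3 : R)
  (htheta1 : 0 < theta1 < 1) (htheta2 : 0 < theta2 < theta1 / 3)
  (htheta3 : theta2 < theta3 <= (theta1 - theta2) / 2)
  (* the random vectors *)
  (d : measure_display) (Omega : measurableType d) (P : probability Omega R)
  (u : Omega -> path_of R p)
  (hunif : forall (i : 'I_n) (t : nat), (1 <= t)%N ->
     uniform_on_sphere P (fun omega => u omega t i))
  (hindep : independent_vectors P u)
  (* the run of the algorithm, from a deterministic initialization z1 *)
  (z1 : profile R p) (z x : Omega -> path_of R p)
  (q : Omega -> nat -> 'I_n -> 'rV[R]_m)
  (hz1 : forall omega, z omega 1%N = z1)
  (halg : forall omega, algorithm1 X W
     (fun i t => r i ^+ 2 /
        (4 * m%:R * (p i)%:R ^+ 2 * Fg i ^+ 2 * t%:R `^ theta1))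
     (fun i t => 2 / t%:R `^ theta2)
     (fun i t => 1 / t%:R `^ (1 - theta2))
     (fun i t => 1 / (t + 1)%:R `^ theta3)
     (fun i t => r i / (t + 1)%:R `^ theta3)
     f g (u omega) (z omega) (x omega) (q omega))
  (hXT : forall T, (1 <= T)%N -> comparators P X g x T !=set0)
  (hXT_static : forall T, (1 <= T)%N -> static_comparators P X g x T !=set0)
  (T : nat) (hT : (1 <= T)%N) :
  let tau : R := (1 - w / (2 * n%:R ^+ 2)) ^- 2 in
  let lambda : R := (1 - w / (2 * n%:R ^+ 2)) `^ (1 / iota%:R) in
  let FG : R := max_over Fg in
  let C0 : R := 6 * m%:R * n%:R ^+ 2 * FG ^+ 2 * tau / (1 - lambda)
                + 2 * m%:R * n%:R * FG ^+ 2 in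
  let C1 : R :=
    \sum_(i < n)
      (m%:R * FG * Gg i * (2 * r i + Rad i) / (1 - theta3 + theta2)
       + Gf i * (2 * r i + Rad i) / (1 - theta3)
       + 8 * m%:R * (p i)%:R ^+ 2 * Fg i ^+ 2 * Rad i ^+ 2 / r i ^+ 2
       + Ff i ^+ 2 / (4 * m%:R * Fg i ^+ 2 * (1 - theta1 + 2 * theta3))
       + 16 * m%:R * (p i)%:R ^+ 2 * Fg i ^+ 2 * Rad i ^+ 2 / r i ^+ 2)
    + C0 / theta2 in
  let C21 : R :=
    2 * n%:R *
      (1 + max_over (fun i => Ff i ^+ 2 /
                       (Fg i ^+ 2 * (1 - theta1 + 2 * theta3)))
         + 1 / (1 - theta2)) in
  let C2 : R := C21 * (2 * \sum_(i < n) Ff i + C1) in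
  (forall y : path_of R p, comparators P X g x T y ->
     ('E_P[fun omega => regret f (x omega) y T] <=
       (C1 * T%:R `^ Num.max theta1
               (Num.max (1 - theta1 + 2 * theta3) (1 - theta3 + theta2))
        + max_over (fun i => 8 * m%:R * (p i)%:R ^+ 2 * Fg i ^+ 2 * Rad i
                               / r i ^+ 2)
          * T%:R `^ theta1 * path_length y T)%:E)%E) /\
  ('E_P[fun omega => violation g (x omega) T] <=
     (Num.sqrt C2 * T%:R `^ (1 - theta2 / 2))%:E)%E.

Proof.
split; last exact: (expected_violation_bound hn hm hp hf hg hW hA hB htheta1
  htheta2 htheta3 hunif hindep hz1 halg hXT_static hT).
move=> y; exact: (expected_regret_bound hn hm hp hf hg hW hA hB htheta1
  htheta2 htheta3 hunif hindep hz1 halg hT).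
Qed.
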